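(* Let $\mathcal S$ be an operator system. The following are equivalent: (i) $\mathcal S$ is nuclear; (ii) if $\Phi:\mathcal T_1\to\mathcal T_2$ is a complete order quotient map for operator systems $\mathcal T_1$ and $\mathcal T_2$, then $\mathrm{id}_{\mathcal S}\otimes\Phi:\mathcal S\otimes_{\min}\mathcal T_1\to\mathcal S\otimes_{\min}\mathcal T_2$ is a complete order quotient map; (iii) if $\Phi:\mathfrak C_I\to\mathcal T$ is a complete order quotient map for an index set $I$ and an operator system $\mathcal T$, then $\mathrm{id}_{\mathcal S}\otimes\Phi:\mathcal S\otimes_{\min}\mathfrak C_I\to\mathcal S\otimes_{\min}\mathcal T$ is a complete order quotient map; (iv) if $\Phi:\mathcal T\to E$ is a complete order quotient map for an operator system $\mathcal T$ and a finite dimensional operator system $E$, then $\mathrm{id}_{\mathcal S}\otimes\Phi:\mathcal S\otimes_{\min}\mathcal T\to\mathcal S\otimes_{\min}E$ is a complete order quotient map.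
   Context: Operator systems are abstract (Choi–Effros) operator systems, not assumed complete. For a linear map $\varphi$, $\varphi_n$ is its entrywise amplification. Complete order quotient map: a unital completely positive surjection $\varphi:\mathcal S\to\mathcal T$ of operator systems such that for all $n$, all $Q\in M_n(\mathcal T)^+$ and all $\varepsilon>0$ there is $P\in M_n(\mathcal S)^+$ with $\varphi_n(P)=Q+\varepsilon I_n\otimes 1_{\mathcal T}$. Tensor products: for operator systems $\mathcal S,\mathcal T$ the following are operator systems with underlying space the algebraic (uncompleted) tensor product $\mathcal S\otimes\mathcal T$ and unit $1_{\mathcal S}\otimes1_{\mathcal T}$. $M_n(\mathcal S\otimes_{\min}\mathcal T)^+$ is the set of $X\in M_n(\mathcal S\otimes\mathcal T)$ with $(\varphi\otimes\psi)_n(X)\in M_{nkl}^+$ for all unital completely positive $\varphi:\mathcal S\to M_k$, $\psi:\mathcal T\to M_l$, $k,l\in\mathbb N$. $M_n(\mathcal S\otimes_{\max}\mathcal T)^+$ is the set of $X$ such that for all $\varepsilon>0$, $X+\varepsilon I_n\otimes1_{\mathcal S}\otimes1_{\mathcal T}$ has the form $\alpha(P\otimes Q)\alpha^*$ with $P\in M_k(\mathcal S)^+$, $Q\in M_l(\mathcal T)^+$, $\alpha\in M_{n,kl}$, $k,l\in\mathbb N$. $\mathcal S$ is nuclear if $\mathcal S\otimes_{\min}\mathcal T=\mathcal S\otimes_{\max}\mathcal T$ (equal positive cones at every matrix level) for every operator system $\mathcal T$. Coproduct: for a family $\{\mathcal S_\lambda\}_{\lambda\in\Lambda}$ of operator systems,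 $\oplus_1\{\mathcal S_\lambda:\lambda\in\Lambda\}$ is the algebraic direct sum (finitely supported families) modulo the subspace spanned by the differences $n_{\lambda_1}-n_{\lambda_2}$, where $n_\lambda$ is $1_{\mathcal S_\lambda}$ in coordinate $\lambda$ and $0$ elsewhere (so all units are identified). Elements of $M_n$ of it are written $\sum_{\lambda\in F}x_\lambda$ with $F\subset\Lambda$ finite and $x_\lambda\in M_n(\mathcal S_\lambda)$; the involution is $(\sum x_\lambda)^*=\sum x_\lambda^*$, and $\sum_{\lambda\in F}x_\lambda\ge0$ iff $\sum_{\lambda\in F}\omega_\lambda(x_\lambda)\ge0$ for every family of states $\omega_\lambda$ on $M_n(\mathcal S_\lambda)$, $\lambda\in F$, whose restrictions to $M_n\cong M_n\otimes\mathbb C1_{\mathcal S_\lambda}$ all coincide. The order unit is the common class of the $n_\lambda$. The operator system $\mathfrak C_I$: let $I$ be a (nonempty) index set and $\{I_k\}_{k\in\mathbb N}$ a sequence of index sets, each of the same cardinality as $I$. For $\iota_k\in I_k$ let $\mathfrak C_{\iota_k}$ be the operator subsystem of (a copy, labelled $\iota_k$, of) $M_k(C([0,1]))$ spanned by $e_{ij}\otimes1$ and $e_{ij}\otimes t$, $1\le i,j\le k$, where $1,t\in C([0,1])$ are the constant function and the coordinate function. Then $\mathfrak C_I:=\oplus_1\{\mathfrak C_{\iota_k}:k\in\mathbb N,\iota_k\in I_k\}$. *)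

(* Defs.v *)
(* Scalars are the complex numbers R[i] over an arbitrary R : realType. *)
From HB Require Import structures.
From mathcomp Require Import all_boot all_order all_algebra.
From mathcomp Require Import finmap.
From mathcomp Require Import generic_quotient ring_quotient.
From mathcomp Require Import sesquilinear spectral.
From mathcomp Require Import freeg complex mxtens.
From mathcomp Require Import all_classical all_reals.
From mathcomp Require Import topology normedtype.

Set Implicit Arguments.
Unset Strict Implicit.
Unset Printing Implicit Defensive.

Import Order.TTheory GRing.Theory Num.Theory numFieldNormedType.Exports.

Local Open Scope classical_set_scope.
Local Open Scope ring_scope.
Local Open Scope sesquilinear_scope.

Section Span.
Variables (K : fieldType) (V : lmodType K) (U : set V).

Definition lin_span : set V := [set x | exists (n : nat) (c : 'I_n -> K)
  (u : 'I_n -> V), (forall i, U (u i)) /\ x = \sum_i c i *: u i].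

Definition span_pred : {pred V} := fun x => `[< lin_span x >].

Lemma span_predP x : reflect (lin_span x) (x \in span_pred).
Proof. exact: asboolP. Qed.

Lemma lin_span0 : lin_span 0.
Proof.
exists 0%N, (fun=> 0), (fun=> 0); split; first by case.
by rewrite big_ord0.
Qed.

Lemma lin_spanZD a x y : lin_span x -> lin_span y -> lin_span (a *: x + y).
Proof.
move=> [n [c [u [Uu ->]]]] [m [d [v [Uv ->]]]].
exists (n + m)%N,
  (fun i : 'I_(n + m) => match fintype.split i with inl j => a * c j | inr j => d j end),
  (fun i : 'I_(n + m) => match fintype.split i with inl j => u j | inr j => v j end).
split; first by move=> i; case: (fintype.split i).
rewrite big_split_ord scaler_sumr /=; congr (_ + _); apply: eq_bigr => i _.
  have -> : fintype.split (lshift m i) = inl i by exact: (unsplitK (inl i)).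
  by rewrite scalerA.
by have -> : fintype.split (rshift n i) = inr i by exact: (unsplitK (inr i)).
Qed.

Lemma lin_span_gen x : U x -> lin_span x.
Proof.
move=> Ux; exists 1%N, (fun=> 1), (fun=> x); split => //.
by rewrite big_ord1 scale1r.
Qed.

Lemma span_pred_submod : submod_closed span_pred.
Proof.
split; first exact/span_predP/lin_span0.
by move=> a x y /span_predP Sx /span_predP Sy; apply/span_predP/lin_spanZD.
Qed.

HB.instance Definition _ :=
  GRing.isSubmodClosed.Build K V span_pred span_pred_submod.

Definition span_sub := {x : V | x \in span_pred}.

HB.instance Definition _ := Choice.on span_sub.
HB.instance Definition _ := SubChoice.on span_sub.
HB.instance Definition _ := [SubChoice_isSubLmodule of span_sub by <:].

Local Open Scope quotient_scope.

Definition qspan := Quotient.quot span_pred.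

HB.instance Definition _ := GRing.Zmodule.on qspan.
HB.instance Definition _ : EqQuotient V (Quotient.equiv span_pred) qspan :=
  EqQuotient.on qspan.

Definition qproj (x : V) : qspan := \pi_qspan x.

Lemma qproj_eq x y : qproj x = qproj y <-> lin_span (x - y).
Proof.
split=> [/eqmodP|] h; last by apply/eqmodP/span_predP.
exact/span_predP.
Qed.

Lemma qprojD x y : qproj (x + y) = qproj x + qproj y.
Proof. exact: (Quotient.pi_add span_pred). Qed.

Lemma qproj_repr (x : qspan) : qproj (repr x) = x.
Proof. exact: reprK. Qed.

Definition qscale (a : K) (x : qspan) : qspan := qproj (a *: repr x).

Lemma qprojZ a x : qproj (a *: x) = qscale a (qproj x).
Proof.
apply/qproj_eq; rewrite -scalerBr -[_ *: _]addr0.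
by apply: lin_spanZD; [apply/qproj_eq; rewrite qproj_repr|exact: lin_span0].
Qed.

Lemma qscaleA a b x : qscale a (qscale b x) = qscale (a * b) x.
Proof. by rewrite -[x]qproj_repr -!qprojZ scalerA. Qed.

Lemma qscale1 : left_id 1 qscale.
Proof. by move=> x; rewrite -[x]qproj_repr -qprojZ scale1r. Qed.

Lemma qscaleDr : right_distributive qscale +%R.
Proof.
move=> a x y; rewrite -[x]qproj_repr -[y]qproj_repr.
by rewrite -qprojD -!qprojZ -qprojD scalerDr.
Qed.

Lemma qscaleDl x : {morph qscale^~ x : a b / a + b}.
Proof.
by move=> a b; rewrite -[x]qproj_repr -!qprojZ -qprojD scalerDl.
Qed.

HB.instance Definition _ :=
  GRing.Zmodule_isLmodule.Build K qspan qscaleA qscale1 qscaleDr qscaleDl.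

Lemma qproj_linear : linear qproj.
Proof. by move=> a x y; rewrite qprojD qprojZ. Qed.

End Span.

Section DirectSum.
Variables (K : fieldType) (L : choiceType) (V : L -> lmodType K).

Record dsum := DSum {
  dsum_val :> forall l, V l;
  dsum_finite : finite_set [set l | dsum_val l != 0] }.

Lemma dsumP (x y : dsum) : (forall l, x l = y l) -> x = y.
Proof.
case: x y => [x fx] [y fy] /= exy.
have {exy} exy : x = y by exact: functional_extensionality_dep.
by case: y / exy fy => fy; congr DSum; exact: Prop_irrelevance.
Qed.

HB.instance Definition _ := gen_eqMixin dsum.
HB.instance Definition _ := gen_choiceMixin dsum.

Fact dsum_zero_subproof : finite_set [set l | (0 : V l) != 0].
Proof.
by rewrite (_ : [set _ | _] = set0)//; apply/seteqP; split=> l //=; rewrite eqxx.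
Qed.
Definition dsum_zero := DSum dsum_zero_subproof.

Fact dsum_add_subproof (x y : dsum) : finite_set [set l | x l + y l != 0].
Proof.
have := dsum_finite x; have := dsum_finite y => fy fx.
apply: (@sub_finite_set _ _ ([set l | x l != 0] `|` [set l | y l != 0])).
  move=> l /= h; case: (eqVneq (x l) 0) => [x0|]; last by left.
  by right; move: h; rewrite x0 add0r.
by rewrite finite_setU.
Qed.
Definition dsum_add x y := DSum (dsum_add_subproof x y).

Fact dsum_opp_subproof (x : dsum) : finite_set [set l | - x l != 0].
Proof.
by apply: sub_finite_set (dsum_finite x) => l /=; rewrite oppr_eq0.
Qed.
Definition dsum_opp x := DSum (dsum_opp_subproof x).

Fact dsum_scale_subproof (a : K) (x : dsum) :
  finite_set [set l | a *: x l != 0].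
Proof.
apply: sub_finite_set (dsum_finite x) => l /=; apply: contra_neq => ->.
by rewrite scaler0.
Qed.
Definition dsum_scale a x := DSum (dsum_scale_subproof a x).

Fact dsum_addA : associative dsum_add.
Proof. by move=> x y z; apply: dsumP => l /=; rewrite addrA. Qed.
Fact dsum_addC : commutative dsum_add.
Proof. by move=> x y; apply: dsumP => l /=; rewrite addrC. Qed.
Fact dsum_add0 : left_id dsum_zero dsum_add.
Proof. by move=> x; apply: dsumP => l /=; rewrite add0r. Qed.
Fact dsum_addN : left_inverse dsum_zero dsum_opp dsum_add.
Proof. by move=> x; apply: dsumP => l /=; rewrite addNr. Qed.

HB.instance Definition _ :=
  GRing.isZmodule.Build dsum dsum_addA dsum_addC dsum_add0 dsum_addN.

Fact dsum_scaleA a b x : dsum_scale a (dsum_scale b x) = dsum_scale (a * b) x.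
Proof. by apply: dsumP => l /=; rewrite scalerA. Qed.
Fact dsum_scale1 : left_id 1 dsum_scale.
Proof. by move=> x; apply: dsumP => l /=; rewrite scale1r. Qed.
Fact dsum_scaleDr : right_distributive dsum_scale +%R.
Proof. by move=> a x y; apply: dsumP => l /=; rewrite scalerDr. Qed.
Fact dsum_scaleDl x : {morph dsum_scale^~ x : a b / a + b}.
Proof. by move=> a b; apply: dsumP => l /=; rewrite scalerDl. Qed.

HB.instance Definition _ := GRing.Zmodule_isLmodule.Build K dsum
  dsum_scaleA dsum_scale1 dsum_scaleDr dsum_scaleDl.

Fact dsum_in_subproof l (v : V l) :
  finite_set [set m | dfwith (fun m => 0 : V m) l v m != 0].
Proof.
apply: (@sub_finite_set _ _ [set l]); last exact: finite_set1.
move=> m /=; case: (eqVneq l m) => [<- //|lm].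
by rewrite dfwithout// eqxx.
Qed.

Definition dsum_in l (v : V l) : dsum := DSum (dsum_in_subproof v).

End DirectSum.

Section AlgebraicTensor.
Variables (K : fieldType) (V W : lmodType K).

Definition tens_rel : set {freeg (V * W)%type / K} := [set z |
  [\/ exists v1 v2 w,
        z = << (v1 + v2, w) >> - << (v1, w) >> - << (v2, w) >>,
      exists v w1 w2,
        z = << (v, w1 + w2) >> - << (v, w1) >> - << (v, w2) >>,
      exists a v w, z = << (a *: v, w) >> - << a *g (v, w) >>
    | exists a v w, z = << (v, a *: w) >> - << a *g (v, w) >>]].

Definition tprod := qspan tens_rel.
HB.instance Definition _ := GRing.Lmodule.on tprod.

Definition tens (v : V) (w : W) : tprod := qproj tens_rel << (v, w) >>.

(* Linear extension to the tensor product of a map b of two variables;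
   meaningful when b is bilinear (see tlift_tens and tlift_linear), when it
   does not depend on the representative chosen by repr. *)
Definition tlift (X : lmodType K) (b : V -> W -> X) (z : tprod) : X :=
  fglift (fun p => b p.1 p.2) (repr z).

Lemma fglift_linear (X : lmodType K) (g : V * W -> X) : linear (fglift g).
Proof.
have gB := lift_is_additive g.
have g0 : fglift g 0 = 0 by rewrite -[0]subr0 gB subrr.
have gN x : fglift g (- x) = - fglift g x by rewrite -sub0r gB g0 sub0r.
have gD x y : fglift g (x + y) = fglift g x + fglift g y.
  by rewrite -{1}[y]opprK gB gN opprK.
have gS (s : seq (V * W)) F : fglift g (\sum_(p <- s) F p) =
    \sum_(p <- s) fglift g (F p) by exact: (big_morph _ gD g0).
move=> a x y; rewrite gD; congr (_ + _).
rewrite -[LHS]/(fglift g (\sum_(p <- dom x) << a * coeff p x *g p >>)) gS.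
rewrite -{3}[x]freeg_sumE gS scaler_sumr.
by apply: eq_bigr => p _; rewrite !liftU scalerA.
Qed.

Section Lift.
Variables (X : lmodType K) (b : V -> W -> X).
Hypothesis b_linearl : forall w, linear (b^~ w).
Hypothesis b_linearr : forall v, linear (b v).

Let g (p : V * W) := b p.1 p.2.

Lemma tlift_qproj x : tlift b (qproj tens_rel x) = fglift g x.
Proof.
have gl := fglift_linear g.
have g0 : fglift g 0 = 0 by rewrite -[0 in LHS]subr0 lift_is_additive subrr.
have gZ a y : fglift g (a *: y) = a *: fglift g y.
  by rewrite -[a *: y]addr0 gl g0 addr0.
have gB y z : fglift g (y - z) = fglift g y - fglift g z.
  exact: lift_is_additive.
have bDl v1 v2 w : b (v1 + v2) w = b v1 w + b v2 w.
  by have := b_linearl w 1 v1 v2; rewrite !scale1r.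
have bDr v w1 w2 : b v (w1 + w2) = b v w1 + b v w2.
  by have := b_linearr v 1 w1 w2; rewrite !scale1r.
have b0l w : b 0 w = 0 by apply: (addrI (b 0 w)); rewrite -bDl !addr0.
have b0r v : b v 0 = 0 by apply: (addrI (b v 0)); rewrite -bDr !addr0.
have bZl a v w : b (a *: v) w = a *: b v w.
  by have := b_linearl w a v 0; rewrite b0l !addr0.
have bZr a v w : b v (a *: w) = a *: b v w.
  by have := b_linearr v a w 0; rewrite b0r !addr0.
have g_rel z : tens_rel z -> fglift g z = 0.
  case=> -[? [? [? ->]]]; rewrite !gB !liftU /g /= ?scale1r.
  - by rewrite bDl -addrA -opprD subrr.
  - by rewrite bDr -addrA -opprD subrr.
  - by rewrite bZl subrr.
  - by rewrite bZr subrr.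
have g_span z : lin_span tens_rel z -> fglift g z = 0.
  move=> [n [c [u [Uu ->]]]]; elim/big_rec: _ => // i y _ y0.
  by rewrite gl y0 g_rel// scaler0 addr0.
apply/eqP; rewrite -subr_eq0 /tlift -gB; apply/eqP/g_span.
by apply/qproj_eq; rewrite qproj_repr.
Qed.

Lemma tlift_tens v w : tlift b (tens v w) = b v w.
Proof. by rewrite tlift_qproj liftU scale1r. Qed.

Lemma tlift_linear : linear (tlift b).
Proof.
move=> a x y; rewrite -[x]qproj_repr -[y]qproj_repr -qproj_linear.
by rewrite !tlift_qproj fglift_linear.
Qed.

End Lift.
End AlgebraicTensor.

Section OperatorSystems.
Variable R : realType.
Local Notation C := R[i].

(* The data of a matrix-ordered *-vector space with a distinguished element.
   Tensor products and coproducts are defined at this level; the Choi-Effros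
   axioms are stated separately in is_opsys. Matrix levels are indexed by all
   n : nat; level 0 is trivial and carries no information. *)
Record mospace := MOSpace {
  mos_car :> lmodType C;
  mos_star : mos_car -> mos_car;
  mos_one : mos_car;
  mos_cone : forall n, set 'M[mos_car]_n }.

Section MatrixOperations.
Variable S : mospace.

Definition mxstar n (X : 'M[S]_n) : 'M[S]_n :=
  \matrix_(i, j) mos_star (X j i).

(* The product a X a^* *)
Definition mxcompress n m (a : 'M[C]_(n, m)) (X : 'M[S]_m) : 'M[S]_n :=
  \matrix_(i, j) \sum_k \sum_l (a i k * Num.conj (a j l)) *: X k l.

(* The element a (x) 1 of M_n(S) = M_n (x) S *)
Definition mxunit n (a : 'M[C]_n) : 'M[S]_n :=
  map_mx (fun z => z *: mos_one S) a.

(* The element r (I_n (x) 1) of M_n(S) *)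
Definition mxunitr n (r : R) : 'M[S]_n := mxunit ((r%:C)%C)%:M.

Definition mxscale n (a : C) (X : 'M[S]_n) : 'M[S]_n := map_mx ( *:%R a) X.

End MatrixOperations.

(* Abstract (Choi-Effros) operator systems: complex *-vector spaces with
   compatible proper cones of self-adjoint matrices and an Archimedean matrix
   order unit. *)
Record is_opsys (S : mospace) : Prop := IsOpsys {
  opsys_star_semilinear : forall (a : C) (x y : S),
    mos_star (a *: x + y) = Num.conj a *: mos_star x + mos_star y;
  opsys_starK : involutive (@mos_star S);
  opsys_sa : forall n (X : 'M[S]_n), mos_cone X -> mxstar X = X;
  opsys_add : forall n (X Y : 'M[S]_n),
    mos_cone X -> mos_cone Y -> mos_cone (X + Y);
  opsys_scale : forall n (r : R) (X : 'M[S]_n),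
    0 <= r -> mos_cone X -> mos_cone (mxscale (r%:C)%C X);
  opsys_proper : forall n (X : 'M[S]_n),
    mos_cone X -> mos_cone (- X) -> X = 0;
  opsys_compress : forall n m (a : 'M[C]_(n, m)) (X : 'M[S]_m),
    mos_cone X -> mos_cone (mxcompress a X);
  opsys_one_sa : mos_star (mos_one S) = mos_one S;
  opsys_unit : forall n (X : 'M[S]_n), mxstar X = X ->
    exists2 r : R, 0 < r & mos_cone (mxunitr S n r + X);
  opsys_arch : forall n (X : 'M[S]_n),
    (forall r : R, 0 < r -> mos_cone (mxunitr S n r + X)) -> mos_cone X }.

Record opsys := Opsys {
  opsys_mos :> mospace;
  opsysP : is_opsys opsys_mos }.

Definition ucp (S T : mospace) (f : S -> T) : Prop :=
  [/\ linear f,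
      f (mos_one S) = mos_one T
    & forall n (X : 'M[S]_n), mos_cone X -> mos_cone (map_mx f X)].

Definition complete_order_quotient (S T : mospace) (f : S -> T) : Prop :=
  [/\ ucp f,
      forall y, exists x, f x = y
    & forall n (Q : 'M[T]_n) (e : R), mos_cone Q -> 0 < e ->
        exists P : 'M[S]_n, mos_cone P /\ map_mx f P = Q + mxunitr T n e].

Definition finite_dimensional (V : lmodType C) : Prop :=
  exists (n : nat) (b : 'I_n -> V),
    forall x, exists c : 'I_n -> C, x = \sum_i c i *: b i.

(* States on the operator system M_n(S). *)
Definition mxstate (S : mospace) n (w : 'M[S]_n -> C) : Prop :=
  [/\ forall (a : C) X Y, w (mxscale a X + Y) = a * w X + w Y,
      w (mxunitr S n 1) = 1
    & forall X, mos_cone X -> 0 <= w X].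

(* With the order of R[i], 0 <= z means that z is real and nonnegative. *)
Definition psd n (A : 'M[C]_n) : Prop :=
  forall v : 'rV[C]_n, 0 <= (v *m A *m v ^t*) 0 0.

(* The identification M_n(M_k(V)) = M_(n * k)(V) *)
Definition mxflat (V : Type) n k (X : 'M['M[V]_k]_n) : 'M[V]_(n * k) :=
  \matrix_(p, q) X (mxtens_unindex p).1 (mxtens_unindex q).1
                   (mxtens_unindex p).2 (mxtens_unindex q).2.

Definition mx_mos k : mospace :=
  @MOSpace 'M[C]_k (fun A => A ^t*) 1%:M (fun n => [set X | psd (mxflat X)]).

(* M_k(V) as a vector space with entrywise operations; an alias, since 'M[V]_k
   only has a scalar action of its own ring of coefficients *)
Definition mxmod (V : lmodType C) (k : nat) : Type := 'M[V]_k.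

Section MatrixModule.
Variables (V : lmodType C) (k : nat).

HB.instance Definition _ := GRing.Zmodule.copy (mxmod V k) 'M[V]_k.

Definition mxmod_scale (a : C) (X : mxmod V k) : mxmod V k :=
  map_mx ( *:%R a) X.

Fact mxmod_scaleA a b X :
  mxmod_scale a (mxmod_scale b X) = mxmod_scale (a * b) X.
Proof. by apply/matrixP => i j; rewrite !mxE scalerA. Qed.
Fact mxmod_scale1 : left_id 1 mxmod_scale.
Proof. by move=> X; apply/matrixP => i j; rewrite !mxE scale1r. Qed.
Fact mxmod_scaleDr : right_distributive mxmod_scale +%R.
Proof. by move=> a X Y; apply/matrixP => i j; rewrite !mxE scalerDr. Qed.
Fact mxmod_scaleDl X : {morph mxmod_scale^~ X : a b / a + b}.
Proof. by move=> a b; apply/matrixP => i j; rewrite !mxE scalerDl. Qed.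

HB.instance Definition _ := GRing.Zmodule_isLmodule.Build C (mxmod V k)
  mxmod_scaleA mxmod_scale1 mxmod_scaleDr mxmod_scaleDl.

End MatrixModule.

Definition mxof_mos (S : mospace) k : mospace :=
  @MOSpace (mxmod S k) (@mxstar S k) (mxunitr S k 1)
    (fun n => [set X | mos_cone (@mxflat S n k X)]).

(* The operator subsystem of S spanned by U: a self-adjoint subspace containing
   the unit, with the matrix cones induced by those of S. *)
Section Subsystem.
Variables (S : mospace) (U : set S).
Hypothesis U_star : forall x, lin_span U x -> lin_span U (mos_star x).
Hypothesis U_one : lin_span U (mos_one S).

Definition sub_star (x : span_sub U) : span_sub U :=
  exist _ (mos_star (val x))
    (introT (span_predP _ _) (U_star (elimT (span_predP _ _) (valP x)))).

Definition sub_mos : mospace :=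
  @MOSpace (span_sub U) sub_star
    (exist _ (mos_one S) (introT (span_predP _ _) U_one))
    (fun n => [set X | mos_cone (map_mx val X)]).

End Subsystem.

Definition I01 : set R := `[0, 1].

Definition C01 := continuousType I01 C^o.

HB.instance Definition _ := Choice.on C01.

Section ContinuousFunctions.
Implicit Types f g : C01.

Fact C01_add_subproof f g : continuous (fun x => f x + g x : C^o).
Proof.
move=> x.
exact: (@cvgD _ _ _ _ (nbhs_filter x) _ _ _ _ (cts_fun x) (cts_fun x)).
Qed.
Definition C01_add f g : C01 := mkcts (@C01_add_subproof f g).

Fact C01_opp_subproof f : continuous (fun x => - f x : C^o).
Proof.
move=> x.
exact: (@cvgN _ _ _ _ (nbhs_filter x) _ _ (cts_fun x)).
Qed.
Definition C01_opp f : C01 := mkcts (@C01_opp_subproof f).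

Fact C01_scale_subproof (a : C) f : continuous (fun x => a *: f x : C^o).
Proof.
move=> x.
exact: (@cvgZl_tmp _ _ _ _ (nbhs_filter x) _ _ _ (cts_fun x)).
Qed.
Definition C01_scale a f : C01 := mkcts (@C01_scale_subproof a f).

Fact C01_cst_subproof (a : C) : continuous (fun _ : I01 => a : C^o).
Proof. by move=> x; exact: (@cvg_cst _ _ _ _ (nbhs_filter x)). Qed.
Definition C01_cst a : C01 := mkcts (@C01_cst_subproof a).

Fact C01_conj_subproof f : continuous (fun x => Num.conj (f x) : C^o).
Proof.
move=> x; apply/(@cvgrPdist_lt _ _ _ _ (nbhs_filter x)) => e e0.
have fx : f t @[t --> x] --> f x := @cts_fun _ _ f x.
have /(@cvgrPdist_lt _ _ _ _ (nbhs_filter x))/(_ e e0) := fx.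
by apply: filterS => y /=; rewrite -rmorphB norm_conjC.
Qed.
Definition C01_conj f : C01 := mkcts (@C01_conj_subproof f).

Fact C01_coord_subproof : continuous (fun x : I01 => ((set_val x)%:C)%C : C^o).
Proof.
move=> x; apply/(@cvgrPdist_lt _ _ _ _ (nbhs_filter x)) => -[e e'].
rewrite ltcE /= => /andP[/eqP -> e0].
have h : continuous (set_val : I01 -> R) by exact: initial_continuous.
have /(@cvgrPdist_lt _ _ _ _ (nbhs_filter x))/(_ e e0) := h x.
apply: filterS => y /= hy.
by rewrite -rmorphB normc_def /= expr0n addr0 sqrtr_sqr ltcR.
Qed.
Definition C01_coord : C01 := mkcts C01_coord_subproof.

Fact C01_addA : associative C01_add.
Proof. by move=> f g h; apply/continuousEP => x; exact: addrA. Qed.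
Fact C01_addC : commutative C01_add.
Proof. by move=> f g; apply/continuousEP => x; exact: addrC. Qed.
Fact C01_add0 : left_id (C01_cst 0) C01_add.
Proof. by move=> f; apply/continuousEP => x; exact: add0r. Qed.
Fact C01_addN : left_inverse (C01_cst 0) C01_opp C01_add.
Proof. by move=> f; apply/continuousEP => x; exact: addNr. Qed.

HB.instance Definition _ :=
  GRing.isZmodule.Build C01 C01_addA C01_addC C01_add0 C01_addN.

Fact C01_scaleA a b f : C01_scale a (C01_scale b f) = C01_scale (a * b) f.
Proof. by apply/continuousEP => x; exact: scalerA. Qed.
Fact C01_scale1 : left_id 1 C01_scale.
Proof. by move=> f; apply/continuousEP => x; exact: scale1r. Qed.
Fact C01_scaleDr : right_distributive C01_scale +%R.
Proof. by move=> a f g; apply/continuousEP => x; exact: scalerDr. Qed.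
Fact C01_scaleDl f : {morph C01_scale^~ f : a b / a + b}.
Proof. by move=> a b; apply/continuousEP => x; exact: scalerDl. Qed.

HB.instance Definition _ := GRing.Zmodule_isLmodule.Build C C01
  C01_scaleA C01_scale1 C01_scaleDr C01_scaleDl.

End ContinuousFunctions.

Definition C01_mos : mospace :=
  @MOSpace C01 C01_conj (C01_cst 1)
    (fun n => [set F | forall x : I01, psd (map_mx (fun f : C01 => f x) F)]).

Section Ck.
Variable k : nat.
Local Notation M := (mxof_mos C01_mos k).

(* e_ij (x) f *)
Definition eltm (i j : 'I_k) (f : C01) : M :=
  \matrix_(a, b) (f *+ ((a == i) && (b == j))).

Definition Ck_gen : set M := [set X | exists i j,
  X = eltm i j (C01_cst 1) \/ X = eltm i j C01_coord].

Fact C01_conj_additive : {morph C01_conj : f g / f + g}.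
Proof. by move=> f g; apply/continuousEP => x; exact: rmorphD. Qed.

Fact C01_conj0 : C01_conj 0 = 0.
Proof. by apply/continuousEP => x; exact: rmorph0. Qed.

Fact M_star_linear (a : C) (X Y : M) :
  mos_star (a *: X + Y) = Num.conj a *: mos_star X + mos_star Y.
Proof.
apply/matrixP => i j; rewrite !mxE /= C01_conj_additive; congr (_ + _).
by apply/continuousEP => x; exact: rmorphM.
Qed.

Fact eltm_star i j f : C01_conj f = f -> mos_star (eltm i j f) = eltm j i f.
Proof.
move=> ff; apply/matrixP => a b; rewrite !mxE /= andbC.
by case: (_ && _); rewrite ?mulr1n ?mulr0n ?C01_conj0.
Qed.

Fact Ck_star x : lin_span Ck_gen x -> lin_span Ck_gen (mos_star x).
Proof.
have s0 : mos_star (0 : M) = 0.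
  by apply/matrixP => i j; rewrite !mxE /= C01_conj0.
move=> [n [c [u [Uu ->]]]].
elim/big_rec: _ => [|i X _ sX]; first by rewrite s0; exact: lin_span0.
rewrite M_star_linear; apply: lin_spanZD => //; apply: lin_span_gen.
have [a [b [->|->]]] := Uu i; exists b, a; [left|right]; apply: eltm_star.
  by apply/continuousEP => x0; exact: rmorph1.
apply/continuousEP => x0; apply/eqP.
by rewrite eq_complex /= oppr0 !eqxx.
Qed.

Fact Ck_one : lin_span Ck_gen (mos_one M).
Proof.
have -> : mos_one M = \sum_(i < k) eltm i i (C01_cst 1).
  apply/matrixP => a b; rewrite [RHS]summxE [LHS]mxE mxE.
  case: (eqVneq a b) => [<-|ab].
    rewrite (bigD1 a)//= mxE !eqxx big1 ?addr0 => [|i ia].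
      by rewrite !mulr1n scale1r.
    by rewrite mxE eq_sym (negbTE ia).
  rewrite big1 => [|i _]; first by rewrite mulr0n scale0r.
  by rewrite mxE; case: (eqVneq a i) => [<-|//]; rewrite eq_sym (negbTE ab).
rewrite -[\sum_(i < k) _]addr0; elim/big_rec: _ => [|i X _ sX].
  by rewrite addr0; exact: lin_span0.
rewrite -[eltm _ _ _]scale1r -addrA; apply: lin_spanZD => //.
by apply: lin_span_gen; exists i, i; left.
Qed.

Definition Ck_mos : mospace := sub_mos Ck_star Ck_one.

End Ck.

Section Coproduct.
Variables (L : choiceType) (S : L -> mospace).

Local Notation D := (dsum (fun l => S l : lmodType C)).

Definition dsum_unit l : D := dsum_in (mos_one (S l)).

Definition coprod_rel : set D :=
  [set z | exists l m, z = dsum_unit l - dsum_unit m].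

Definition coprod := qspan coprod_rel.
HB.instance Definition _ := GRing.Lmodule.on coprod.

Definition coprod_in l (v : S l) : coprod := qproj coprod_rel (dsum_in v).

(* The sum is over the support of the representative x of z. *)
Definition coprod_star (z : coprod) : coprod :=
  let x := repr z in
  \sum_(l \in [set l | x l != 0]) coprod_in (mos_star (x l)).

(* The common class of the units of the S l (see coprod_oneE) *)
Definition coprod_one : coprod :=
  xget 0 [set u | exists l, u = coprod_in (mos_one (S l))].

Lemma coprod_oneE l : coprod_one = coprod_in (mos_one (S l)).
Proof.
rewrite /coprod_one; case: xgetP => [u _ [m ->]|/(_ _ (ex_intro _ l erefl))//].
by apply/qproj_eq/lin_span_gen; exists m, l.
Qed.

(* The choice of the expression of X is immaterial: two expressions differ by
   differences of units, on which the states of a compatible family cancel, and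
   states of M_n (x) 1 extend to M_n(S l), so that F can be enlarged. *)
Definition coprod_cone n : set 'M[coprod]_n := [set X |
  exists (F : {fset L}) (x : forall l, 'M[S l]_n),
    X = \sum_(l <- F) map_mx (@coprod_in l) (x l) /\
    forall w : (forall l, 'M[S l]_n -> C),
      (forall l, l \in F -> mxstate (w l)) ->
      (forall l m, l \in F -> m \in F ->
        forall a : 'M[C]_n, w l (mxunit (S l) a) = w m (mxunit (S m) a)) ->
      0 <= \sum_(l <- F) w l (x l)].

Definition coprod_mos : mospace :=
  MOSpace coprod_star coprod_one coprod_cone.

End Coproduct.

(* The summand labelled by (k, i) is the one in M_{k+1}(C([0,1])): the index
   sets I_1, I_2, ... are numbered from 0 here. *)
Definition CI_mos (I : nat -> Type) : mospace :=
  @coprod_mos {classic {k : nat & I k}} (fun l => Ck_mos (tag l).+1).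

(* X with the conjugate scalar action *)
Definition conjmod (X : lmodType C) : Type := X.

Section ConjugateModule.
Variable X : lmodType C.

HB.instance Definition _ := GRing.Zmodule.copy (conjmod X) X.

Definition conjmod_scale (a : C) (x : conjmod X) : conjmod X :=
  Num.conj a *: (x : X).

Fact conjmod_scaleA a b x :
  conjmod_scale a (conjmod_scale b x) = conjmod_scale (a * b) x.
Proof. by rewrite /conjmod_scale scalerA rmorphM. Qed.
Fact conjmod_scale1 : left_id 1 conjmod_scale.
Proof. by move=> x; rewrite /conjmod_scale rmorph1 scale1r. Qed.
Fact conjmod_scaleDr : right_distributive conjmod_scale +%R.
Proof. by move=> a x y; rewrite /conjmod_scale scalerDr. Qed.
Fact conjmod_scaleDl x : {morph conjmod_scale^~ x : a b / a + b}.
Proof. by move=> a b; rewrite /conjmod_scale rmorphD scalerDl. Qed.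

HB.instance Definition _ := GRing.Zmodule_isLmodule.Build C (conjmod X)
  conjmod_scaleA conjmod_scale1 conjmod_scaleDr conjmod_scaleDl.

End ConjugateModule.

Section Tensor.
Variables S T : mospace.

(* The antilinear extension of (s (x) t)^* = s^* (x) t^* *)
Definition tprod_star (z : tprod S T) : tprod S T :=
  @tlift C S T (conjmod (tprod S T))
    (fun s t => tens (mos_star s) (mos_star t)) z.

Definition tprod_one : tprod S T := tens (mos_one S) (mos_one T).

Definition min_cone n : set 'M[tprod S T]_n := [set X |
  forall (k l : nat) (f : S -> 'M[C]_k) (g : T -> 'M[C]_l),
    @ucp S (mx_mos k) f -> @ucp T (mx_mos l) g ->
    @mos_cone (mx_mos (k * l)) n (map_mx (tlift (fun s t => f s *t g t)) X)].

Definition min_mos : mospace := MOSpace tprod_star tprod_one min_cone.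

(* P (x) Q in M_{kl}(S (x) T); indices are paired as in tensmx. *)
Definition tensmat k l (P : 'M[S]_k) (Q : 'M[T]_l) : 'M[tprod S T]_(k * l) :=
  \matrix_(p, q) tens (P (mxtens_unindex p).1 (mxtens_unindex q).1)
                      (Q (mxtens_unindex p).2 (mxtens_unindex q).2).

(* mxunitr and mxcompress only involve the vector space and the unit, which
   are those of min_mos. *)
Definition max_cone n : set 'M[tprod S T]_n := [set X |
  forall e : R, 0 < e -> exists (k l : nat) (P : 'M[S]_k) (Q : 'M[T]_l)
    (a : 'M[C]_(n, k * l)),
    [/\ mos_cone P, mos_cone Q
      & X + mxunitr min_mos n e = @mxcompress min_mos _ _ a (tensmat P Q)]].

Definition max_mos : mospace := MOSpace tprod_star tprod_one max_cone.

End Tensor.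

Definition nuclear (S : opsys) : Prop :=
  forall (T : opsys) n, @mos_cone (min_mos S T) n = @mos_cone (max_mos S T) n.

Definition id_tens (S T1 T2 : mospace) (f : T1 -> T2) :
    min_mos S T1 -> min_mos S T2 :=
  tlift (fun s t => tens s (f t)).

End OperatorSystems.

(* Main.v *)
(* Maximal tensor products lift positive elements along quotient maps, which
   gives every lifting property from nuclearity. Conversely, let X be positive
   in M_n(S (x)min T). It lives in S (x) E for a subsystem E of T spanned by
   finitely many positive elements p_j, and is positive in S (x)min E by
   Arveson's theorem. Let B_l be small multiples of the countably many positive
   matrices over E that are Gaussian-integer combinations of the p_j. Then
   (c, y) |-> c 1 + sum_l sum_ab (y_l)_ab (B_l)_ab is a complete order quotient
   map onto E from the system of block diagonal matrices c 1 + sum_l y_l, and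
   it stays one after composition with the map from the coproduct of the
   C_{iota_k} that sends a + b t to (x(1)_00, x(0) - x(1)_00 1), x = a + b t.
   Hence X + e lifts to a positive matrix over S (x)min (block diagonal
   matrices), which equals the maximal tensor product because positivity is
   decided by the finitely many nontrivial blocks and the limit; so X + e has
   the form defining the maximal cone. *)
Require Import Defs.
From mathcomp Require Import all_boot all_order all_algebra.
From mathcomp Require Import finmap.
From mathcomp Require Import sesquilinear spectral freeg complex mxtens.
From mathcomp Require Import all_classical all_reals.
From mathcomp Require Import topology.
From mathcomp Require Import ring lra.

Set Implicit Arguments.
Unset Strict Implicit.
Unset Printing Implicit Defensive.

Import Order.TTheory GRing.Theory Num.Theory.

(** * Positive semidefinite matrices and matrix cones *)

(** The coproduct identifies the units of all its summands, so a unital map out of a bare summand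
    M_k would tie the image of that summand to the common unit. The coordinate function t removes
    the tie: A (x) (1 - t) is A at 0 and vanishes at 1, so each summand carries a block that is
    independent of the unit. Block diagonal matrices stand between the coproduct and E because their
    cones are explicit. Nuclearity is computed for them by hand, and all that is needed of the
    coproduct is a ucp map out of it. They also form an operator system, to which (iv) applies,
    while (iii) is applied to the composite map from the coproduct. Finite generation of E makes the
    B_l countable. Rounding coefficients to Gaussian integers costs an error that depends on the
    matrix size only; after scaling it is absorbed by the e in the definition of a quotient map.
    Countability allows weights with sum_l tr B_l <= 1, which is what makes (c, y) |-> c 1 + sum_l
    sum_ab (y_l)_ab (B_l)_ab positive. Hence the single index set [nat] serves for I in (iii). *)

Section PositiveSemidefinite.
Local Open Scope ring_scope.
Local Open Scope sesquilinear_scope.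
Variable R : realType.
Local Notation C := R[i].
Local Notation cj := Num.conj.
Local Notation rC r := ((r%:C)%C : C).

Lemma cjD (a b : C) : cj (a + b) = cj a + cj b. Proof. exact: rmorphD. Qed.
Lemma cjB (a b : C) : cj (a - b) = cj a - cj b. Proof. exact: rmorphB. Qed.
Lemma cjN (a : C) : cj (- a) = - cj a. Proof. exact: rmorphN. Qed.
Lemma cjM (a b : C) : cj (a * b) = cj a * cj b. Proof. exact: rmorphM. Qed.
Lemma cj_sum (J : Type) (s : seq J) (P : pred J) (F : J -> C) :
  cj (\sum_(j <- s | P j) F j) = \sum_(j <- s | P j) cj (F j).
Proof. exact: rmorph_sum. Qed.
Lemma cj_real (r : R) : cj (rC r) = rC r.
Proof. by apply/CrealP/complex_realP; exists r. Qed.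

Lemma rCM (a b : R) : rC (a * b) = rC a * rC b. Proof. exact: rmorphM. Qed.
Lemma rCD (a b : R) : rC (a + b) = rC a + rC b. Proof. exact: rmorphD. Qed.
Lemma rCN (a : R) : rC (- a) = - rC a. Proof. exact: rmorphN. Qed.
Lemma rCVK (a : R) : 0 < a -> rC a^-1 * rC a = 1.
Proof. by move=> a0; rewrite -rCM mulVf ?gt_eqF. Qed.

Section Form.
Variable I : finType.
Implicit Types (A : I -> I -> C) (u v : I -> C).

(** Index sets are arbitrary finite types: an element of M_n(M_k) is then a form on a product type,
    and regrouping indices is a mere [fpsd_reindex]. *)
Definition sform A u v : C := \sum_i \sum_j u i * A i j * cj (v j).

Definition fpsd A := forall v, 0 <= sform A v v.

Lemma sformDl A u1 u2 v :
  sform A (fun i => u1 i + u2 i) v = sform A u1 v + sform A u2 v.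
Proof.
rewrite -big_split; apply: eq_bigr => i _; rewrite -big_split.
by apply: eq_bigr => j _; rewrite !mulrDl.
Qed.

Lemma sformDr A u v1 v2 :
  sform A u (fun i => v1 i + v2 i) = sform A u v1 + sform A u v2.
Proof.
rewrite -big_split; apply: eq_bigr => i _; rewrite -big_split.
by apply: eq_bigr => j _; rewrite rmorphD mulrDr.
Qed.

Lemma sformZl A a u v : sform A (fun i => a * u i) v = a * sform A u v.
Proof.
rewrite mulr_sumr; apply: eq_bigr => i _; rewrite mulr_sumr.
by apply: eq_bigr => j _; rewrite !mulrA.
Qed.

Lemma sformZr A a u v : sform A u (fun i => a * v i) = cj a * sform A u v.
Proof.
rewrite mulr_sumr; apply: eq_bigr => i _; rewrite mulr_sumr.
by apply: eq_bigr => j _; rewrite rmorphM mulrCA.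
Qed.

Lemma sum_delta (f : I -> C) i : \sum_j (i == j)%:R * f j = f i.
Proof.
rewrite (bigD1 i)//= eqxx mul1r big1 ?addr0// => j ij.
by rewrite eq_sym (negbTE ij) mul0r.
Qed.

Lemma sform_delta A i j :
  sform A (fun k => (i == k)%:R) (fun k => (j == k)%:R) = A i j.
Proof.
rewrite /sform; under eq_bigr => k _.
  under eq_bigr => l _ do rewrite -mulrA rmorph_nat [A k l * _]mulrC.
  rewrite -mulr_sumr sum_delta; over.
by rewrite sum_delta.
Qed.

Lemma sformD A B u v :
  sform (fun i j => A i j + B i j) u v = sform A u v + sform B u v.
Proof.
rewrite -big_split; apply: eq_bigr => i _; rewrite -big_split.
by apply: eq_bigr => j _; rewrite mulrDr mulrDl.
Qed.

Lemma sformZ a A u v : sform (fun i j => a * A i j) u v = a * sform A u v.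
Proof.
rewrite mulr_sumr; apply: eq_bigr => i _; rewrite mulr_sumr.
by apply: eq_bigr => j _; rewrite !mulrA [u i * a]mulrC.
Qed.

Lemma sform_id u v : sform (fun i j => (i == j)%:R) u v = \sum_i u i * cj (v i).
Proof.
apply: eq_bigr => i _; under eq_bigr do rewrite -mulrA mulrCA.
by rewrite sum_delta.
Qed.

Lemma normE_sum (v : I -> C) : 0 <= \sum_i v i * cj (v i).
Proof. by apply: sumr_ge0 => i _; exact: mul_conjC_ge0. Qed.

Lemma sform_sum (J : Type) (s : seq J) (A : J -> I -> I -> C) u v :
  sform (fun i j => \sum_(k <- s) A k i j) u v = \sum_(k <- s) sform (A k) u v.
Proof.
rewrite exchange_big; apply: eq_bigr => i _ /=.
rewrite exchange_big; apply: eq_bigr => j _ /=.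
by rewrite mulr_sumr mulr_suml.
Qed.

Lemma eq_fpsd A B : A =2 B -> fpsd A -> fpsd B.
Proof.
move=> AB pA v; have := pA v; congr (_ <= _).
by apply: eq_bigr => i _; apply: eq_bigr => j _; rewrite AB.
Qed.

Lemma fpsdD A B : fpsd A -> fpsd B -> fpsd (fun i j => A i j + B i j).
Proof. by move=> pA pB v; rewrite sformD addr_ge0. Qed.

Lemma fpsdZ a A : 0 <= a -> fpsd A -> fpsd (fun i j => a * A i j).
Proof. by move=> a0 pA v; rewrite sformZ mulr_ge0. Qed.

Lemma fpsd_sum (J : Type) (s : seq J) (A : J -> I -> I -> C) :
  (forall k, fpsd (A k)) -> fpsd (fun i j => \sum_(k <- s) A k i j).
Proof. by move=> pA v; rewrite sform_sum sumr_ge0// => k _; exact: pA. Qed.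

Lemma conj_eq (a b : C) :
  a + b \is Num.real -> 'i * a - 'i * b \is Num.real -> b = cj a.
Proof.
move=> /CrealP; rewrite cjD => h1 /CrealP; rewrite cjB !cjM conjCi => h2.
have {}h2 : cj b - cj a = a - b.
  by apply: (mulfI (neq0Ci C)); rewrite mulrBr [RHS]mulrBr -h2; ring.
have : (cj a + cj b - (cj b - cj a)) = (a + b) - (a - b) by rewrite h1 h2.
rewrite (_ : _ - _ = 2 * cj a); last by ring.
rewrite (_ : _ - _ = 2 * b); last by ring.
by move=> /mulfI -> //; rewrite pnatr_eq0.
Qed.

(** Polarization: the form is real at [u + v] and at ['i u + v], which makes both combinations of
    the cross terms in [conj_eq] real. *)
Lemma fpsd_sformC A u v : fpsd A -> sform A v u = cj (sform A u v).
Proof.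
move=> pA; apply: conj_eq.
  have := pA (fun i => u i + v i).
  rewrite sformDl !sformDr => /ger0_real h.
  have := realB (realB h (ger0_real (pA u))) (ger0_real (pA v)).
  by congr (_ \is _); ring.
have := pA (fun i => 'i * u i + v i).
rewrite sformDl !sformDr => /ger0_real h.
have := realB (realB h (ger0_real (pA (fun i => 'i * u i)))) (ger0_real (pA v)).
by congr (_ \is _); rewrite !sformZl !sformZr conjCi; ring.
Qed.

Lemma fpsd_herm A i j : fpsd A -> A j i = cj (A i j).
Proof. by move=> pA; rewrite -!sform_delta; exact: fpsd_sformC. Qed.

(** The form vanishes at every pair (v, v); polarizing with two basis vectors then kills each
    entry. *)
Lemma fpsd_anti A i j : fpsd A -> fpsd (fun i j => - A i j) -> A i j = 0.
Proof.
move=> pA pNA.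
have A0 v : sform A v v = 0.
  apply/eqP; rewrite eq_le pA andbT -oppr_ge0; have := pNA v.
  rewrite (_ : sform _ _ _ = - sform A v v)// -mulN1r -sformZ.
  by apply: eq_bigr => k _; apply: eq_bigr => l _; rewrite mulN1r.
pose u k : C := (i == k)%:R; pose v k : C := (j == k)%:R.
have h1 : sform A u v + sform A v u = 0.
  have := A0 (fun i => u i + v i).
  by rewrite sformDl !sformDr !A0 add0r addr0.
have h2 : 'i * sform A u v - 'i * sform A v u = 0.
  have := A0 (fun i => 'i * u i + v i).
  by rewrite sformDl !sformDr !sformZl !sformZr !A0 conjCi !mulr0 add0r addr0 mulNr.
move: h2; rewrite -mulrBr => /eqP; rewrite mulf_eq0 (negbTE (neq0Ci _))/=.
rewrite -(sform_delta A i j) => /eqP h2; have : sform A u v *+ 2 = 0.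
  by rewrite -[RHS]add0r -{1}h1 -h2; ring.
by move=> /eqP; rewrite mulrn_eq0 => /eqP.
Qed.

Lemma fpsd_arch A :
  (forall r : R, 0 < r -> fpsd (fun i j => rC r * (i == j)%:R + A i j)) ->
  fpsd A.
Proof.
move=> h v; set z := sform A v v; set s := \sum_i v i * cj (v i).
have s0 : 0 <= s := normE_sum v.
have hr (r : R) : 0 < r -> 0 <= rC r * s + z.
  by move=> /h /(_ v); rewrite sformD sformZ sform_id.
have sE : s = rC (complex.Re s) by move: s0; case: (s) => a b; rewrite lecE /= => /andP[/eqP-> _].
have zr : complex.Im z = 0.
  have := hr 1 ltr01; rewrite mul1r sE lecE /= => /andP[]; case: (z) => a b /=.
  by rewrite add0r => /eqP.
have zE : z = rC (complex.Re z) by move: zr; case: (z) => a b /= ->.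
rewrite zE lecR leNgt; apply/negP => z0.
have s1 : 0 <= complex.Re s by rewrite -lecR -sE.
(* For z < 0 this r satisfies r s <= - z / 2, hence r s + z < 0. *)
have := hr (- complex.Re z / (complex.Re s + 1) / 2) _.
rewrite zE sE /= -rmorphM -rmorphD /= lecR => /(_ _)/wrap[].
  by rewrite divr_gt0// divr_gt0 ?oppr_gt0// ltr_wpDl.
rewrite leNgt => /negP; apply.
have : 0 < (complex.Re s + 1)^-1 by rewrite invr_gt0 ltr_wpDl.
have : (complex.Re s + 1) * (complex.Re s + 1)^-1 = 1.
  by rewrite divff// gt_eqF// ltr_wpDl.
by move: (_^-1) s1 z0; move: (complex.Re s) (complex.Re z) => a b c; nra.
Qed.

(** From |v_i A_ij v_j| <= e (|v_i|^2 + |v_j|^2) / 2, summed over i and j. It turns an entrywise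
    rounding error into an order estimate. *)
Lemma fpsd_bound A (e : R) :
    (forall i j, A j i = cj (A i j)) -> (forall i j, `|A i j| <= rC e) ->
  fpsd (fun i j => rC (#|I|%:R * e) * (i == j)%:R + A i j).
Proof.
move=> hA bA v; rewrite sformD sformZ sform_id.
have re : sform A v v \is Num.real.
  apply/CrealP; rewrite cj_sum; under eq_bigr do rewrite cj_sum.
  rewrite exchange_big; apply: eq_bigr => i _; apply: eq_bigr => j _.
  by rewrite !cjM conjCK hA conjCK; ring.
have re1 : rC (#|I|%:R * e) * \sum_i v i * cj (v i) \is Num.real.
  by rewrite realM// ?(ger0_real (normE_sum _))//; apply/complex_realP; eexists.
set t := rC _ * _ in re1 *.
have [h|h] : 0 <= t + sform A v v \/ t + sform A v v < 0.
- by case/orP: (realD re1 re) => h; [left|move: h; rewrite le_eqVlt => /orP[/eqP ->|]; [left|right]].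
- by [].
exfalso.
suff : `|sform A v v| <= t.
  have : - sform A v v <= `|sform A v v|.
  by rewrite -normrN; apply: real_ler_norm; rewrite realN.
  move=> /le_trans tr /tr.
  by rewrite -subr_ge0 opprK real_leNgt// ?h// realD.
have le2 i j : `|v i * A i j * cj (v j)| <=
    rC e * ((v i * cj (v i) + v j * cj (v j)) / 2).
  rewrite !normrM norm_conjC mulrAC mulrC ler_pM ?mulr_ge0//.
  rewrite -!normCK ler_pdivlMr ?ltr0n// -subr_ge0.
  have := mul_conjC_ge0 (`|v i| - `|v j|).
  rewrite cjB !conj_normC; congr (_ <= _); ring.
rewrite (le_trans (ler_norm_sum _ _ _))//.
rewrite (le_trans (ler_sum _ (fun i _ => ler_norm_sum _ _ _)))//.
rewrite (le_trans (ler_sum _ (fun i _ => ler_sum _ (fun j _ => le2 i j))))//.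
rewrite le_eqVlt; apply/orP; left; apply/eqP.
rewrite /t rmorphM rmorph_nat; set S := \sum_i v i * cj (v i).
have S1 i : \sum_j rC e * ((v i * cj (v i) + v j * cj (v j)) / 2) =
    rC e / 2 * (#|I|%:R * (v i * cj (v i)) + S).
  rewrite -mulr_sumr -mulr_suml big_split /= sumr_const -/S -mulr_natl.
  by ring.
under eq_bigr do rewrite S1.
rewrite -mulr_sumr big_split /= -mulr_sumr sumr_const -/S -mulr_natl.
by field.
Qed.

End Form.

Lemma fpsd_compress (I J : finType) (a : I -> J -> C) A : fpsd A ->
  fpsd (fun i j => \sum_k \sum_l a i k * cj (a j l) * A k l).
Proof.
move=> pA v; have := pA (fun k => \sum_i v i * a i k).
congr (_ <= _); rewrite /sform.
under eq_bigr => k _.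
  under eq_bigr => l _.
    rewrite cj_sum mulr_suml mulr_suml; under eq_bigr do rewrite mulr_sumr; over.
  rewrite exchange_big; over.
rewrite exchange_big; apply: eq_bigr => i _ /=.
under eq_bigr => k _ do rewrite exchange_big.
rewrite exchange_big; apply: eq_bigr => j _ /=.
rewrite mulr_sumr mulr_suml; apply: eq_bigr => k _.
rewrite mulr_sumr mulr_suml; apply: eq_bigr => l _.
by rewrite cjM; ring.
Qed.

Lemma fpsd_reindex (I J : finType) (h : I -> J) A : fpsd A ->
  fpsd (fun i j => A (h i) (h j)).
Proof.
move=> pA; apply: eq_fpsd (fpsd_compress (fun i j => (h i == j)%:R) pA) => i j.
under eq_bigr => k _.
  under eq_bigr => l _ do rewrite rmorph_nat -mulrA.
  rewrite -mulr_sumr sum_delta; over.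
by rewrite sum_delta.
Qed.

(** Spectral theorem: A = U^* D U with U unitary and D >= 0, and B is U^* times the square root of
    D. *)
Lemma fpsd_factor (I : finType) (A : I -> I -> C) : fpsd A ->
  exists B : I -> I -> C, forall i j, A i j = \sum_k B i k * cj (B j k).
Proof.
move=> pA; pose M : 'M[C]_#|I| := \matrix_(i, j) A (enum_val i) (enum_val j).
have hM : M \is hermsymmx.
  apply/is_hermitianmxP; rewrite expr0 scale1r; apply/matrixP => i j.
  by rewrite !mxE; exact: fpsd_herm.
have := orthomx_spectralP (hermitian_normalmx hM).
set U := spectralmx M; set d := spectral_diag M => ME.
have uU : U \is unitarymx := spectral_unitarymx M.
have uUt : U *m U ^t* = 1%:M by apply/unitarymxP.
have iU : invmx U = U ^t* := invmx_unitary uU.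
have dE i : d 0 i = sform (fun p q => M p q) (U i) (U i).
  have -> : d 0 i = (U *m M *m U ^t*) i i.
    rewrite ME iU !mulmxA uUt mul1mx -mulmxA uUt mulmx1 mxE.
    by rewrite eqxx mulr1n.
  rewrite mxE /sform exchange_big; apply: eq_bigr => j _.
  by rewrite !mxE mulr_suml.
have pM : fpsd (fun p q => M p q).
  by apply: eq_fpsd (fpsd_reindex enum_val pA) => p q; rewrite mxE.
exists (fun i k => cj (U (enum_rank k) (enum_rank i)) * sqrtC (d 0 (enum_rank k))).
move=> i j; have -> : A i j = M (enum_rank i) (enum_rank j).
  by rewrite mxE !enum_rankK.
rewrite {1}ME iU mxE (reindex (@enum_rank I))/=; last first.
  by apply: onW_bij; exact: enum_rank_bij.
apply: eq_bigr => k _; rewrite mul_mx_diag !mxE cjM conjCK.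
have d0 : 0 <= d 0 (enum_rank k) by rewrite dE; exact: pM.
have /CrealP -> : sqrtC (d 0 (enum_rank k)) \is Num.real.
  by rewrite ger0_real ?sqrtC_ge0.
rewrite -{1}[d 0 _]sqrtCK; ring.
Qed.

(** A Gram factorization of B splits the product into a sum of copies of A rescaled by the columns
    of the factor. *)
Lemma fpsd_tensor (I J : finType) A B : fpsd A -> fpsd B ->
  fpsd (fun p q : I * J => A p.1 q.1 * B p.2 q.2).
Proof.
move=> pA /fpsd_factor[D BE].
have h k : fpsd (fun p q : I * J => D p.2 k * cj (D q.2 k) * A p.1 q.1).
  move=> v; have := fpsd_reindex fst pA (fun p : I * J => v p * D p.2 k).
  congr (_ <= _); apply: eq_bigr => p _; apply: eq_bigr => q _.
  by rewrite cjM; ring.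
apply: eq_fpsd (fpsd_sum (index_enum J) h) => p q.
by rewrite BE mulr_sumr; apply: eq_bigr => k _; ring.
Qed.

Lemma sum_pair (V : nmodType) (I J : finType) (F : I * J -> V) :
  \sum_p F p = \sum_i \sum_j F (i, j).
Proof. by rewrite pair_bigA; apply: eq_bigr => -[]. Qed.

Lemma fpsd_gram (I K : finType) (D : I -> K -> C) :
  fpsd (fun p q => \sum_m D p m * cj (D q m)).
Proof.
apply: fpsd_sum => m v; rewrite [leRHS](_ : _ =
    (\sum_p v p * D p m) * cj (\sum_p v p * D p m)) ?mul_conjC_ge0//.
rewrite cj_sum mulr_suml; apply: eq_bigr => p _.
by rewrite mulr_sumr; apply: eq_bigr => q _; rewrite cjM; ring.
Qed.

(** Conjugation of A by id (x) b, carried out on a Gram factor of A. *)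
Lemma fpsd_local (I J K : finType) (b : J -> K -> C) (A : I * K -> I * K -> C) :
  fpsd A -> fpsd (fun p q : I * J =>
    \sum_k \sum_l b p.2 k * cj (b q.2 l) * A (p.1, k) (q.1, l)).
Proof.
move=> /fpsd_factor[B AE].
apply: eq_fpsd (fpsd_gram (fun p m => \sum_k b p.2 k * B (p.1, k) m)) => p q.
under eq_bigr do rewrite cj_sum mulr_suml.
rewrite exchange_big; apply: eq_bigr => k _ /=.
under eq_bigr do rewrite mulr_sumr.
rewrite exchange_big; apply: eq_bigr => l _ /=.
by rewrite AE mulr_sumr; apply: eq_bigr => m _; rewrite cjM; ring.
Qed.

Lemma fpsd_local1 (I J K : finType) (b : J -> K -> C) (A : K * I -> K * I -> C) :
  fpsd A -> fpsd (fun p q : J * I =>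
    \sum_k \sum_l b p.1 k * cj (b q.1 l) * A (k, p.2) (l, q.2)).
Proof.
move=> pA; have pA' := fpsd_reindex (fun p : I * K => (p.2, p.1)) pA.
exact: (fpsd_reindex (fun p : J * I => (p.2, p.1)) (fpsd_local b pA')).
Qed.

Lemma fpsd_id (I : finType) : fpsd (fun i j : I => (i == j)%:R).
Proof. by move=> v; rewrite sform_id normE_sum. Qed.

Lemma fpsd_order_unit (I : finType) (A : I -> I -> C) :
  (forall i j, A j i = cj (A i j)) ->
  exists2 r : R, 0 < r & fpsd (fun i j => rC r * (i == j)%:R + A i j).
Proof.
move=> hA; pose e := \sum_i \sum_j complex.Re `|A i j|.
have nE i j : `|A i j| = rC (complex.Re `|A i j|).
  by have := normr_ge0 (A i j); case: `|_| => a b; rewrite lecE /= => /andP[/eqP ->].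
have n0 i j : 0 <= complex.Re `|A i j| by have := normr_ge0 (A i j); rewrite nE lecR.
have bA i j : `|A i j| <= rC e.
  rewrite nE lecR /e (bigD1 i)//= (bigD1 j)//= -addrA lerDl.
  apply: addr_ge0; apply: sumr_ge0 => l _; first exact: n0.
  by apply: sumr_ge0 => m _; exact: n0.
have e0 : 0 <= e by rewrite sumr_ge0// => i _; rewrite sumr_ge0.
exists (#|I|%:R * e + 1); first by rewrite ltr_wpDl// mulr_ge0.
have := fpsdD (@fpsd_id I) (fpsd_bound hA bA); apply: eq_fpsd => i j.
by rewrite rCD mulrDl mul1r addrA [X in X + A _ _]addrC.
Qed.

Lemma psdE n (A : 'M[C]_n) : psd A <-> fpsd (fun i j => A i j).
Proof.
have E (v : 'rV[C]_n) : (v *m A *m v ^t*) 0 0 = sform (fun i j => A i j) (v 0) (v 0).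
  rewrite mxE /sform exchange_big; apply: eq_bigr => j _.
  by rewrite !mxE mulr_suml.
split=> pA v; last by rewrite E.
have := pA (\row_i v i); rewrite E; congr (_ <= _).
by apply: eq_bigr => i _; apply: eq_bigr => j _; rewrite !mxE.
Qed.

Lemma psd_flatE n k (X : 'M['M[C]_k]_n) :
  psd (mxflat X) <-> fpsd (fun p q : 'I_n * 'I_k => X p.1 q.1 p.2 q.2).
Proof.
rewrite psdE; split=> [/(fpsd_reindex (@mxtens_index n k))|].
  by apply: eq_fpsd => p q; rewrite mxE !mxtens_indexK.
by move/(fpsd_reindex (@mxtens_unindex n k)); apply: eq_fpsd => p q; rewrite mxE.
Qed.

End PositiveSemidefinite.

(** * Matrix cones over abstract operator systems *)

Section OperatorSystemCones.
Local Open Scope ring_scope.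
Variable R : realType.
Local Notation C := R[i].
Local Notation cj := Num.conj.
Local Notation rC r := ((r%:C)%C : C).

(** Matrix cones with indices in any finite type. Over an operator system the enumeration is
    immaterial, since compression by permutation matrices preserves the cones ([mos_coneE],
    [fcone_reindex]). *)
Definition fcone (S : mospace R) (I : finType) (x : I -> I -> S) :=
  mos_cone (\matrix_(p < #|I|, q < #|I|) x (enum_val p) (enum_val q)).

Lemma sum_deltaZ (V : lmodType C) (I : finType) (f : I -> V) i :
  \sum_j (i == j)%:R *: f j = f i.
Proof.
rewrite (bigD1 i)//= eqxx scale1r big1 ?addr0// => j ij.
by rewrite eq_sym (negbTE ij) scale0r.
Qed.

Lemma mxunitrE (S : mospace R) n r i j :
  mxunitr S n r i j = (rC r * (i == j)%:R) *: mos_one S.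
Proof. by rewrite !mxE mulr_natr. Qed.

Lemma mxunitrDE (S : mospace R) n r (X : 'M[S]_n) i j :
  (mxunitr S n r + X) i j = (rC r * (i == j)%:R) *: mos_one S + X i j.
Proof. by rewrite -mxunitrE [LHS]mxE. Qed.

Lemma map_mx_entry (A B : Type) (f : A -> B) m n (X : 'M[A]_(m, n)) i j :
  map_mx f X i j = f (X i j).
Proof. by rewrite mxE. Qed.

Lemma reindex_enum (V : nmodType) (I : finType) (f : I -> V) :
  \sum_i f i = \sum_(p < #|I|) f (enum_val p).
Proof.
by rewrite (reindex (@enum_val I predT))//=; apply: onW_bij; exact: enum_val_bij.
Qed.

Lemma eq_fcone (S : mospace R) (I : finType) (x y : I -> I -> S) :
  (forall i j, x i j = y i j) -> fcone x -> fcone y.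
Proof.
rewrite /fcone => xy; congr (mos_cone _).
by apply/matrixP => p q; rewrite !mxE.
Qed.

Section Opsys.
Variable S : opsys R.

Lemma mos_starD (x y : S) : mos_star (x + y) = mos_star x + mos_star y.
Proof.
have := opsys_star_semilinear (opsysP S) 1 x y.
by rewrite !scale1r rmorph1 scale1r.
Qed.

Lemma mos_star0 : mos_star (0 : S) = 0.
Proof. by apply: (addrI (mos_star 0)); rewrite -mos_starD !addr0. Qed.

Lemma mos_compress m (X : 'M[S]_m) : mos_cone X ->
  forall n (a : 'M[C]_(n, m)), mos_cone (mxcompress a X).
Proof. by move=> cX n a; exact: opsys_compress (opsysP S) _ _ a X cX. Qed.

Lemma fcone_compress (I J : finType) (a : I -> J -> C) (x : J -> J -> S) :
  fcone x -> fcone (fun i j => \sum_k \sum_l (a i k * cj (a j l)) *: x k l).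
Proof.
rewrite /fcone => /mos_compress.
move=> /(_ _ (\matrix_(p < #|I|, q < #|J|) a (enum_val p) (enum_val q))).
congr (mos_cone _); apply/matrixP => p q; rewrite !mxE [RHS]reindex_enum.
apply: eq_bigr => k _; rewrite [RHS]reindex_enum.
by apply: eq_bigr => l _; rewrite !mxE.
Qed.

Lemma fcone_reindex (I J : finType) (h : I -> J) (x : J -> J -> S) :
  fcone x -> fcone (fun i j => x (h i) (h j)).
Proof.
move/(fcone_compress (fun i k => (h i == k)%:R)); apply: eq_fcone => i j.
under eq_bigr => k _.
  under eq_bigr => l _ do rewrite rmorph_nat -scalerA.
  rewrite -scaler_sumr sum_deltaZ; over.
by rewrite sum_deltaZ.
Qed.

Lemma mos_coneE n (X : 'M[S]_n) : mos_cone X <-> fcone (fun i j => X i j).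
Proof.
have E p q (h : 'I_p -> 'I_q) (Y : 'M[S]_q) : mos_cone Y ->
    mos_cone (\matrix_(i, j) Y (h i) (h j)).
  move=> /mos_compress/(_ _ (\matrix_(i, k) (h i == k)%:R)).
  congr (mos_cone _); apply/matrixP => i j; rewrite !mxE.
  under eq_bigr => k _.
    under eq_bigr => l _ do rewrite !mxE rmorph_nat -scalerA.
    rewrite -scaler_sumr sum_deltaZ; over.
  by rewrite sum_deltaZ.
split=> [|/(E _ _ (@enum_rank 'I_n))]; first exact: E.
by congr (mos_cone _); apply/matrixP => i j; rewrite !mxE !enum_rankK.
Qed.

Section Families.
Variable I : finType.
Implicit Types x y : I -> I -> S.

Lemma fconeD x y : fcone x -> fcone y -> fcone (fun i j => x i j + y i j).
Proof.
move=> cx cy; have := opsys_add (opsysP S) cx cy.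
by congr (mos_cone _); apply/matrixP => p q; rewrite !mxE.
Qed.

Lemma fconeZ r x : 0 <= r -> fcone x -> fcone (fun i j => rC r *: x i j).
Proof.
move=> r0 cx; have := opsys_scale (opsysP S) r0 cx.
by congr (mos_cone _); apply/matrixP => p q; rewrite !mxE.
Qed.

(** The order unit axiom at X = 0 gives r > 0 with r 1 >= 0; it remains to divide by r. *)
Lemma fcone_unit : fcone (fun i j : I => (i == j)%:R *: mos_one S).
Proof.
have [|r r0] := @opsys_unit _ _ (opsysP S) #|I| 0.
  apply/matrixP => i j; rewrite !mxE.
  exact: mos_star0.
have ri : 0 <= r^-1 by rewrite invr_ge0 ltW.
move=> /(opsys_scale (opsysP S) ri); congr (mos_cone _).
apply/matrixP => p q; rewrite addr0 [LHS]mxE mxunitrE scalerA mulrA.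
by rewrite rCVK// mul1r [RHS]mxE (inj_eq enum_val_inj).
Qed.

Lemma fcone0 : fcone (fun i j : I => 0 : S).
Proof. by apply: eq_fcone (fconeZ (lexx 0) fcone_unit) => i j; rewrite scale0r. Qed.

Lemma fcone_sum (J : Type) (s : seq J) (P : pred J) (x : J -> I -> I -> S) :
  (forall k, P k -> fcone (x k)) -> fcone (fun i j => \sum_(k <- s | P k) x k i j).
Proof.
move=> cx; elim: s => [|k s IH].
  by apply: eq_fcone fcone0 => i j; rewrite big_nil.
case: (boolP (P k)) => Pk.
  by apply: eq_fcone (fconeD (cx _ Pk) IH) => i j; rewrite big_cons Pk.
by apply: eq_fcone IH => i j; rewrite big_cons (negbTE Pk).
Qed.

Lemma fcone_star x i j : fcone x -> mos_star (x i j) = x j i.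
Proof.
move=> /(opsys_sa (opsysP S))/matrixP/(_ (enum_rank j) (enum_rank i)).
by rewrite !mxE !enum_rankK.
Qed.

Lemma fcone_order_unit x : (forall i j, mos_star (x i j) = x j i) ->
  exists2 r, 0 < r & fcone (fun i j => (rC r * (i == j)%:R) *: mos_one S + x i j).
Proof.
move=> hx.
have [|r r0 h] := @opsys_unit _ _ (opsysP S) _
    (\matrix_(p < #|I|, q < #|I|) x (enum_val p) (enum_val q)).
  by apply/matrixP => p q; rewrite !mxE.
exists r => //; move: h; congr (mos_cone _).
apply/matrixP => p q; rewrite [LHS]mxE mxunitrE !mxE.
by rewrite (inj_eq enum_val_inj).
Qed.

End Families.

(** A block Schur product: in a Gram factorization of A, each rank one term contributes a
    compression of Q. *)
Lemma fcone_schur (I J : finType) (A : I * J -> I * J -> C) (Q : J -> J -> S) :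
  fpsd A -> fcone Q ->
  fcone (fun i j => \sum_a \sum_b A (i, a) (j, b) *: Q a b).
Proof.
move=> /fpsd_factor[B AE] cQ.
have := @fcone_sum I _ (index_enum (I * J)%type) xpredT _
  (fun k _ => fcone_compress (fun i a => B (i, a) k) cQ).
apply: eq_fcone => i j; rewrite exchange_big; apply: eq_bigr => a _ /=.
rewrite exchange_big; apply: eq_bigr => b _ /=.
by rewrite AE scaler_suml.
Qed.

Lemma fcone_tensor (I J : finType) (A : I -> I -> C) (Q : J -> J -> S) :
  fpsd A -> fcone Q -> fcone (fun p q : I * J => A p.1 q.1 *: Q p.2 q.2).
Proof.
move=> /fpsd_factor[B AE] cQ.
have := @fcone_sum (I * J)%type I (index_enum I) xpredT _
  (fun k _ => fcone_compress (fun p a => B p.1 k * (p.2 == a)%:R) cQ).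
apply: eq_fcone => p q; rewrite AE scaler_suml; apply: eq_bigr => k _.
under eq_bigr => a _.
  under eq_bigr => b _ do
    rewrite cjM rmorph_nat [(_ == a)%:R]lock mulrACA [_ * (_ == b)%:R]mulrC mulrA mulrC mulrA -scalerA -lock.
  rewrite -scaler_sumr sum_deltaZ -scalerA; over.
by rewrite sum_deltaZ.
Qed.

Lemma fcone_fpsd (I : finType) (A : I -> I -> C) (h : S) :
  fpsd A -> fcone (fun _ _ : unit => h) -> fcone (fun i j => A i j *: h).
Proof.
move=> pA ch.
apply: eq_fcone (fcone_schur (fpsd_reindex (fst : I * unit -> I) pA) ch) => i j.
by rewrite (big_pred1 tt) ?(big_pred1 tt)//; case.
Qed.

Lemma mos_starZ a (x : S) : mos_star (a *: x) = cj a *: mos_star x.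
Proof.
by have := opsys_star_semilinear (opsysP S) a x 0; rewrite mos_star0 !addr0.
Qed.

Lemma mos_starB (x y : S) : mos_star (x - y) = mos_star x - mos_star y.
Proof. by rewrite -scaleN1r mos_starD mos_starZ rmorphN rmorph1 scaleN1r. Qed.

Lemma mos_starN (x : S) : mos_star (- x) = - mos_star x.
Proof. by rewrite -sub0r mos_starB mos_star0 sub0r. Qed.

Lemma mos_starK (x : S) : mos_star (mos_star x) = x.
Proof. exact: opsys_starK (opsysP S) x. Qed.

Lemma mos_star_one : mos_star (mos_one S) = mos_one S.
Proof. exact: opsys_one_sa (opsysP S). Qed.

Lemma mos_star_sum (J : Type) (s : seq J) (P : pred J) (F : J -> S) :
  mos_star (\sum_(j <- s | P j) F j) = \sum_(j <- s | P j) mos_star (F j).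
Proof. exact: (big_morph _ mos_starD mos_star0). Qed.

Definition pos_elt (x : S) := fcone (fun _ _ : unit => x).

Lemma pos_elt_one : pos_elt (mos_one S).
Proof. by apply: eq_fcone (fcone_unit unit) => -[] []; rewrite scale1r. Qed.

Lemma pos_elt_bound (x : S) : mos_star x = x ->
  exists2 r, 0 < r & pos_elt (rC r *: mos_one S + x).
Proof.
move=> sx; have [//|r r0 h] := @fcone_order_unit unit (fun _ _ => x).
by exists r => //; apply: eq_fcone h => -[] []; rewrite mulr1.
Qed.

(** Real and imaginary parts reduce to self-adjoint y, and y = (r 1 + y) - r 1 for an order bound
    r. *)
Lemma pos_elt_span (x : S) : lin_span [set p | pos_elt p] x.
Proof.
have sa y : mos_star y = y -> lin_span [set p | pos_elt p] y.
  move=> /pos_elt_bound[r r0 yr].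
  rewrite (_ : y = - rC r *: mos_one S + (rC r *: mos_one S + y)); last first.
    by rewrite addrA scaleNr addNr add0r.
  by apply: lin_spanZD; apply: lin_span_gen => //; exact: pos_elt_one.
have -> : x = 2^-1 *: (x + mos_star x)
              + (- ('i / 2) *: ('i *: (x - mos_star x)) + 0).
  rewrite addr0 scalerA mulNr mulrAC -expr2 sqrCi mulNr mul1r opprK -scalerDr.
  by rewrite addrACA subrr addr0 -mulr2n -(scaler_nat 2 x) scalerA mulVf ?scale1r ?pnatr_eq0.
apply: lin_spanZD.
  by apply: sa; rewrite mos_starD mos_starK addrC.
apply: lin_spanZD; last exact: lin_span0.
by apply: sa; rewrite mos_starZ mos_starB mos_starK conjCi -opprB scalerN scaleNr opprK.
Qed.

End Opsys.

Lemma ucp_fcone (S T : mospace R) (f : S -> T) (I : finType) (x : I -> I -> S) :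
  ucp f -> fcone x -> fcone (fun i j => f (x i j)).
Proof.
by move=> [_ _ h] /h; congr (mos_cone _); apply/matrixP => p q; rewrite !mxE.
Qed.

Lemma linear_sumZ (V W : lmodType C) (f : V -> W) : linear f ->
  forall (J : Type) (s : seq J) (c : J -> C) (x : J -> V),
  f (\sum_(j <- s) c j *: x j) = \sum_(j <- s) c j *: f (x j).
Proof.
move=> fl J s c x; have f0 : f 0 = 0.
  by have := fl (-1) 0 0; rewrite scaler0 addr0 scaleN1r addNr.
elim: s => [|j s IH]; first by rewrite !big_nil.
by rewrite !big_cons fl IH.
Qed.

Lemma linear0_of (V W : lmodType C) (f : V -> W) : linear f -> f 0 = 0.
Proof.
by move=> fl; have := fl (-1) 0 0; rewrite scaler0 addr0 scaleN1r addNr.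
Qed.

Lemma linearZ_of (V W : lmodType C) (f : V -> W) : linear f ->
  forall a x, f (a *: x) = a *: f x.
Proof. by move=> fl a x; rewrite -[a *: x]addr0 fl linear0_of// addr0. Qed.

Lemma linearD_of (V W : lmodType C) (f : V -> W) : linear f ->
  forall x y, f (x + y) = f x + f y.
Proof. by move=> fl x y; have := fl 1 x y; rewrite !scale1r. Qed.

Lemma linear_sum_of (V W : lmodType C) (f : V -> W) : linear f ->
  forall (J : Type) (s : seq J) (P : pred J) (x : J -> V),
  f (\sum_(j <- s | P j) x j) = \sum_(j <- s | P j) f (x j).
Proof.
by move=> fl J s P x; apply: (big_morph f (linearD_of fl) (linear0_of fl)).
Qed.

Lemma map_mxunitr (S T : mospace R) (f : S -> T) n r : linear f ->
  f (mos_one S) = mos_one T -> map_mx f (mxunitr S n r) = mxunitr T n r.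
Proof.
move=> fl f1; apply/matrixP => i j.
by rewrite [LHS]mxE !mxunitrE (linearZ_of fl) f1.
Qed.

Lemma mx_mos_opsys k : is_opsys (mx_mos R k).
Proof.
split.
- move=> a A B; apply/matrixP => i j; rewrite !mxE; exact: (etrans (cjD _ _) (congr2 _ (cjM _ _) erefl)).
- by move=> A; apply/matrixP => i j; rewrite !mxE conjCK.
- move=> n X; rewrite /= psd_flatE => pX.
  apply/matrixP => i j; apply/matrixP => a b; rewrite !mxE /=.
  by have /= -> := fpsd_herm (i, a) (j, b) pX; rewrite conjCK.
- move=> n X Y; rewrite /= !psd_flatE => pX pY.
  by apply: eq_fpsd (fpsdD pX pY) => p q; rewrite !mxE.
- move=> n r X r0; rewrite /= !psd_flatE => pX.
  have {}r0 : 0 <= rC r by rewrite lecR.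
  by apply: eq_fpsd (fpsdZ r0 pX) => p q; rewrite !mxE.
- move=> n X; rewrite /= !psd_flatE => pX pNX.
  apply/matrixP => i j; apply/matrixP => a b; rewrite !mxE.
  apply: (fpsd_anti (i, a) (j, b) pX).
  by apply: eq_fpsd pNX => p q; rewrite !mxE.
- move=> n m a X; rewrite /= !psd_flatE => pX.
  apply: eq_fpsd (fpsd_local1 (fun i j => a i j) pX) => p q; rewrite mxE /= summxE; apply: eq_bigr => i _.
  by rewrite summxE; apply: eq_bigr => j _; rewrite mxE.
- by apply/matrixP => i j; rewrite !mxE rmorph_nat eq_sym.
- move=> n X sX.
  have [|r r0 hr] := @fpsd_order_unit R ('I_n * 'I_k)%type (fun p q => X p.1 q.1 p.2 q.2).
    by move=> p q; rewrite -{1}sX !mxE.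
  exists r => //; rewrite /= psd_flatE; apply: eq_fpsd hr => p q.
  by rewrite (@mxunitrDE (mx_mos R k) n r X) !mxE -mulrA -natrM mulnb -xpair_eqE -!surjective_pairing.
- move=> n X h; rewrite /= psd_flatE; apply: fpsd_arch => r r0.
  have := h r r0; rewrite /= psd_flatE; apply: eq_fpsd => p q.
  by rewrite (@mxunitrDE (mx_mos R k) n r X) !mxE -mulrA -natrM mulnb -xpair_eqE -!surjective_pairing.
Qed.

Section UcpStar.
Variables (S T : mospace R) (f : S -> T).
Hypotheses (fucp : ucp f) (Ssa : is_opsys S) (Tsa : is_opsys T).

(** Positive elements and their images are self-adjoint, and positive elements span. *)
Lemma ucp_star x : f (mos_star x) = mos_star (f x).
Proof.
have [n [c [p [pp ->]]]] := @pos_elt_span (Opsys Ssa) x.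
have fl : linear f by have [] := fucp.
rewrite (linear_sumZ fl) (@mos_star_sum (Opsys Ssa)) (@mos_star_sum (Opsys Tsa)).
have sE i : mos_star (c i *: p i) = cj (c i) *: p i.
  by rewrite (@mos_starZ (Opsys Ssa)) (@fcone_star (Opsys Ssa) _ _ tt tt (pp i)).
under eq_bigr do rewrite sE; rewrite (linear_sumZ fl).
apply: eq_bigr => i _; rewrite (@mos_starZ (Opsys Tsa)).
by rewrite (@fcone_star (Opsys Tsa) _ _ tt tt (ucp_fcone fucp (pp i))).
Qed.

End UcpStar.

End OperatorSystemCones.

(** * Extension and separation by completely positive maps *)

Section PositiveExtension.
Local Open Scope ring_scope.
Local Open Scope classical_set_scope.
Variable R : realType.
Local Notation C := R[i].
Local Notation rC r := ((r%:C)%C : C).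
Variables (V : lmodType C) (K : set V) (u0 : V) (W : set V) (phi : V -> R).
Hypothesis K_add : forall x y, K x -> K y -> K (x + y).
Hypothesis K_scale : forall r x, 0 <= r -> K x -> K (rC r *: x).
Hypothesis K_unit : forall x, exists r, K (rC r *: u0 + x).
Hypothesis W_unit : W u0.
Hypothesis W_linear : forall r x y, W x -> W y -> W (rC r *: x + y).
Hypothesis phi_linear : forall r x y, W x -> W y ->
  phi (rC r *: x + y) = r * phi x + phi y.
Hypothesis phi_pos : forall x, W x -> K x -> 0 <= phi x.

(* Partial positive real functionals extending phi, as graphs. *)
Let graph0 : set (V * R) := [set z | W z.1 /\ z.2 = phi z.1].

Let positive_graph (G : set (V * R)) :=
  (forall r x s y t, G (x, s) -> G (y, t) -> G (rC r *: x + y, r * s + t)) /\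
  (forall x s, G (x, s) -> K x -> 0 <= s).

(** The extension theorem of M. Riesz, with [u0] as order unit: a maximal positive graph is total,
    because a vector outside its domain can be given the supremum of its lower bounds as value. *)
Lemma positive_extension : exists psi : V -> R,
  [/\ forall r x y, psi (rC r *: x + y) = r * psi x + psi y,
      forall x, K x -> 0 <= psi x
    & forall x, W x -> psi x = phi x].
Proof.
have [A [[GD Gpos] Amax]] : exists A, positive_graph (A `|` graph0) /\
    forall B, A `<` B -> ~ positive_graph (B `|` graph0).
  (* The conditions bear on [A] together with [graph0], so that the empty chain has an admissible
     union too. *)
  apply: (@Zorn_bigcup _ [set A | positive_graph (A `|` graph0)]) => F FP Ftot.
  split=> [r x s y t|x s].
    move=> [[X FX Xx]|x0] [[Y FY Yy]|y0].
    - have [XY|YX] := Ftot _ _ FX FY.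
        have [h _] := FP _ FY.
        by have [] := h r x s y t (or_introl (XY _ Xx)) (or_introl Yy); [left; exists Y|right].
      have [h _] := FP _ FX.
      by have [] := h r x s y t (or_introl Xx) (or_introl (YX _ Yy)); [left; exists X|right].
    - have [h _] := FP _ FX.
      by have [] := h r x s y t (or_introl Xx) (or_intror y0); [left; exists X|right].
    - have [h _] := FP _ FY.
      by have [] := h r x s y t (or_intror x0) (or_introl Yy); [left; exists Y|right].
    - right; move: x0 y0 => [/= Wx ->] [/= Wy ->]; split=> /=; first exact: W_linear.
      by rewrite phi_linear.
  move=> [[X FX Xx]|[/= Wx ->]]; last exact: phi_pos.
  by have [_] := FP _ FX; apply; left.
set G := A `|` graph0 in GD Gpos.
have G0 : G (0, 0).
  have Wu : G (u0, phi u0) by right.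
  by have := GD (-1) _ _ _ _ Wu Wu; rewrite rmorphN rmorph1 scaleN1r addNr mulN1r addNr.
have GZ r x s : G (x, s) -> G (rC r *: x, r * s).
  by move=> Gx; have := GD r _ _ _ _ Gx G0; rewrite !addr0.
have K0 : K 0.
  have [r Kr] := K_unit 0.
  by have := K_scale (lexx 0) Kr; rewrite scale0r.
have G_fun x s t : G (x, s) -> G (x, t) -> s = t.
  have le a b : G (x, a) -> G (x, b) -> a <= b.
    move=> Ga Gb; rewrite -subr_ge0 addrC -mulN1r; apply: (Gpos 0) => //.
    by have := GD (-1) _ _ _ _ Ga Gb; rewrite rmorphN rmorph1 scaleN1r addNr.
  by move=> Gs Gt; apply/eqP; rewrite eq_le !le.
have G_total v : exists s, G (v, s).
  apply: contrapT => Gv.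
  (* Lower bounds for a value at v: if u + v is in K, the value is at least minus the value at u. By
     [LU] they lie below the upper bounds, which come from u - v in K. *)
  pose L := [set s | exists u, G (u, - s) /\ K (u + v)].
  have LU l t u : L l -> G (u, t) -> K (u - v) -> l <= t.
    move=> [u' [Gu' Ku']] Gu Ku; rewrite -subr_ge0 addrC.
    apply: (Gpos (u' + u)).
      by have := GD 1 _ _ _ _ Gu' Gu; rewrite scale1r mul1r.
    by have := K_add Ku' Ku; rewrite addrACA subrr addr0.
  have Gu r : G (rC r *: u0, r * phi u0) by apply: GZ; right.
  have L_sup : has_sup L.
    split.
      by have [r Kr] := K_unit v; exists (- (r * phi u0)), (rC r *: u0); rewrite opprK.
    have [r Kr] := K_unit (- v); exists (r * phi u0) => l Ll.
    exact: LU Ll (Gu r) Kr.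
  pose c := sup L.
  pose B : set (V * R) := [set z | exists u s t,
    G (u, s) /\ z = (u + rC t *: v, s + t * c)].
  have GB z : G z -> B z.
    by case: z => x s Gx; exists x, s, 0; rewrite scale0r mul0r !addr0.
  have Bv : B (v, c) by exists 0, 0, 1; rewrite scale1r mul1r !add0r.
  apply: (Amax B).
    split; first by move=> z Az; apply: GB; left.
    by move=> BA; apply: Gv; exists c; left; exact: BA.
  have -> : B `|` graph0 = B by apply: setUidl => z ?; apply: GB; right.
  split=> [r x s y t|x s].
    move=> [u [p [a [Ga [-> ->]]]]] [u' [p' [a' [Ga' [-> ->]]]]].
    exists (rC r *: u + u'), (r * p + p'), (r * a + a'); split; first exact: GD.
    congr pair; last by ring.
    by rewrite scalerDr rmorphD rmorphM scalerDl scalerA addrACA.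
  move=> [u [p [a [Ga [-> ->]]]]] Ku.
  (* After division by |a|, membership of u + a v in K is a lower bound at v for a > 0 and an upper
     bound for a < 0; c respects both. *)
  have [a0|a0|a0] := ltgtP a 0; last first.
  - by move: Ku; rewrite a0 scale0r mul0r !addr0; exact: Gpos.
  - have Kv : K (rC a^-1 *: u + v).
      have ai : 0 <= a^-1 by rewrite invr_ge0 ltW.
      have := K_scale ai Ku; rewrite scalerDr scalerA rCVK//.
      by rewrite scale1r.
    have : - (a^-1 * p) <= c.
      apply: ub_le_sup; first by case: L_sup.
      by exists (rC a^-1 *: u); rewrite opprK; split => //; exact: GZ.
    rewrite lerNl -(ler_pM2l a0) mulrA divff ?gt_eqF// mul1r mulrN.
    by rewrite -subr_ge0 opprK.
  - have Kv : K (rC (- a)^-1 *: u - v).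
      have ai : 0 <= (- a)^-1 by rewrite invr_ge0 oppr_ge0 ltW.
      have := K_scale ai Ku; rewrite scalerDr scalerA invrN rCN mulNr.
      by rewrite -rCM mulVf ?lt_eqF// scaleN1r.
    have : c <= (- a)^-1 * p.
      apply: ge_sup; first by case: L_sup.
      by move=> l Ll; apply: LU Ll _ Kv; exact: GZ.
    rewrite -(ler_pM2l (x := - a)) ?oppr_gt0// mulrA divff ?oppr_eq0 ?lt_eqF// mul1r.
    by rewrite mulNr -subr_ge0 opprK.
pose psi v := xget 0 [set s | G (v, s)].
have psiG v : G (v, psi v).
  by rewrite /psi; case: xgetP => // h; have [s /h] := G_total v.
exists psi; split=> [r x y|x|x Wx].
- by apply: (G_fun (rC r *: x + y)) => //; exact: GD.
- exact: Gpos.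
- by apply: (G_fun x) => //; right.
Qed.

End PositiveExtension.

(** * Positive functionals on matrices over a system, and the matrix-valued maps they encode *)

Section MatrixFunctionals.
Local Open Scope ring_scope.
Local Open Scope classical_set_scope.
Local Open Scope sesquilinear_scope.
Variable R : realType.
Local Notation C := R[i].
Local Notation cj := Num.conj.
Local Notation rC r := ((r%:C)%C : C).

Lemma ge0_of_perturbation (a z : R) : (forall d, 0 < d -> 0 <= a + d * z) -> 0 <= a.
Proof.
move=> h; rewrite leNgt; apply/negP => a0.
have y0 : 0 < `|z| + 1 by rewrite ltr_wpDl.
have d1 : 0 < - a / (`|z| + 1) / 2 by rewrite !divr_gt0 ?oppr_gt0.
have := h _ d1; set d := _ / 2 in d1 *.
have : d * z <= d * (`|z| + 1).
  by rewrite ler_pM2l// (le_trans (ler_norm z))// lerDl.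
have -> : d * (`|z| + 1) = - a / 2 by rewrite /d; field; rewrite gt_eqF.
lra.
Qed.

Section Complexification.
Variables (V : lmodType C) (psi : V -> R).
Hypothesis psi_linear : forall r x y, psi (rC r *: x + y) = r * psi x + psi y.

(** The complex linear functional with real part [psi]. *)
Definition complexify (v : V) : C := rC (psi v) - 'i * rC (psi ('i *: v)).

Lemma complexify_linear a x y :
  complexify (a *: x + y) = a * complexify x + complexify y.
Proof.
have psi0 : psi 0 = 0 by have := psi_linear (-1) 0 0; rewrite scaler0 addr0; lra.
have psiZ r u : psi (rC r *: u) = r * psi u.
  by have := psi_linear r u 0; rewrite psi0 !addr0.
have psiD u v : psi (u + v) = psi u + psi v.
  by have := psi_linear 1 u v; rewrite scale1r mul1r.
have psiN u : psi (- u) = - psi u.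
  by have := psiZ (-1) u; rewrite rCN scaleN1r mulN1r.
case: a => a b; have -> : (a +i* b)%C = rC a + 'i * rC b.
  by simpc.
have -> : (rC a + 'i * rC b) *: x = rC a *: x + rC b *: ('i *: x).
  by rewrite scalerDl scalerA [_ * 'i]mulrC.
rewrite /complexify.
have -> : 'i *: (rC a *: x + rC b *: ('i *: x) + y) =
    rC a *: ('i *: x) - rC b *: x + 'i *: y.
  rewrite !scalerDr !scalerA [_ * rC a]mulrC.
  by rewrite mulrAC -expr2 sqrCi mulN1r scaleNr.
rewrite !psiD psiN !psiZ !rCD rCN !rCM.
have i2 : 'i * 'i = -1 :> C by rewrite -expr2 sqrCi.
ring: i2.
Qed.

End Complexification.

Section Functional.
Variables (S : opsys R) (k : nat) (w : mxmod S k -> C).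
Hypothesis w_linear : forall a x y, w (a *: x + y) = a * w x + w y.
Hypothesis w_pos : forall X, mos_cone (X : 'M[S]_k) -> 0 <= w X.

Definition mx_elem (i j : 'I_k) (s : S) : mxmod S k :=
  (\matrix_(a, b) (((i == a)%:R * (j == b)%:R) *: s) : 'M[S]_k).

(** The Choi correspondence between functionals on M_k(S) and maps from S to M_k; [choi_map_trace]
    recovers the functional. *)
Definition choi_map (s : S) : 'M[C]_k := \matrix_(i, j) w (mx_elem i j s).

Lemma w_sum (J : Type) (r : seq J) (c : J -> C) (X : J -> mxmod S k) :
  w (\sum_(j <- r) c j *: X j) = \sum_(j <- r) c j * w (X j).
Proof.
have w0 : w 0 = 0.
  by have := w_linear (-1) 0 0; rewrite scaler0 addr0 mulN1r addNr.
elim: r => [|j r IH]; first by rewrite !big_nil.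
by rewrite !big_cons w_linear IH.
Qed.

Lemma choi_map_linear : linear choi_map.
Proof.
move=> a s t; apply/matrixP => i j; rewrite !mxE -w_linear; congr w.
by apply/matrixP => p q; rewrite !mxE scalerDr !scalerA mulrC.
Qed.

Lemma mx_elem_sum (X : mxmod S k) : X = \sum_i \sum_j 1 *: mx_elem i j (X i j).
Proof.
apply/matrixP => a b; rewrite summxE.
under eq_bigr => i _.
  rewrite summxE.
  under eq_bigr => j _ do rewrite scale1r mxE mulrC -scalerA [j == b]eq_sym.
  rewrite sum_deltaZ [i == a]eq_sym; over.
by rewrite sum_deltaZ.
Qed.

Lemma choi_map_trace (X : mxmod S k) : w X = \sum_i \sum_j choi_map (X i j) i j.
Proof.
rewrite {1}[X]mx_elem_sum pair_bigA w_sum [RHS]pair_bigA.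
by apply: eq_bigr => p _; rewrite mul1r mxE.
Qed.

(** Positivity of w at level k gives positivity at every level: the vector v compresses x to a k by
    k matrix y over S, and the form at v is w(y). *)
Lemma choi_map_cp (I : finType) (x : I -> I -> S) : fcone x ->
  fpsd (fun p q : I * 'I_k => choi_map (x p.1 q.1) p.2 q.2).
Proof.
move=> cx v; pose y i j : S := \sum_a \sum_b (v (a, i) * cj (v (b, j))) *: x a b.
have cY : mos_cone (\matrix_(i < k, j < k) y i j).
  apply/mos_coneE; apply: eq_fcone (fcone_compress (fun i a => v (a, i)) cx).
  by move=> i j; rewrite mxE.
set Y := \matrix_(_, _) _ in cY; have := w_pos cY; congr (_ <= _); rewrite choi_map_trace.
have yE i j : choi_map (Y i j) i j =
    \sum_a \sum_b v (a, i) * choi_map (x a b) i j * cj (v (b, j)).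
  rewrite (_ : Y i j = y i j); last by rewrite mxE.
  rewrite /y pair_bigA (linear_sumZ choi_map_linear) summxE pair_bigA.
  by apply: eq_bigr => p _; rewrite mxE; ring.
under eq_bigr => i _ do under eq_bigr => j _ do rewrite yE.
rewrite [RHS]sum_pair [RHS]exchange_big; apply: eq_bigr => i _ /=.
under [RHS]eq_bigr do rewrite sum_pair exchange_big /=.
by rewrite [RHS]exchange_big.
Qed.

End Functional.

Section SelfAdjoint.
Variables (S : opsys R) (k : nat).

Lemma mxstarD (X Y : 'M[S]_k) : mxstar (X + Y) = mxstar X + mxstar Y.
Proof. by apply/matrixP => i j; rewrite !mxE mos_starD. Qed.

Lemma mxstarN (X : 'M[S]_k) : mxstar (- X) = - mxstar X.
Proof. by apply/matrixP => i j; rewrite !mxE mos_starN. Qed.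

Lemma mxstarK (X : 'M[S]_k) : mxstar (mxstar X) = X.
Proof. by apply/matrixP => i j; rewrite !mxE mos_starK. Qed.

Lemma mxstarZ a (X : mxmod S k) :
  mxstar (a *: X : mxmod S k) = (cj a *: (mxstar X : mxmod S k) : mxmod S k).
Proof. by apply/matrixP => i j; rewrite !mxE mos_starZ. Qed.

Lemma mos_cone0 : mos_cone (0 : 'M[S]_k).
Proof. by apply/mos_coneE; apply: eq_fcone (fcone0 _ _) => i j; rewrite mxE. Qed.

Lemma mos_coneZ r (X : mxmod S k) : 0 <= r -> mos_cone (X : 'M[S]_k) ->
  mos_cone ((rC r *: X : mxmod S k) : 'M[S]_k).
Proof. by move=> r0 /(opsys_scale (opsysP S) r0). Qed.

Lemma mxunitr_star r : mxstar (mxunitr S k r) = mxunitr S k r.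
Proof.
apply/matrixP => i j; rewrite mxE !mxunitrE mos_starZ mos_star_one.
by rewrite cjM cj_real rmorph_nat eq_sym.
Qed.

Lemma mxmodDr a (X Y : 'M[S]_k) :
  ((a *: (X : mxmod S k) : mxmod S k) : 'M[S]_k) + (a *: (Y : mxmod S k) : mxmod S k) =
  (a *: ((X + Y : 'M[S]_k) : mxmod S k) : mxmod S k).
Proof. by apply/matrixP => i j; rewrite !mxE scalerDr. Qed.

Lemma mxmodDl a b (X : 'M[S]_k) :
  ((a *: (X : mxmod S k) : mxmod S k) : 'M[S]_k) + (b *: (X : mxmod S k) : mxmod S k) =
  ((a + b) *: (X : mxmod S k) : mxmod S k).
Proof. by apply/matrixP => i j; rewrite !mxE scalerDl. Qed.

Lemma mxunitrZ a r : mxunitr S k (a * r) = (rC a *: (mxunitr S k r : mxmod S k) : mxmod S k).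
Proof.
by apply/matrixP => i j; rewrite mxunitrE mxE mxunitrE scalerA rCM mulrA.
Qed.

Lemma mxunitr_pos r : 0 <= r -> mos_cone (mxunitr S k r).
Proof.
move=> r0; apply/mos_coneE; apply: eq_fcone (fconeZ r0 (fcone_unit S _)) => i j.
by rewrite mxunitrE scalerA.
Qed.

Variable psi : mxmod S k -> R.
Hypothesis psi_linear : forall r x y, psi (rC r *: x + y) = r * psi x + psi y.
Hypothesis psi_pos : forall X : 'M[S]_k, mos_cone (X + mxstar X) -> 0 <= psi X.

(** Skew-adjoint elements satisfy X + X^* = 0, so [psi] is nonnegative at both 'i X and - 'i X and
    vanishes there. *)
Lemma complexify_sa (X : 'M[S]_k) : mxstar X = X ->
  complexify psi X = rC (psi X).
Proof.
move=> sX; have skew a : cj a = - a -> 0 <= psi (a *: (X : mxmod S k)).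
  move=> ca; apply: psi_pos; rewrite mxstarZ ca sX.
  have -> : (a *: (X : mxmod S k)) + (- a *: (X : mxmod S k)) = 0.
    by rewrite scaleNr subrr.
  exact: mos_cone0.
have h1 := skew 'i (conjCi _).
have h2 : 0 <= psi (- 'i *: (X : mxmod S k)).
  by apply: skew; rewrite cjN conjCi.
have psi0 : psi 0 = 0 by have := psi_linear (-1) 0 0; rewrite scaler0 addr0; lra.
have psiN u : psi (- u) = - psi u.
  by have := psi_linear (-1) u 0; rewrite addr0 psi0 rCN scaleN1r mulN1r addr0.
rewrite /complexify; have -> : psi ('i *: (X : mxmod S k)) = 0.
  by move: h2; rewrite scaleNr psiN; lra.
by rewrite mulr0 subr0.
Qed.

Lemma complexify_pos (X : 'M[S]_k) : mos_cone X -> 0 <= complexify psi X.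
Proof.
move=> cX; have sX := opsys_sa (opsysP S) cX.
rewrite complexify_sa// lecR; apply: psi_pos; rewrite sX.
exact: (opsys_add (opsysP S) cX cX).
Qed.

End SelfAdjoint.

Definition order_embedding (S T : mospace R) (f : S -> T) : Prop :=
  [/\ ucp f, injective f
    & forall n (X : 'M[S]_n), mos_cone (map_mx f X) -> mos_cone X].

Lemma ReB_i (z : C) : rC (complex.Re z) - 'i * rC (complex.Re ('i * z)) = z.
Proof. by case: z => a b; simpc. Qed.

Lemma Re_ge0 (z : C) : 0 <= z + cj z -> 0 <= complex.Re z.
Proof. by case: z => a b; rewrite lecE /= => /andP[_]; lra. Qed.

(* Arveson: g corresponds to a positive functional on M_k(E), which is extended
   to M_k(T). *)
Lemma ucp_extension (E T : opsys R) (h : E -> T) k (g : E -> 'M[C]_k) :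
    order_embedding h -> @ucp R E (mx_mos R k) g ->
  exists g' : T -> 'M[C]_k, @ucp R T (mx_mos R k) g' /\ forall x, g' (h x) = g x.
Proof.
move=> [hucp hinj hcone] gucp; have [hlin h1 hpos] := hucp; have [glin g1 gpos] := gucp.
(* The form of g_k(Y) at the vector sum_i e_i (x) e_i, which is why it is positive. *)
pose G (Y : mxmod E k) : C := \sum_i \sum_j g (Y i j) i j.
have Glin a X Y : G (a *: X + Y) = a * G X + G Y.
  rewrite mulr_sumr -big_split; apply: eq_bigr => i _ /=.
  rewrite mulr_sumr -big_split; apply: eq_bigr => j _ /=.
  by rewrite !mxE glin !mxE.
have Gpos (Y : 'M[E]_k) : mos_cone Y -> 0 <= G Y.
  move=> /gpos; rewrite /= psd_flatE => /(_ (fun p => (p.1 == p.2)%:R)).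
  congr (_ <= _); rewrite /sform sum_pair; apply: eq_bigr => i _ /=.
  transitivity (\sum_i0 (i == i0)%:R *
    \sum_(q : 'I_k * 'I_k) g (Y i q.1) i0 q.2 * cj ((q.1 == q.2)%:R)).
    apply: eq_bigr => j _; rewrite mulr_sumr; apply: eq_bigr => q _.
    by rewrite mxE mulrA.
  rewrite sum_delta sum_pair; apply: eq_bigr => j _ /=.
  by under eq_bigr do rewrite rmorph_nat mulrC; rewrite sum_delta.
have Gstar (Y : 'M[E]_k) : G (mxstar Y) = cj (G Y).
  rewrite cj_sum; under [RHS]eq_bigr do rewrite cj_sum.
  rewrite exchange_big; apply: eq_bigr => i _ /=; apply: eq_bigr => j _ /=.
  have /= gs := ucp_star gucp (opsysP E) (mx_mos_opsys R k).
  by rewrite mxE gs !mxE.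
pose W : set (mxmod T k) := [set X | exists Y : 'M[E]_k, X = map_mx h Y].
pose phi (X : mxmod T k) := complex.Re (G (xget 0 [set Y : 'M[E]_k | X = map_mx h Y])).
have phiE (Y : 'M[E]_k) : phi (map_mx h Y) = complex.Re (G Y).
  rewrite /phi; case: xgetP => [Z _ ZY|/(_ Y)]; last by case.
  congr (complex.Re (G _)); apply/matrixP => i j; apply: hinj.
  by move/matrixP: ZY => /(_ i j); rewrite !mxE.
have hstar := ucp_star hucp (opsysP E) (opsysP T).
have hD a (X Y : mxmod E k) : map_mx h (a *: X + Y : mxmod E k) =
    (a *: (map_mx h X : mxmod T k) + (map_mx h Y : mxmod T k) : mxmod T k).
  by apply/matrixP => i j; rewrite !mxE hlin.
(* Testing X + X^* instead of X makes the unit an order unit for all of M_k(T), not only for its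
   self-adjoint part. *)
pose K : set (mxmod T k) := [set X | mos_cone ((X : 'M[T]_k) + mxstar X)].
have [|||||||psi [psi_lin psi_pos psi_ext]] := @positive_extension R (mxmod T k) K
    (mxunitr T k 1) W phi.
- move=> X Y cX cY; rewrite /K/= mxstarD addrACA.
  by have := opsys_add (opsysP T) cX cY; exact.
- move=> r X r0 cX; rewrite /K/= mxstarZ cj_real mxmodDr.
  exact: mos_coneZ.
- move=> X; have [|r r0 hr] := @opsys_unit _ _ (opsysP T) k ((X : 'M[T]_k) + mxstar X).
    by rewrite mxstarD mxstarK addrC.
  exists (r / 2); rewrite /K/= mxstarD mxstarZ mxunitr_star cj_real addrACA.
  rewrite mxmodDl -rCD -splitr -mxunitrZ mulr1.
  exact: hr.
- by exists (mxunitr E k 1); rewrite map_mxunitr.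
- by move=> r _ _ [X ->] [Y ->]; exists (rC r *: (X : mxmod E k) + Y); rewrite hD.
- move=> r _ _ [X ->] [Y ->]; rewrite -hD !phiE Glin.
  by case: (G X) (G Y) => a b [c d]; simpc.
- move=> _ [Y ->]; rewrite /K/= (_ : _ + _ = map_mx h (Y + mxstar Y)); last first.
    by apply/matrixP => i j; rewrite !mxE (linearD_of hlin) hstar.
  move=> /hcone/Gpos; rewrite phiE -[Y in Y + _](scale1r (Y : mxmod E k)) Glin Gstar mul1r.
  exact: Re_ge0.
have w_lin := complexify_linear psi_lin.
have w_pos := complexify_pos psi_lin psi_pos.
have w_ext (Y : 'M[E]_k) : complexify psi (map_mx h Y) = G Y.
  have hZ : ('i *: (map_mx h Y : mxmod T k)) = map_mx h ('i *: (Y : mxmod E k) : mxmod E k).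
    by apply/matrixP => i j; rewrite !mxE (linearZ_of hlin).
  rewrite /complexify hZ !psi_ext; [|by exists ('i *: (Y : mxmod E k))|by exists Y].
  rewrite !phiE; have -> : G ('i *: (Y : mxmod E k)) = 'i * G Y.
    rewrite -['i *: _]addr0 Glin (_ : G 0 = 0) ?addr0// /G big1// => i _.
    by rewrite big1// => j _; rewrite mxE linear0_of// mxE.
  exact: ReB_i.
exists (choi_map (complexify psi)).
have ext x : choi_map (complexify psi) (h x) = g x.
  apply/matrixP => i j; rewrite mxE.
  have -> : mx_elem i j (h x) = map_mx h (mx_elem i j x).
    by apply/matrixP => a b; rewrite !mxE (linearZ_of hlin).
  rewrite w_ext /G.
  transitivity (\sum_a (i == a)%:R * \sum_b (j == b)%:R * g x a b).
    apply: eq_bigr => a _; rewrite mulr_sumr; apply: eq_bigr => b _.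
    by rewrite mxE (linearZ_of glin) mxE mulrA.
  by rewrite sum_delta sum_delta.
split=> //; split.
- exact: choi_map_linear.
- by rewrite -h1 ext g1.
- move=> n X /mos_coneE/(choi_map_cp w_lin w_pos) h'; rewrite /= psd_flatE.
  by apply: eq_fpsd h' => p q; rewrite map_mx_entry.
Qed.

(* The Choi map of a state is completely positive but not unital; adding d times
   its trace makes the image of 1 invertible, so that it can be normalized. *)
Section Normalization.
Variables (S : opsys R) (n : nat) (w : mxmod S n -> C).
Hypothesis w_linear : forall a x y, w (a *: x + y) = a * w x + w y.
Hypothesis w_pos : forall X, mos_cone (X : 'M[S]_n) -> 0 <= w X.
Hypothesis w_one : w (mxunitr S n 1) = 1.
Variable d : R.
Hypothesis d0 : 0 < d.

Let g (s : S) : 'M[C]_n := choi_map w s + (rC d * \tr (choi_map w s))%:M.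

Lemma perturbed_choi_linear : linear g.
Proof.
move=> a s t; rewrite /g (choi_map_linear w_linear) linearP /= scalerDr mulrDr.
have E (x y : C) : (a * x + y)%:M = a *: x%:M + y%:M :> 'M_n.
  by apply/matrixP => i j; rewrite !mxE mulrnDl mulrnAr.
by rewrite [rC d * (a * _)]mulrCA E addrACA.
Qed.

Lemma perturbed_choi_cp (I : finType) (x : I -> I -> S) : fcone x ->
  fpsd (fun p q : I * 'I_n => g (x p.1 q.1) p.2 q.2).
Proof.
move=> cx; have cw := choi_map_cp w_linear w_pos cx.
have ct : fpsd (fun i j => \tr (choi_map w (x i j))).
  exact: (fpsd_sum (index_enum 'I_n) (fun m => fpsd_reindex (fun i => (i, m)) cw)).
have d1 : 0 <= rC d by rewrite lecR ltW.
apply: eq_fpsd (fpsdD cw (fpsd_tensor (fpsdZ d1 ct) (@fpsd_id R 'I_n))) => p q.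
by rewrite [g _]/g [in RHS]mxE [_%:M _ _]mxE mulr_natr.
Qed.

(** The trace of [choi_map w] at 1 is w(I_n (x) 1) = 1, hence g(1) >= d I_n, and a vector killed by
    a factor b of g(1) must be 0. *)
Lemma perturbed_choi_one : exists2 b : 'M[C]_n, b \in unitmx & g (mos_one S) = b *m b ^t*.
Proof.
have pg : fpsd (fun i j => g (mos_one S) i j).
  have := perturbed_choi_cp (pos_elt_one S).
  by move/(fpsd_reindex (fun i => (tt, i))).
have pw : fpsd (fun i j => choi_map w (mos_one S) i j).
  have := choi_map_cp w_linear w_pos (pos_elt_one S).
  by move/(fpsd_reindex (fun i => (tt, i))).
have tr1 : \tr (choi_map w (mos_one S)) = 1.
  rewrite -w_one choi_map_trace//; apply: eq_bigr => i _.
  under eq_bigr => j _ do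
    rewrite mxunitrE mul1r (linearZ_of (choi_map_linear w_linear)) mxE.
  by rewrite sum_delta.
have [B gB] := fpsd_factor pg; pose b : 'M[C]_n := \matrix_(i, j) B i j.
have gb : g (mos_one S) = b *m b ^t*.
  by apply/matrixP => i j; rewrite gB mxE; apply: eq_bigr => k _; rewrite !mxE.
exists b => //; rewrite -row_free_unit -kermx_eq0; apply/rowV0P => u /sub_kermxP ub.
have u0 : sform (fun i j => g (mos_one S) i j) (u 0) (u 0) = 0.
  transitivity ((u *m g (mos_one S) *m u ^t*) 0 0).
    rewrite mxE /sform exchange_big; apply: eq_bigr => j _.
    by rewrite !mxE mulr_suml.
  by rewrite gb mulmxA ub !mul0mx mxE.
have s0 : sform (fun i j => (i == j)%:R) (u 0) (u 0) = 0.
  apply/eqP; rewrite eq_le (fpsd_id (u 0)) andbT.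
  suff : rC d * sform (fun i j => (i == j)%:R) (u 0) (u 0) <= 0.
    by rewrite pmulr_rle0 // ltcR.
  rewrite -u0 -sformZ -[leLHS]add0r.
  apply: (le_trans (lerD (pw (u 0)) (lexx _))); rewrite -sformD.
  rewrite le_eqVlt; apply/orP; left; apply/eqP.
  apply: eq_bigr => i _; apply: eq_bigr => j _.
  by rewrite [g _]/g tr1 mulr1 [in RHS]mxE [_%:M _ _]mxE mulr_natr.
apply/rowP => i; rewrite mxE; apply/eqP.
move/eqP: s0; rewrite sform_id psumr_eq0; last by move=> j _; exact: mul_conjC_ge0.
by move=> /allP/(_ i (mem_index_enum _)); rewrite /= mul_conjC_eq0.
Qed.

(** With g(1) = b b^*, conjugating g by the inverse of b gives a unital map; the entries of b, read
    as a vector, undo the conjugation and return w up to the trace term. *)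
Lemma ucp_of_functional : exists (f : S -> 'M[C]_n) (v : 'I_n * 'I_n -> C),
  @ucp R S (mx_mos R n) f /\
  forall X : 'M[S]_n, sform (fun p q : 'I_n * 'I_n => f (X p.1 q.1) p.2 q.2) v v =
    w X + rC d * \sum_i \tr (choi_map w (X i i)).
Proof.
have [b ub gb] := perturbed_choi_one; pose a := invmx b.
pose f s := a *m g s *m a ^t*.
have fE s i j : f s i j = \sum_k \sum_l a i k * cj (a j l) * g s k l.
  rewrite mxE exchange_big; apply: eq_bigr => l _ /=.
  by rewrite !mxE mulr_suml; apply: eq_bigr => k _; ring.
have ab : a *m b = 1%:M by exact: mulVmx.
have ba : b *m a = 1%:M by exact: mulmxV.
exists f, (fun p => b p.1 p.2); split; first split.
- move=> c s t; rewrite /f perturbed_choi_linear mulmxDr mulmxDl.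
  by rewrite -scalemxAr -scalemxAl.
- by rewrite /f gb !mulmxA ab mul1mx -map_mxM -trmx_mul ab trmx1 map_mx1.
- move=> m X /mos_coneE/perturbed_choi_cp/(fpsd_local (fun i j => a i j)) h.
  by rewrite /= psd_flatE; apply: eq_fpsd h => p q; rewrite mxE fE.
move=> X; rewrite /sform sum_pair /=.
transitivity (\sum_i \sum_j (b *m f (X i j) *m b ^t*) i j).
  apply: eq_bigr => i _.
  under eq_bigr do rewrite sum_pair /=.
  rewrite exchange_big; apply: eq_bigr => j _ /=.
  rewrite mxE exchange_big; apply: eq_bigr => l _ /=.
  by rewrite !mxE mulr_suml.
have E i j : b *m f (X i j) *m b ^t* = g (X i j).
  rewrite /f !mulmxA ba mul1mx -mulmxA -map_mxM -trmx_mul ba.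
  by rewrite trmx1 map_mx1 mulmx1.
rewrite (eq_bigr (fun i => \sum_j g (X i j) i j)) => [|i _]; last first.
  by apply: eq_bigr => j _; rewrite E.
rewrite choi_map_trace// mulr_sumr -big_split; apply: eq_bigr => i _ /=.
under eq_bigr => j _ do rewrite mxE [_%:M _ _]mxE -mulr_natl.
by rewrite big_split /= sum_delta.
Qed.

End Normalization.

(** Hahn-Banach: a self-adjoint X outside the cone is strictly negative under a positive normalized
    functional, and [ucp_of_functional] replaces that functional by ucp maps up to an arbitrarily
    small error. *)
Lemma ucp_separation (S : opsys R) n (X : 'M[S]_n) :
    (forall k (f : S -> 'M[C]_k), @ucp R S (mx_mos R k) f ->
      fpsd (fun p q : 'I_n * 'I_k => f (X p.1 q.1) p.2 q.2)) ->
  mos_cone X.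
Proof.
wlog sX : X / mxstar X = X => [IH h|h].
  (* Every ucp map sends X to a hermitian matrix and so kills Z, a multiple of X minus its adjoint.
     By the self-adjoint case Z and - Z are positive, whence Z = 0. *)
  pose Z : 'M[S]_n := \matrix_(i, j) ('i *: (X i j - mos_star (X j i))).
  have sZ : mxstar Z = Z.
    apply/matrixP => i j; rewrite !mxE mos_starZ mos_starB mos_starK conjCi.
    by rewrite -opprB scalerN scaleNr opprK.
  have fZ k (f : S -> 'M[C]_k) : @ucp R S (mx_mos R k) f -> forall i j, f (Z i j) = 0.
    move=> fu i j; have [fl _ _] := fu; apply/matrixP => a b.
    have gs := ucp_star fu (opsysP S) (mx_mos_opsys R k).
    rewrite mxE (linearZ_of fl) (linearD_of fl) -scaleN1r (linearZ_of fl) gs !mxE.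
    have /= := fpsd_herm (i, a) (j, b) (h _ _ fu) => ->.
    by rewrite conjCK mulN1r subrr mulr0.
  have Z0 : Z = 0.
    apply: (opsys_proper (opsysP S)); apply: IH.
    - exact: sZ.
    - move=> k f fu v; rewrite /sform big1// => p _; rewrite big1// => q _.
      by rewrite fZ// mxE mulr0 mul0r.
    - by rewrite mxstarN sZ.
    - move=> k f fu v; have [fl _ _] := fu.
      rewrite /sform big1// => p _; rewrite big1// => q _.
      by rewrite mxE -scaleN1r (linearZ_of fl) fZ// scaler0 mxE mulr0 mul0r.
  apply: IH => //; apply/matrixP => i j.
  move/matrixP: Z0 => /(_ i j); rewrite !mxE => /eqP.
  by rewrite scaler_eq0 (negbTE (neq0Ci _)) /= subr_eq0 => /eqP <-.
apply: contrapT => nX.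
have [d d0 nXd] : exists2 d, 0 < d & ~ mos_cone (mxunitr S n d + X).
  apply: contrapT => h'; apply: nX; apply: (opsys_arch (opsysP S)) => r r0.
  by apply: contrapT => nXr; apply: h'; exists r.
pose U : mxmod S n := mxunitr S n 1.
set Y : 'M[S]_n := mxunitr S n d + X in nXd.
have sY : mxstar Y = Y by rewrite mxstarD mxunitr_star sX.
have U0 : U != 0.
  apply/eqP => U0; apply: nX; have [r r0] := opsys_unit (opsysP S) sX.
  by rewrite -[r]mulr1 mxunitrZ -/U U0 scaler0 add0r.
pose phi (Z : mxmod S n) := xget 0 [set r | Z = rC r *: U].
have phiE r : phi (rC r *: U) = r.
  rewrite /phi; case: xgetP => [t _ /eqP|/(_ r)]; last by case.
  rewrite -subr_eq0 -scalerBl scaler_eq0 (negbTE U0) orbF subr_eq0 => /eqP.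
  by move=> /complexI.
(* The positive cone enlarged by the ray of - Y: a functional that is positive on K and 1 at U has
   psi Y <= 0, that is psi X <= - d. *)
pose K : set (mxmod S n) := [set Z | exists2 t, 0 <= t &
  mos_cone (((Z : 'M[S]_n) + mxstar Z) + (rC t *: (Y : mxmod S n) : mxmod S n))].
have [|||||||psi [psi_lin psi_pos psi_ext]] := @positive_extension R (mxmod S n) K
    U [set Z | exists r, Z = rC r *: U] phi.
- move=> Z1 Z2 [t1 t10 c1] [t2 t20 c2]; exists (t1 + t2); first exact: addr_ge0.
  have := opsys_add (opsysP S) c1 c2; congr (mos_cone _).
  by rewrite addrACA mxmodDl -rCD mxstarD addrACA.
- move=> r Z r0 [t t0 c]; exists (r * t); first exact: mulr_ge0.
  have := mos_coneZ r0 c; congr (mos_cone _).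
  rewrite mxstarZ cj_real rCM -scalerA.
  by apply/matrixP => i j; rewrite !mxE !scalerDr.
- move=> Z; have [|r r0 hr] := @opsys_unit _ _ (opsysP S) n ((Z : 'M[S]_n) + mxstar Z).
    by rewrite mxstarD mxstarK addrC.
  exists (r / 2), 0 => //; rewrite scale0r addr0 mxstarD mxstarZ mxunitr_star cj_real addrACA.
  rewrite mxmodDl -rCD -splitr -mxunitrZ mulr1.
  exact: hr.
- by exists 1; rewrite scale1r.
- by move=> r _ _ [a ->] [b ->]; exists (r * a + b); rewrite rCD rCM scalerDl scalerA.
- move=> r _ _ [a ->] [b ->]; rewrite scalerA -scalerDl -rCM -rCD !phiE.
  by [].
- move=> _ [r ->] [t t0]; rewrite phiE mxstarZ cj_real mxunitr_star mxmodDl => c.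
  (* If r < 0, adding - 2 r U leaves t Y >= 0, against [nXd] when t > 0; when t = 0 the membership
     says - U >= 0, which forces U = 0. *)
  rewrite leNgt; apply/negP => r0.
  have [t1|t1] := ltP 0 t.
    apply: nXd; have t2 : 0 <= t^-1 by rewrite invr_ge0 ltW.
    have r1 : 0 <= - (r + r) by lra.
    have c1 := opsys_add (opsysP S) (mxunitr_pos S n r1) c.
    have := mos_coneZ t2 c1; congr (mos_cone _).
    rewrite addrA -[- (r + r)]mulr1 mxunitrZ mxmodDl -!rCD.
    rewrite addNr scale0r add0r scalerA -rCM mulVf ?gt_eqF// scale1r.
    by [].
  have t2 : t = 0 by apply/eqP; rewrite eq_le t1 t0.
  have s0 : 0 <= (- (r + r))^-1 by rewrite invr_ge0; lra.
  move: (mos_coneZ s0 c); rewrite t2 scale0r addr0 scalerA -rCD -rCM invrN mulNr.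
  rewrite mulVf; last by apply/eqP; lra.
  rewrite rCN scaleN1r => /(opsys_proper (opsysP S) (mxunitr_pos S n ler01)) U1.
  by move: U0; rewrite /U U1 eqxx.
have psiZ r Z : psi (rC r *: Z) = r * psi Z.
  have psi0 : psi 0 = 0 by have := psi_lin (-1) 0 0; rewrite scaler0 addr0; lra.
  by rewrite -[_ *: _]addr0 psi_lin psi0 addr0.
have psiD Z1 Z2 : psi (Z1 + Z2) = psi Z1 + psi Z2.
  by rewrite -[Z1]scale1r psi_lin mul1r scale1r.
have psiU : psi U = 1.
  by rewrite psi_ext; [rewrite -[U]scale1r phiE|exists 1; rewrite scale1r].
have psi_pos' (Z : 'M[S]_n) : mos_cone (Z + mxstar Z) -> 0 <= psi Z.
  by move=> cZ; apply: psi_pos; exists 0 => //; rewrite scale0r addr0.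
have psiY : psi X <= - d.
  have : 0 <= psi (rC (-1) *: (Y : mxmod S n)).
    apply: psi_pos; exists 2 => //; rewrite mxstarZ cj_real sY !mxmodDl -!rCD.
    have -> : (-1 - 1 + 2 : R) = 0 by lra.
    by rewrite scale0r; exact: mos_cone0.
  have -> : Y = rC d *: U + (X : mxmod S n) by rewrite -mxunitrZ mulr1.
  by rewrite psiZ psi_lin psiU; lra.
have w_lin := complexify_linear psi_lin.
have w_pos := complexify_pos psi_lin psi_pos'.
have w_sa := complexify_sa psi_lin psi_pos'.
have w1 : complexify psi U = 1 by rewrite w_sa ?psiU// mxunitr_star.
pose z : C := \sum_i \tr (choi_map (complexify psi) (X i i)).
suff : 0 <= psi X by apply/negP; rewrite -ltNge (le_lt_trans psiY)// oppr_lt0.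
apply: (@ge0_of_perturbation _ (complex.Re z)) => e e0.
have [f [v [fu fv]]] := ucp_of_functional w_lin w_pos w1 e0.
have := h _ _ fu v; rewrite fv w_sa//.
by rewrite -/z; case: z => a b; simpc => /andP[_].
Qed.

End MatrixFunctionals.

(** * Tensor products and quotient maps *)

Section AlgebraicTensorProduct.
Local Open Scope ring_scope.
Local Open Scope classical_set_scope.
Variable K : fieldType.

Section Tens.
Variables V W : lmodType K.

Lemma qproj_rel (z : {freeg (V * W)%type / K}) : @tens_rel K V W z -> qproj (@tens_rel K V W) z = 0.
Proof.
move=> hz; have -> : 0 = qproj (@tens_rel K V W) 0.
  by have := qprojD (@tens_rel K V W) 0 0; rewrite addr0 -{1}[qproj _ 0]addr0 => /addrI.
by apply/qproj_eq; rewrite subr0; exact: lin_span_gen.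
Qed.

Lemma qprojB (x y : {freeg (V * W)%type / K}) :
  qproj (@tens_rel K V W) (x - y) = qproj (@tens_rel K V W) x - qproj (@tens_rel K V W) y.
Proof. by apply/esym/eqP; rewrite subr_eq -qprojD subrK. Qed.

Lemma tensDl (v1 v2 : V) (w : W) : tens (v1 + v2) w = tens v1 w + tens v2 w.
Proof.
apply/eqP; rewrite -subr_eq0 opprD addrA -!qprojB; apply/eqP/qproj_rel.
by constructor 1; exists v1, v2, w.
Qed.

Lemma tensDr (v : V) (w1 w2 : W) : tens v (w1 + w2) = tens v w1 + tens v w2.
Proof.
apply/eqP; rewrite -subr_eq0 opprD addrA -!qprojB; apply/eqP/qproj_rel.
by constructor 2; exists v, w1, w2.
Qed.

Lemma qproj_coef a (v : V) (w : W) :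
  qproj (@tens_rel K V W) << a *g (v, w) >> = a *: tens v w.
Proof.
rewrite -[a *: _]addr0 -[RHS]/(a *: qproj (@tens_rel K V W) << (v, w) >> + 0) addr0.
have -> : << a *g (v, w) >> = a *: << (v, w) >> :> {freeg (V * W)%type / K}.
  by apply/eqP/freeg_eqP => p; rewrite coeffZ !coeffU mul1r.
exact: qprojZ.
Qed.

Lemma tensZl a (v : V) (w : W) : tens (a *: v) w = a *: tens v w.
Proof.
rewrite -qproj_coef; apply/eqP; rewrite -subr_eq0 -qprojB; apply/eqP/qproj_rel.
by constructor 3; exists a, v, w.
Qed.

Lemma tensZr a (v : V) (w : W) : tens v (a *: w) = a *: tens v w.
Proof.
rewrite -qproj_coef; apply/eqP; rewrite -subr_eq0 -qprojB; apply/eqP/qproj_rel.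
by constructor 4; exists a, v, w.
Qed.

Lemma tens_linearl (w : W) : linear (fun v : V => tens v w).
Proof. by move=> a x y; rewrite tensDl tensZl. Qed.

Lemma tens_linearr (v : V) : linear (fun w : W => tens v w).
Proof. by move=> a x y; rewrite tensDr tensZr. Qed.

Lemma tens_sum (z : tprod V W) : exists s : seq (V * W), z = \sum_(p <- s) tens p.1 p.2.
Proof.
have q0 : qproj (@tens_rel K V W) 0 = 0.
  by rewrite -[0 in LHS](subrr 0) qprojB subrr.
exists [seq (coeff p (repr z) *: p.1, p.2) | p <- dom (repr z)].
rewrite big_map -[LHS](qproj_repr z) -[in LHS](freeg_sumE (repr z)).
rewrite (big_morph _ (@qprojD _ _ _) q0); apply: eq_bigr => -[v w] _ /=.
by rewrite qproj_coef tensZl.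
Qed.

End Tens.
End AlgebraicTensorProduct.

Section OperatorSystemTensors.
Local Open Scope ring_scope.
Local Open Scope classical_set_scope.
Variable R : realType.
Local Notation C := R[i].
Local Notation cj := Num.conj.
Local Notation rC r := ((r%:C)%C : C).

Lemma mxD_entry (S : mospace R) n (X Y : 'M[S]_n) i j : (X + Y) i j = X i j + Y i j.
Proof. by rewrite mxE. Qed.

Lemma mxunitrD (S : mospace R) n a b : mxunitr S n (a + b) = mxunitr S n a + mxunitr S n b.
Proof.
by apply/matrixP => i j; rewrite mxD_entry !mxunitrE rCD mulrDl scalerDl.
Qed.

(* The algebraic tensor product with the cones of min_mos. Keeping the carrier
   abstract spares unification the quotient construction of tprod. *)
Record tensor_model (S T : mospace R) := TensorModel {
  tm_mos :> mospace R;
  tm_tens : S -> T -> tm_mos;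
  tm_map : forall k l, (S -> 'M[C]_k) -> (T -> 'M[C]_l) -> tm_mos -> 'M[C]_(k * l);
  tm_linearl : forall t, linear (tm_tens^~ t);
  tm_linearr : forall s, linear (tm_tens s);
  tm_one : tm_tens (mos_one S) (mos_one T) = mos_one tm_mos;
  tm_sum : forall z, exists s : seq (S * T), z = \sum_(p <- s) tm_tens p.1 p.2;
  tm_univ : forall (X : lmodType C) (b : S -> T -> X),
    (forall t, linear (b^~ t)) -> (forall s, linear (b s)) ->
    exists h : tm_mos -> X, linear h /\ forall s t, h (tm_tens s t) = b s t;
  tm_map_linear : forall k l (f : S -> 'M[C]_k) (g : T -> 'M[C]_l),
    linear f -> linear g -> linear (tm_map f g);
  tm_mapE : forall k l (f : S -> 'M[C]_k) (g : T -> 'M[C]_l),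
    linear f -> linear g -> forall s t, tm_map f g (tm_tens s t) = f s *t g t;
  tm_coneP : forall n (X : 'M[tm_mos]_n), mos_cone X <->
    forall (k l : nat) (f : S -> 'M[C]_k) (g : T -> 'M[C]_l),
    @ucp R S (mx_mos R k) f -> @ucp R T (mx_mos R l) g ->
    fpsd (fun p q : 'I_n * 'I_(k * l) => tm_map f g (X p.1 q.1) p.2 q.2) }.

Section MinModel.
Variables S T : mospace R.

Section TensorMaps.
Variables (k l : nat) (f : S -> 'M[C]_k) (g : T -> 'M[C]_l).
Hypotheses (fl : linear f) (gl : linear g).

Let bl (t : T) : linear (fun s : S => f s *t g t : 'M[C]_(k * l)).
Proof.
move=> a x y; apply/matrixP => i j; rewrite !mxE fl !mxE mulrDl.
by rewrite mulrA.
Qed.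

Let br (s : S) : linear (fun t : T => f s *t g t : 'M[C]_(k * l)).
Proof.
move=> a x y; apply/matrixP => i j; rewrite !mxE gl !mxE mulrDr.
by rewrite mulrCA.
Qed.

Definition min_map (z : min_mos S T) : 'M[C]_(k * l) := tlift (fun s t => f s *t g t) z.

Lemma min_mapE s t : min_map (tens s t) = f s *t g t.
Proof. exact: (tlift_tens bl br). Qed.

Lemma min_map_linear : linear min_map.
Proof. exact: (tlift_linear bl br). Qed.

End TensorMaps.

Definition min_tens (s : S) (t : T) : min_mos S T := tens s t.

Lemma min_tens_linearl t : linear (min_tens^~ t).
Proof. exact: tens_linearl. Qed.

Lemma min_tens_linearr s : linear (min_tens s).
Proof. exact: tens_linearr. Qed.

Lemma min_mos_coneP n (X : 'M[min_mos S T]_n) :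
  mos_cone X <-> forall (k l : nat) (f : S -> 'M[C]_k) (g : T -> 'M[C]_l),
    @ucp R S (mx_mos R k) f -> @ucp R T (mx_mos R l) g ->
    fpsd (fun p q : 'I_n * 'I_(k * l) => min_map f g (X p.1 q.1) p.2 q.2).
Proof.
have E k l f g (Y : 'M[min_mos S T]_n) : psd (mxflat (map_mx (@min_map k l f g) Y)) <->
    fpsd (fun p q : 'I_n * 'I_(k * l) => min_map f g (Y p.1 q.1) p.2 q.2).
  by rewrite psd_flatE; split; apply: eq_fpsd => p q; rewrite map_mx_entry.
by split=> h k l f g fu gu; apply/E; exact: h.
Qed.

Lemma min_mos_one : min_tens (mos_one S) (mos_one T) = mos_one (min_mos S T).
Proof. by []. Qed.

Lemma min_mos_sum (z : min_mos S T) :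
  exists s : seq (S * T), z = \sum_(p <- s) min_tens p.1 p.2.
Proof. exact: tens_sum. Qed.

Lemma min_mos_univ (X : lmodType C) (b : S -> T -> X) :
    (forall t, linear (b^~ t)) -> (forall s, linear (b s)) ->
  exists h : min_mos S T -> X, linear h /\ forall s t, h (min_tens s t) = b s t.
Proof.
move=> bl br; exists (tlift b); split; first exact: tlift_linear.
exact: tlift_tens.
Qed.

Definition min_model : tensor_model S T :=
  TensorModel min_tens_linearl min_tens_linearr min_mos_one min_mos_sum
    min_mos_univ min_map_linear min_mapE min_mos_coneP.

End MinModel.

Section IdTens.
Variables (S T1 T2 : mospace R) (f : T1 -> T2).
Hypothesis fl : linear f.

Let bl (t : T1) : linear (fun s : S => tens s (f t)).
Proof. exact: tens_linearl. Qed.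

Let br (s : S) : linear (fun t : T1 => tens s (f t)).
Proof. by move=> a x y; rewrite fl tens_linearr. Qed.

Lemma id_tensE s t :
  @id_tens R S T1 T2 f (tm_tens (min_model S T1) s t) = tm_tens (min_model S T2) s (f t).
Proof. exact: (tlift_tens bl br). Qed.

Lemma id_tens_linear : linear (@id_tens R S T1 T2 f).
Proof. exact: (tlift_linear bl br). Qed.

End IdTens.

(** * The form defining the maximal cone, and the passage along maps *)

Section Models.
Variables (S T : mospace R) (M : tensor_model S T).
Local Notation te := (tm_tens M).

Lemma tm_ext (X : lmodType C) (f g : M -> X) : linear f -> linear g ->
  (forall s t, f (te s t) = g (te s t)) -> forall z, f z = g z.
Proof.
move=> fl gl fg z; have [s ->] := tm_sum z.
rewrite (linear_sum_of fl) (linear_sum_of gl).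
by apply: eq_bigr => p _; exact: fg.
Qed.

Definition tm_tensmat k l (P : 'M[S]_k) (Q : 'M[T]_l) : 'M[M]_(k * l) :=
  \matrix_(p, q) te (P (mxtens_unindex p).1 (mxtens_unindex q).1)
                    (Q (mxtens_unindex p).2 (mxtens_unindex q).2).

Lemma tm_tensmatE k l (P : 'M[S]_k) (Q : 'M[T]_l) i j :
  tm_tensmat P Q i j = te (P (mxtens_unindex i).1 (mxtens_unindex j).1)
                          (Q (mxtens_unindex i).2 (mxtens_unindex j).2).
Proof. by rewrite mxE. Qed.

(** The maximal cone asks for this form only after adding each positive multiple of the unit. *)
Definition max_form n (X : 'M[M]_n) :=
  exists (k l : nat) (P : 'M[S]_k) (Q : 'M[T]_l) (a : 'M[C]_(n, k * l)),
    [/\ mos_cone P, mos_cone Q & X = mxcompress a (tm_tensmat P Q)].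

Lemma mxcompressE n m (a : 'M[C]_(n, m)) (X : 'M[M]_m) i j :
  mxcompress a X i j = \sum_p (a i p.1 * cj (a j p.2)) *: X p.1 p.2.
Proof. by rewrite [LHS]mxE pair_bigA. Qed.

(** Under f (x) g, the matrix P (x) Q becomes, up to reindexing, a Kronecker product of positive
    matrices. *)
Lemma max_form_min n (X : 'M[M]_n) : max_form X -> mos_cone X.
Proof.
move=> [k [l [P [Q [a [cP cQ ->]]]]]]; apply/tm_coneP => k' l' f g fu gu.
have [fl _ fp] := fu; have [gl _ gp] := gu.
have pF : fpsd (fun p q : 'I_k * 'I_k' => f (P p.1 q.1) p.2 q.2).
  have := fp _ _ cP; rewrite /= psd_flatE.
  by apply: eq_fpsd => p q; rewrite map_mx_entry.
have pG : fpsd (fun p q : 'I_l * 'I_l' => g (Q p.1 q.1) p.2 q.2).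
  have := gp _ _ cQ; rewrite /= psd_flatE.
  by apply: eq_fpsd => p q; rewrite map_mx_entry.
pose h (r : 'I_(k * l) * 'I_(k' * l')) :=
  (((mxtens_unindex r.1).1, (mxtens_unindex r.2).1),
   ((mxtens_unindex r.1).2, (mxtens_unindex r.2).2)).
have := fpsd_local1 (fun i j => a i j) (fpsd_reindex h (fpsd_tensor pF pG)).
apply: eq_fpsd => p q; rewrite mxcompressE.
rewrite pair_bigA (linear_sumZ (tm_map_linear fl gl)) summxE.
by apply: eq_bigr => r _; rewrite tm_tensmatE [in RHS]mxE tm_mapE// [in RHS]mxE.
Qed.

Lemma min_coneD n (X Y : 'M[M]_n) : mos_cone X -> mos_cone Y -> mos_cone (X + Y).
Proof.
move=> /tm_coneP cX /tm_coneP cY; apply/tm_coneP => k l f g fu gu.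
have [fl _ _] := fu; have [gl _ _] := gu.
apply: eq_fpsd (fpsdD (cX _ _ _ _ fu gu) (cY _ _ _ _ fu gu)) => p q.
by rewrite mxD_entry (linearD_of (tm_map_linear fl gl)) [in RHS]mxE.
Qed.

Lemma min_cone_arch n (X : 'M[M]_n) :
  (forall e : R, 0 < e -> mos_cone (X + mxunitr M n e)) -> mos_cone X.
Proof.
move=> h; apply/tm_coneP => k l f g fu gu; apply: fpsd_arch => r r0.
have [fl f1 _] := fu; have [gl g1 _] := gu.
have /tm_coneP/(_ _ _ _ _ fu gu) := h r r0; apply: eq_fpsd => p q.
have ml := @tm_map_linear _ _ M _ _ _ _ fl gl.
rewrite addrC mxunitrDE (linearD_of ml) (linearZ_of ml) -tm_one tm_mapE// f1 g1.
rewrite [in LHS]mxE; congr (_ + _); rewrite [LHS]mxE -mulrA; congr (_ * _).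
rewrite !mxE -!natrM !mulnb -xpair_eqE -!surjective_pairing.
by rewrite (can_eq (@mxtens_unindexK _ _)) -xpair_eqE -!surjective_pairing.
Qed.

Lemma tens_unit_min n (Y : 'M[S]_n) : mos_cone Y ->
  mos_cone (map_mx (fun s => te s (mos_one T)) Y).
Proof.
move=> cY; apply/tm_coneP => k l f g fu gu.
have [fl f1 fp] := fu; have [gl g1 _] := gu.
have pF : fpsd (fun p q : 'I_n * 'I_k => f (Y p.1 q.1) p.2 q.2).
  have := fp _ _ cY; rewrite /= psd_flatE.
  by apply: eq_fpsd => p q; rewrite map_mx_entry.
pose h (r : 'I_n * 'I_(k * l)) := ((r.1, (mxtens_unindex r.2).1), (mxtens_unindex r.2).2).
apply: eq_fpsd (fpsd_reindex h (fpsd_tensor pF (@fpsd_id R 'I_l))) => p q.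
by rewrite map_mx_entry tm_mapE// g1 [in RHS]mxE [in RHS]mxE.
Qed.

(** Lifting Q along a quotient map costs an extra d 1. Its effect lies in M_n(S) (x) 1, where the
    unit of M_n(S) can dominate it. *)
Lemma mxcompress_tensmat_unit n k l (a : 'M[C]_(n, k * l))
    (P : 'M[S]_k) (Q : 'M[T]_l) (d : R) i j :
  mxcompress a (tm_tensmat P (Q + mxunitr T l d)) i j =
  mxcompress a (tm_tensmat P Q) i j +
  te (rC d *: \sum_r \sum_s (a i r * cj (a j s)) *:
    (((mxtens_unindex r).2 == (mxtens_unindex s).2)%:R *:
     P (mxtens_unindex r).1 (mxtens_unindex s).1)) (mos_one T).
Proof.
have ll := tm_linearl M (mos_one T).
rewrite !mxcompressE (linearZ_of ll) pair_bigA.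
rewrite (linear_sumZ ll) scaler_sumr -big_split.
apply: eq_bigr => p _; rewrite !tm_tensmatE [Q + _]addrC mxunitrDE /=.
rewrite (linearD_of (tm_linearr M _)) scalerDr addrC; congr (_ + _).
rewrite (linearZ_of (tm_linearr M _)) (linearZ_of ll) !scalerA; congr (_ *: _); ring.
Qed.

End Models.

Lemma ucp_comp (S T1 T2 : mospace R) (f : S -> T1) (g : T1 -> T2) :
  ucp f -> ucp g -> ucp (g \o f).
Proof.
move=> [fl f1 fp] [gl g1 gp]; split; first by move=> a x y /=; rewrite fl gl.
  by rewrite /= f1 g1.
move=> n X /fp/gp; congr (mos_cone _).
by apply/matrixP => i j; rewrite !map_mx_entry.
Qed.

Section ModelMaps.
Variables (S T1 T2 : mospace R) (M1 : tensor_model S T1) (M2 : tensor_model S T2).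
Variables (f : T1 -> T2) (F : M1 -> M2).
Hypothesis F_linear : linear F.
Hypothesis FE : forall s t, F (tm_tens M1 s t) = tm_tens M2 s (f t).

Lemma tm_map_ucp : ucp f -> ucp F.
Proof.
move=> fu; have [fl f1 _] := fu; split; first exact: F_linear.
  by rewrite -!tm_one FE f1.
move=> n X /tm_coneP cX; apply/tm_coneP => k l g h gu hu.
have [gl _ _] := gu; have [hl _ _] := hu.
have [hfl _ _] := ucp_comp fu hu.
apply: eq_fpsd (cX _ _ _ _ gu (ucp_comp fu hu)) => p q; rewrite map_mx_entry.
congr (fun_of_matrix _ _ _); apply/esym.
have ml := @tm_map_linear _ _ M2 _ _ _ _ gl hl.
apply: (@tm_ext _ _ M1 _ (fun z => tm_map g h (F z)) (tm_map g (h \o f))).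
- by move=> a x y; rewrite F_linear ml.
- exact: tm_map_linear.
- by move=> s t; rewrite FE !tm_mapE.
Qed.

Lemma tm_map_mxcompress n k l (a : 'M[C]_(n, k * l)) (P : 'M[S]_k) (Q : 'M[T1]_l) :
  map_mx F (mxcompress a (tm_tensmat M1 P Q)) =
  mxcompress a (tm_tensmat M2 P (map_mx f Q)).
Proof.
apply/matrixP => i j; rewrite map_mx_entry !mxcompressE (linear_sumZ F_linear).
by apply: eq_bigr => p _; rewrite !tm_tensmatE FE map_mx_entry.
Qed.

Lemma tm_map_max_form n (X : 'M[M1]_n) : ucp f -> max_form X -> max_form (map_mx F X).
Proof.
move=> [_ _ fp] [k [l [P [Q [a [cP cQ ->]]]]]].
by exists k, l, P, (map_mx f Q), a; split=> //; [exact: fp | exact: tm_map_mxcompress].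
Qed.

End ModelMaps.

Section ProjectivityOfMax.
Variables (S : opsys R) (T1 : mospace R) (T2 : opsys R).
Variables (M1 : tensor_model S T1) (M2 : tensor_model S T2).
Variables (f : T1 -> T2) (F : M1 -> M2).
Hypothesis F_linear : linear F.
Hypothesis FE : forall s t, F (tm_tens M1 s t) = tm_tens M2 s (f t).
Hypothesis min_max : forall n (X : 'M[M2]_n), mos_cone X ->
  forall e, 0 < e -> max_form (X + mxunitr M2 n e).

(** In Q + e/2 = a (P (x) Q') a^*, lift Q' + d to a positive P' and keep P. The surplus d D (x) 1 is
    at most e/2 for small d, and adding the positive Y = e/2 - d D makes the total exactly Q + e. *)
Lemma tm_quotient : complete_order_quotient f -> complete_order_quotient F.
Proof.
move=> [fu fsurj flift]; have [fl f1 fp] := fu.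
split; first exact: (tm_map_ucp F_linear FE).
  move=> z; have [s ->] := tm_sum z.
  have [g gK] := choice fsurj.
  exists (\sum_(p <- s) tm_tens M1 p.1 (g p.2)); rewrite (linear_sum_of F_linear).
  by apply: eq_bigr => p _; rewrite FE gK.
move=> n Q e cQ e0.
have e2 : 0 < e / 2 by rewrite divr_gt0.
have [k [l [P [Q' [a [cP cQ' QE]]]]]] := min_max cQ e2.
pose D (i j : 'I_n) : S := \sum_r \sum_s (a i r * cj (a j s)) *:
  (((mxtens_unindex r).2 == (mxtens_unindex s).2)%:R *:
   P (mxtens_unindex r).1 (mxtens_unindex s).1).
have cD : fcone D.
  move/mos_coneE: cP => cP.
  have := fcone_tensor (@fpsd_id R 'I_l) cP.
  move/(fcone_reindex (fun r : 'I_(k * l) => ((mxtens_unindex r).2, (mxtens_unindex r).1))).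
  by move/(fcone_compress (fun i j => a i j)); apply: eq_fcone.
have [|r r0 hr] := @fcone_order_unit R S _ (fun i j => - D i j).
  by move=> i j; rewrite mos_starN (fcone_star i j cD).
(* Since D <= r 1, this gives d D <= e/2. *)
pose d := e / 2 / r.
have d0 : 0 < d by rewrite divr_gt0.
have dr : d * r = e / 2 by rewrite mulfVK ?gt_eqF.
have [P' [cP' P'E]] := flift _ _ _ cQ' d0.
pose Y : 'M[S]_n := \matrix_(i, j) ((rC (e / 2) * (i == j)%:R) *: mos_one S - rC d *: D i j).
have cY : mos_cone Y.
  apply/mos_coneE; apply: eq_fcone (fconeZ (ltW d0) hr) => i j.
  by rewrite mxE scalerDr scalerN scalerA mulrA -rCM dr.
exists (mxcompress a (tm_tensmat M1 P P') + map_mx (fun s => tm_tens M1 s (mos_one T1)) Y).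
split.
  apply: min_coneD; last exact: tens_unit_min.
  by apply: max_form_min; exists k, l, P, P', a.
have -> : Q + mxunitr M2 n e =
    mxcompress a (tm_tensmat M2 P Q') + mxunitr M2 n (e / 2).
  by rewrite -QE -addrA -mxunitrD -splitr.
apply/matrixP => i j; rewrite map_mx_entry mxD_entry (linearD_of F_linear).
rewrite -[F (mxcompress _ _ _ _)]map_mx_entry (tm_map_mxcompress F_linear FE) P'E mxcompress_tensmat_unit.
rewrite mxD_entry map_mx_entry FE f1 mxunitrE -tm_one -/(D i j).
have ll := tm_linearl M2 (mos_one T2).
rewrite -addrA -(linearD_of ll) -(linearZ_of ll); congr (_ + tm_tens M2 _ _).
by rewrite mxE addrC subrK.
Qed.

End ProjectivityOfMax.

Lemma nuclearP (S T : opsys R) : nuclear S -> forall n (X : 'M[min_model S T]_n),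
  mos_cone X -> forall e, 0 < e -> max_form (X + mxunitr (min_model S T) n e).
Proof.
move=> nS n X cX; have : @mos_cone R (max_mos S T) n X by rewrite -nS.
exact.
Qed.

(** Nuclearity enters at [T2], where positive elements get the maximal form; hence [T1] can be any
    [mospace], in particular the coproduct. *)
Lemma nuclear_quotient (S : opsys R) (T1 : mospace R) (T2 : opsys R) (f : T1 -> T2) :
  nuclear S -> complete_order_quotient f -> complete_order_quotient (@id_tens R S T1 T2 f).
Proof.
move=> nS fq; have [[fl _ _] _ _] := fq.
exact: (@tm_quotient S T1 T2 (min_model S T1) (min_model S T2) f (@id_tens R S T1 T2 f)
  (@id_tens_linear S T1 T2 f fl) (@id_tensE S T1 T2 f fl) (nuclearP nS) fq).
Qed.

Lemma nuclear_of_max_form (S : opsys R) :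
  (forall (T : opsys R) n (X : 'M[min_model S T]_n), mos_cone X ->
    forall e, 0 < e -> max_form (X + mxunitr (min_model S T) n e)) ->
  nuclear S.
Proof.
move=> h T n; apply/seteqP; split=> X; first by move=> cX e e0; exact: h.
move=> mX; apply: (@min_cone_arch S T (min_model S T)) => e e0.
by apply: max_form_min; exact: mX.
Qed.

End OperatorSystemTensors.

(** * Systems separated by maps into operator systems; Hadamard products *)

Section SeparatedSystems.
Local Open Scope ring_scope.
Local Open Scope classical_set_scope.
Variable R : realType.
Local Notation C := R[i].
Local Notation cj := Num.conj.

(** The maps embed S into the product of the [T i], where the axioms are read off coordinatewise.
    Only the order unit calls for a bound uniform in i, which is the last hypothesis. *)
Lemma opsys_separated (S : mospace R) (I : Type) (T : I -> opsys R)
    (h : forall i, S -> T i) :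
    (forall i, linear (h i)) ->
    (forall i, h i (mos_one S) = mos_one (T i)) ->
    (forall i x, h i (mos_star x) = mos_star (h i x)) ->
    (forall x y, (forall i, h i x = h i y) -> x = y) ->
    (forall n (X : 'M[S]_n), mos_cone X <-> forall i, mos_cone (map_mx (h i) X)) ->
    (forall n (X : 'M[S]_n), mxstar X = X ->
      exists2 r : R, 0 < r & forall i, mos_cone (mxunitr (T i) n r + map_mx (h i) X)) ->
  is_opsys S.
Proof.
move=> hl h1 hs hinj hc hu.
have hD i n (X Y : 'M[S]_n) : map_mx (h i) (X + Y) = map_mx (h i) X + map_mx (h i) Y.
  by apply/matrixP => p q; rewrite map_mx_entry !mxD_entry !map_mx_entry (linearD_of (hl i)).
have inj n (X Y : 'M[S]_n) : (forall i, map_mx (h i) X = map_mx (h i) Y) -> X = Y.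
  move=> XY; apply/matrixP => p q; apply: hinj => i.
  by have /matrixP/(_ p q) := XY i; rewrite !map_mx_entry.
split.
- move=> a x y; apply: hinj => i; rewrite (hl i) !hs hl.
  by rewrite mos_starD mos_starZ.
- by move=> x; apply: hinj => i; rewrite !hs mos_starK.
- move=> n X /hc cX; apply: inj => i; rewrite -[RHS](opsys_sa (opsysP (T i)) (cX i)).
  by apply/matrixP => p q; rewrite !mxE hs.
- move=> n X Y /hc cX /hc cY; apply/hc => i; rewrite hD.
  exact: opsys_add (opsysP (T i)) _ _ _ (cX i) (cY i).
- move=> n r X r0 /hc cX; apply/hc => i.
  have := opsys_scale (opsysP (T i)) r0 (cX i); congr (mos_cone _).
  by apply/matrixP => p q; rewrite !mxE (linearZ_of (hl i)).
- move=> n X /hc cX /hc cNX; apply: inj => i.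
  have -> : map_mx (h i) (0 : 'M[S]_n) = 0.
    by apply/matrixP => p q; rewrite !mxE (linear0_of (hl i)).
  apply: (opsys_proper (opsysP (T i))) (cX i) _.
  have := cNX i; congr (mos_cone _).
  by apply/matrixP => p q; rewrite !mxE -scaleN1r (linearZ_of (hl i)) scaleN1r.
- move=> n m a X /hc cX; apply/hc => i.
  have := mos_compress (cX i) a; congr (mos_cone _).
  apply/matrixP => p q; rewrite !mxE (linear_sum_of (hl i)); apply: eq_bigr => k _.
  rewrite (linear_sum_of (hl i)); apply: eq_bigr => l _.
  by rewrite mxE (linearZ_of (hl i)).
- by apply: hinj => i; rewrite hs h1 mos_star_one.
- move=> n X sX; have [r r0 hr] := hu n X sX; exists r => //; apply/hc => i.
  by rewrite hD map_mxunitr.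
- move=> n X hX; apply/hc => i; apply: (opsys_arch (opsysP (T i))) => r r0.
  by have /hc/(_ i) := hX r r0; rewrite hD map_mxunitr.
Qed.

Section Subsystems.
Variables (S : opsys R) (d : nat) (p : 'I_d -> S).
Hypothesis p_pos : forall j, pos_elt (p j).
Let U : set S := range p.
Hypothesis U_one : lin_span U (mos_one S).

Lemma span_star x : lin_span U x -> lin_span U (mos_star x).
Proof.
move=> [n [c [u [Uu ->]]]]; rewrite mos_star_sum.
exists n, (fun i => cj (c i)), u; split=> //; apply: eq_bigr => i _.
have [j _ <-] := Uu i; rewrite mos_starZ.
by rewrite (fcone_star tt tt (p_pos j)).
Qed.

Definition span_mos := sub_mos span_star U_one.

Definition span_val (x : span_mos) : S := val x.

Lemma span_mos_opsys : is_opsys span_mos.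
Proof.
apply: (@opsys_separated span_mos unit (fun=> S) (fun=> span_val)) => //.
- by move=> x y xy; apply: val_inj; exact: (xy tt).
- by move=> n X; split=> [cX _|/(_ tt)].
- move=> n X sX; have [|r r0 hr] := @opsys_unit _ _ (opsysP S) n (map_mx span_val X).
    by rewrite -[X in RHS]sX; apply/matrixP => i j; rewrite !mxE.
  by exists r.
Qed.

Definition span_opsys := Opsys span_mos_opsys.

Lemma span_val_embedding : @order_embedding R span_opsys S span_val.
Proof.
by split=> //; exact: val_inj.
Qed.

Definition span_gen (j : 'I_d) : span_opsys :=
  exist _ (p j) (introT (span_predP _ _) (lin_span_gen (imageT p j))).

Lemma span_gen_pos j : pos_elt (span_gen j).
Proof.
have [_ _] := span_val_embedding; apply; have := p_pos j.
by congr (mos_cone _); apply/matrixP => a b; rewrite !mxE.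
Qed.

Lemma span_gen_span (x : span_opsys) : exists c : 'I_d -> C, x = \sum_j c j *: span_gen j.
Proof.
have [n [c [u [Uu xE]]]] := elimT (span_predP _ _) (valP x).
have /choice[g gK] i : exists j, p j = u i by have [j _ <-] := Uu i; exists j.
exists (fun j => \sum_(i | g i == j) c i); apply: val_inj; rewrite xE.
have valE (s : seq 'I_d) (F : 'I_d -> span_opsys) :
    val (\sum_(j <- s) F j) = \sum_(j <- s) val (F j).
  by rewrite (big_morph val (id1 := 0) (op1 := +%R)).
rewrite valE (partition_big g xpredT)//=; apply: eq_bigr => j _.
rewrite scaler_suml; apply: eq_bigr => i /eqP <-.
by rewrite gK.
Qed.

End Subsystems.

Lemma fcone_separation (S : opsys R) (I : finType) (x : I -> I -> S) :
    (forall k (f : S -> 'M[C]_k), @ucp R S (mx_mos R k) f ->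
      fpsd (fun p q : I * 'I_k => f (x p.1 q.1) p.2 q.2)) ->
  fcone x.
Proof.
move=> h; apply: ucp_separation => k f fu.
apply: eq_fpsd (fpsd_reindex (fun p => (enum_val p.1, p.2)) (h k f fu)) => p q.
by rewrite mxE.
Qed.

Section HadamardForm.
Variables (S T : opsys R) (M : tensor_model S T) (n : nat).
Local Notation te := (tm_tens M).

(* Same as max_form, with the entrywise product of P and Q instead of P (x) Q. *)
Definition hadamard_form (x : 'I_n -> 'I_n -> M) :=
  exists (A : finType) (P : A -> A -> S) (Q : A -> A -> T) (a : 'I_n -> A -> C),
    [/\ fcone P, fcone Q &
     forall i j, x i j = \sum_s \sum_t (a i s * cj (a j t)) *: te (P s t) (Q s t)].

(** The entrywise product is the compression of P (x) Q to the diagonal index pairs (s, s). *)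
Lemma hadamard_max_form (X : 'M[M]_n) :
  hadamard_form (fun i j => X i j) -> max_form X.
Proof.
move=> [A [P [Q [a [cP cQ XE]]]]]; pose m := #|A|.
exists m, m, (\matrix_(p, q) P (enum_val p) (enum_val q)),
  (\matrix_(p, q) Q (enum_val p) (enum_val q)),
  (\matrix_(i, r) (((mxtens_unindex r).1 == (mxtens_unindex r).2)%:R
                     * a i (enum_val (mxtens_unindex r).1))); split=> //.
apply/matrixP => i j; rewrite mxcompressE XE sum_pair.
have R1 (V : nmodType) (F : 'I_(m * m) -> V) :
    \sum_r F r = \sum_p \sum_q F (mxtens_index (p, q)).
  rewrite pair_bigA (reindex (@mxtens_index m m))/=; last first.
    by exists (@mxtens_unindex m m) => r _; rewrite ?mxtens_indexK ?mxtens_unindexK.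
  by apply: eq_bigr => -[p q].
pose G (p p' q q' : 'I_m) := te (P (enum_val p) (enum_val q)) (Q (enum_val p') (enum_val q')).
transitivity (\sum_(p < m) \sum_(p' < m) \sum_(q < m) \sum_(q' < m) (p == p')%:R *: ((q == q')%:R *:
    ((a i (enum_val p) * cj (a j (enum_val q))) *: G p p' q q'))).
  rewrite reindex_enum; apply: eq_bigr => p _; rewrite [LHS]reindex_enum.
  under [RHS]eq_bigr => p' _.
    under eq_bigr => q _ do rewrite -scaler_sumr sum_deltaZ.
    rewrite -scaler_sumr; over.
  by rewrite sum_deltaZ.
rewrite R1; apply: eq_bigr => p _; apply: eq_bigr => p' _.
rewrite R1; apply: eq_bigr => q _; apply: eq_bigr => q' _.
have := mxtens_indexK (q, q'); have := mxtens_indexK (p, p').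
move: (mxtens_index (p, p')) (mxtens_index (q, q')) => r t rK tK.
rewrite -[(r, t).1]/r -[(r, t).2]/t tm_tensmatE.
rewrite [X in _ = (X * _) *: _]mxE [X in _ = (_ * cj X) *: _]mxE rK tK /=.
rewrite !scalerA /G; congr (_ *: te _ _); last 2 first.
- by rewrite mxE.
- by rewrite mxE.
by rewrite cjM rmorph_nat; ring.
Qed.

Lemma eq_hadamard_form x y : (forall i j, x i j = y i j) -> hadamard_form x -> hadamard_form y.
Proof.
by move=> xy [A [P [Q [a [cP cQ xE]]]]]; exists A, P, Q, a; split=> // i j; rewrite -xy.
Qed.

Lemma hadamard_form0 : hadamard_form (fun i j => 0).
Proof.
exists 'I_0, (fun _ _ => 0), (fun _ _ => 0), (fun _ _ => 0); split; [exact: fcone0..|].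
by move=> i j; rewrite big_ord0.
Qed.

Definition block (U : opsys R) (A B : finType) (x : A -> A -> U) (y : B -> B -> U)
    (s t : A + B) : U :=
  match s, t with inl a, inl b => x a b | inr a, inr b => y a b | _, _ => 0 end.

Lemma fcone_block (U : opsys R) (A B : finType) (x : A -> A -> U) (y : B -> B -> U) :
  fcone x -> fcone y -> fcone (block x y).
Proof.
move=> /(fcone_compress (fun (s : A + B) a => if s is inl b then (b == a)%:R else 0)) cx.
move=> /(fcone_compress (fun (s : A + B) a => if s is inr b then (b == a)%:R else 0)) cy.
have dd (K : finType) (z : K -> K -> U) a b :
    \sum_k \sum_l ((a == k)%:R * cj (b == l)%:R) *: z k l = z a b.
  under eq_bigr => k _.
    under eq_bigr => l _ do rewrite rmorph_nat -scalerA.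
    rewrite -scaler_sumr sum_deltaZ; over.
  by rewrite sum_deltaZ.
apply: eq_fcone (fconeD cx cy) => -[a|a] [b|b].
- by rewrite dd addrC big1 ?add0r// => k _; rewrite big1// => l _; rewrite mul0r scale0r.
- rewrite !big1 ?addr0// => k _; rewrite big1// => l _.
    by rewrite mul0r scale0r.
  by rewrite rmorph0 mulr0 scale0r.
- rewrite !big1 ?addr0// => k _; rewrite big1// => l _.
    by rewrite rmorph0 mulr0 scale0r.
  by rewrite mul0r scale0r.
- by rewrite dd big1 ?add0r// => k _; rewrite big1// => l _; rewrite mul0r scale0r.
Qed.

(** Direct sums of the P and of the Q: the mixed blocks contribute tensors with a zero factor. With
    P (x) Q in place of the entrywise product there would be cross terms such as P (x) Q'. *)
Lemma hadamard_formD x y : hadamard_form x -> hadamard_form y ->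
  hadamard_form (fun i j => x i j + y i j).
Proof.
move=> [A [P [Q [a [cP cQ xE]]]]] [A' [P' [Q' [a' [cP' cQ' yE]]]]].
exists (A + A')%type, (block P P'), (block Q Q'), (fun i s => match s with inl u => a i u | inr u => a' i u end).
split; [exact: fcone_block cP cP'|exact: fcone_block cQ cQ'|] => i j.
have te0 t : te 0 t = 0 by exact: linear0_of (tm_linearl M t).
rewrite big_sumType xE yE /=; congr (_ + _); apply: eq_bigr => s _.
  by rewrite big_sumType /= [X in _ + X]big1 ?addr0// => t _; rewrite te0 scaler0.
by rewrite big_sumType /= [X in X + _]big1 ?add0r// => t _; rewrite te0 scaler0.
Qed.

Lemma hadamard_form_sum (J : Type) (r : seq J) (x : J -> 'I_n -> 'I_n -> M) :
  (forall k, hadamard_form (x k)) -> hadamard_form (fun i j => \sum_(k <- r) x k i j).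
Proof.
move=> hx; elim: r => [|k r IH].
  by apply: eq_hadamard_form hadamard_form0 => i j; rewrite big_nil.
by apply: eq_hadamard_form (hadamard_formD (hx k) IH) => i j; rewrite big_cons.
Qed.

End HadamardForm.

End SeparatedSystems.

(** * Block diagonal systems *)

Section FiniteSupport.
Local Open Scope ring_scope.
Local Open Scope classical_set_scope.
Variables (K : fieldType) (L : choiceType) (V : L -> lmodType K).
Local Notation D := (dsum V).

Lemma dsum_support (I : finType) (y : I -> D) :
  exists2 s : seq L, uniq s & forall i l, y i l != 0 -> l \in s.
Proof.
have : finite_set (\bigcup_(i in [set: I]) [set l | y i l != 0]).
  by apply: bigcup_finite => // i _; exact: dsum_finite.
move=> /finite_seqP[s sE]; exists (undup s); first exact: undup_uniq.
move=> i l yl; rewrite mem_undup.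
have : (\bigcup_(i in [set: I]) [set l | y i l != 0]) l by exists i.
by rewrite sE.
Qed.

Lemma dsumDE (x y : D) l : (x + y) l = x l + y l. Proof. by []. Qed.
Lemma dsumZE a (x : D) l : (a *: x) l = a *: x l. Proof. by []. Qed.
Lemma dsum_inE l (v : V l) : dsum_in v l = v.
Proof. by rewrite /= dfwithin. Qed.

Lemma dsum_in_neq l m (v : V l) : l != m -> dsum_in v m = 0.
Proof. by move=> lm; rewrite /= dfwithout. Qed.

Lemma dsum_in_linear l : linear (@dsum_in K L V l).
Proof.
move=> a x y; apply: dsumP => m; rewrite dsumDE dsumZE.
have [<-|lm] := eqVneq l m; first by rewrite !dsum_inE.
by rewrite !dsum_in_neq// scaler0 addr0.
Qed.

Section Lift.
Variables (W : lmodType K) (g : forall l, V l -> W).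
Hypothesis g_linear : forall l, linear (@g l).

(** Sums over a chosen list containing the support; [dsum_liftE] shows that any such list gives the
    same value. *)
Definition dsum_lift (y : D) : W :=
  \sum_(l <- projT1 (cid2 (dsum_support (fun=> y : D) : exists2 _, _ & forall i : unit, _)))
    g (y l).

Lemma dsum_liftE (y : D) (s : seq L) : uniq s -> (forall l, y l != 0 -> l \in s) ->
  dsum_lift y = \sum_(l <- s) g (y l).
Proof.
move=> us ys; rewrite /dsum_lift; case: cid2 => /= t ut yt.
have gz l : y l = 0 -> g (y l) = 0.
  move=> ->; have := @g_linear l (-1) 0 0.
  by rewrite scaler0 addr0 scaleN1r addNr.
have E (r : seq L) : \sum_(l <- r) g (y l) = \sum_(l <- r | y l != 0) g (y l).
  rewrite [LHS](bigID (fun l => y l != 0))/= [X in _ + X]big1 ?addr0//.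
  by move=> l; rewrite negbK => /eqP /gz.
rewrite !E -big_filter -[RHS]big_filter; apply: perm_big; apply: uniq_perm.
- exact: filter_uniq.
- exact: filter_uniq.
move=> l; rewrite !mem_filter; case: eqVneq => //= yl.
by rewrite (yt tt l yl) (ys l yl).
Qed.

Lemma dsum_lift_linear : linear dsum_lift.
Proof.
move=> a x y.
have [s us h] := dsum_support (fun b : bool => if b then x else y).
have hx l : x l != 0 -> l \in s by exact: (h true).
have hy l : y l != 0 -> l \in s by exact: (h false).
rewrite (dsum_liftE us hx) (dsum_liftE us hy) (@dsum_liftE (a *: x + y) s)//; last first.
  move=> l; apply: contraNT => ls; rewrite dsumDE dsumZE.
  have -> : x l = 0 by apply/eqP; apply: contraNT ls => /hx.
  have -> : y l = 0 by apply/eqP; apply: contraNT ls => /hy.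
  by rewrite scaler0 addr0.
rewrite scaler_sumr -big_split; apply: eq_bigr => l _ /=.
by rewrite g_linear.
Qed.

Lemma dsum_lift_in l (v : V l) : dsum_lift (dsum_in v) = g v.
Proof.
rewrite (@dsum_liftE _ [:: l])//; first by rewrite big_seq1 dsum_inE.
move=> m; rewrite inE; apply: contraNT => lm.
by rewrite dsum_in_neq // eq_sym.
Qed.

End Lift.
End FiniteSupport.

Section BlockDiagonalSystem.
Local Open Scope ring_scope.
Local Open Scope classical_set_scope.
Local Open Scope sesquilinear_scope.
Variable R : realType.
Local Notation C := R[i].
Local Notation cj := Num.conj.
Local Notation rC r := ((r%:C)%C : C).
Variables (L : choiceType) (k : L -> nat).

Definition blk (l : L) : lmodType C := 'M[C]_(k l).
Definition bds_car : lmodType C := (C^o * dsum blk)%type.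

(* (c, y) stands for the family of matrices c 1 + y_l. *)
Definition bds_coord l (z : bds_car) : 'M[C]_(k l) := z.1%:M + (z.2 l : 'M[C]_(k l)).

Fact blk_star_subproof (y : dsum blk) :
  finite_set [set l | ((y l : 'M[C]_(k l)) ^t* : blk l) != 0].
Proof.
apply: sub_finite_set (dsum_finite y) => l /=; apply: contra_neq => ->.
by apply/matrixP => i j; rewrite !mxE rmorph0.
Qed.
Definition blk_star (y : dsum blk) : dsum blk := DSum (blk_star_subproof y).

(** The limit c is tested along with the blocks c 1 + y_l; for finite L it acts as one more block of
    size 1. *)
Definition bds_mos : mospace R := @MOSpace R bds_car
  (fun z => (cj z.1, blk_star z.2)) (1, 0)
  (fun n => [set X | fpsd (fun p q => (X p q).1) /\
    forall l, fpsd (fun p q : 'I_n * 'I_(k l) => bds_coord l (X p.1 q.1) p.2 q.2)]).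

Lemma bds_coord_linear l : linear (bds_coord l : bds_mos -> 'M[C]_(k l)).
Proof.
move=> a x y; apply/matrixP => i j.
by rewrite !mxE mulrDr mulrnDl mulrnAr addrACA.
Qed.

Lemma bds_coord_one l : bds_coord l (mos_one bds_mos) = 1%:M.
Proof. by rewrite /bds_coord /= addr0. Qed.

Lemma bds_coord_star l z : bds_coord l (@mos_star R bds_mos z) = (bds_coord l z) ^t*.
Proof.
apply/matrixP => i j; rewrite !mxE cjD; congr (_ + _).
by rewrite eq_sym; case: (j == i); rewrite ?mulr1n ?mulr0n ?rmorph0.
Qed.

Definition bds_limit (z : bds_mos) : 'M[C]_1 := z.1%:M.

Lemma bds_limit_linear : linear bds_limit.
Proof. by move=> a x y; apply/matrixP => i j; rewrite !mxE mulrnDl mulrnAr. Qed.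

Lemma bds_eq (x y : bds_mos) : bds_limit x = bds_limit y ->
  (forall l, bds_coord l x = bds_coord l y) -> x = y.
Proof.
move=> /matrixP/(_ 0 0); rewrite !mxE eqxx !mulr1n.
case: x y => [c x] [d y] /= -> xy; congr pair; apply: dsumP => l.
by have := xy l; rewrite /bds_coord /= => /addrI.
Qed.

Definition mx_opsys n : opsys R := Opsys (mx_mos_opsys R n).

Lemma bds_coneE n (X : 'M[bds_mos]_n) : mos_cone X <->
  @mos_cone R (mx_opsys 1) n (map_mx bds_limit X) /\
  forall l, @mos_cone R (mx_opsys (k l)) n (map_mx (bds_coord l) X).
Proof.
have E : @mos_cone R (mx_opsys 1) n (map_mx bds_limit X) <-> fpsd (fun p q => (X p q).1).
  rewrite /= psd_flatE; split.
    move=> /(fpsd_reindex (fun i => (i, 0))); apply: eq_fpsd => p q.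
    by rewrite map_mx_entry mxE eqxx mulr1n.
  move=> /(fpsd_reindex (fun p : 'I_n * 'I_1 => p.1)); apply: eq_fpsd => p q.
  by rewrite map_mx_entry mxE !ord1 eqxx mulr1n.
have F l : @mos_cone R (mx_opsys (k l)) n (map_mx (bds_coord l) X) <->
    fpsd (fun p q : 'I_n * 'I_(k l) => bds_coord l (X p.1 q.1) p.2 q.2).
  by rewrite /= psd_flatE; split; apply: eq_fpsd => p q; rewrite map_mx_entry.
split=> [[h1 h2]|[/E h1 h2]]; first by split=> [|l]; [exact/E|exact/F].
by split=> // l; exact/F.
Qed.

Lemma bds_opsys_proof : is_opsys bds_mos.
Proof.
pose T (o : option L) := mx_opsys (if o is Some l then k l else 1).
pose h (o : option L) : bds_mos -> T o :=
  match o return bds_mos -> T o with Some l => bds_coord l | None => bds_limit end.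
apply: (@opsys_separated R bds_mos (option L) T h).
- by case=> [l|]; [exact: bds_coord_linear|exact: bds_limit_linear].
- by case=> [l|]; [exact: bds_coord_one|].
- case=> [l|] x; first exact: bds_coord_star.
  by apply/matrixP => i j; rewrite !mxE !ord1 eqxx !mulr1n.
- by move=> x y xy; apply: bds_eq; [exact: (xy None)|move=> l; exact: (xy (Some l))].
- move=> n X; rewrite bds_coneE; split=> [[h1 h2] [l|//]|hX]; first exact: h2.
  by split=> [|l]; [exact: (hX None)|exact: (hX (Some l))].
move=> n X sX.
(* Outside s, a block of X is the limit of X tensored with the identity, so a bound for the limit
   and finitely many bounds for the blocks in s suffice. *)
have [s us Xs] := dsum_support (fun p : 'I_n * 'I_n => (X p.1 p.2).2).
have sX' i j : @mos_star R bds_mos (X j i) = X i j by rewrite -{2}sX mxE.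
have [r0 r00 hr0] : exists2 r : R, 0 < r & fpsd (fun i j => rC r * (i == j)%:R + (X i j).1).
  by apply: fpsd_order_unit => i j; rewrite -{1}(sX' j i).
pose good (r : R) l := fpsd (fun p q : 'I_n * 'I_(k l) =>
  rC r * (p == q)%:R + bds_coord l (X p.1 q.1) p.2 q.2).
have good_mono r r' l : r <= r' -> good r l -> good r' l.
  move=> rr' gr; have r1 : 0 <= rC (r' - r) by rewrite lecR subr_ge0.
  apply: eq_fpsd (fpsdD (fpsdZ r1 (@fpsd_id R _)) gr) => p q.
  by rewrite addrA -mulrDl -rCD subrK.
have [r [r1 rr hr]] : exists r : R, [/\ 0 < r, r0 <= r & forall l, l \in s -> good r l].
  elim: s {us Xs} => [|l s [r [r1 rr hr]]]; first by exists r0; split.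
  have [t t0 ht] : exists2 t : R, 0 < t & good t l.
    apply: fpsd_order_unit => p q.
    by rewrite -{1}(sX' q.1 p.1) bds_coord_star !mxE.
  exists (r + t); split; first exact: addr_gt0.
    by rewrite (le_trans rr)// lerDl ltW.
  move=> m; rewrite inE => /orP[/eqP ->|ms].
    by apply: good_mono ht; rewrite lerDr ltW.
  by apply: good_mono (hr m ms); rewrite lerDl ltW.
have hinf : fpsd (fun i j => rC r * (i == j)%:R + (X i j).1).
  have r2 : 0 <= rC (r - r0) by rewrite lecR subr_ge0.
  apply: eq_fpsd (fpsdD (fpsdZ r2 (@fpsd_id R _)) hr0) => p q.
  by rewrite addrA -mulrDl -rCD subrK.
exists r => // -[l|]; rewrite /= psd_flatE; last first.
  apply: eq_fpsd (fpsd_reindex (fun p : 'I_n * 'I_1 => p.1) hinf) => p q.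
  by rewrite (@mxunitrDE R (mx_mos R 1)) map_mx_entry !mxE !ord1 eqxx mulr1 !mulr1n.
have gl : good r l.
  have [|ls] := boolP (l \in s); first exact: hr.
  apply: eq_fpsd (fpsd_tensor hinf (@fpsd_id R 'I_(k l))) => p q.
  have -> : bds_coord l (X p.1 q.1) = (X p.1 q.1).1%:M.
    rewrite /bds_coord; have -> : (X p.1 q.1).2 l = 0; last by rewrite addr0.
    by apply/eqP; apply: contraNT ls => /(Xs (p.1, q.1)).
  rewrite [_%:M _ _]mxE mulrDl [(X _ _).1 * _]mulr_natr -mulrA -natrM mulnb -xpair_eqE.
  by rewrite -!surjective_pairing.
apply: eq_fpsd gl => p q.
rewrite (@mxunitrDE R (mx_mos R (k l))) map_mx_entry [in RHS]mxE; congr (_ + _).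
by rewrite mxE /= !mxE -mulrA -natrM mulnb -xpair_eqE -!surjective_pairing.
Qed.

Definition bds : opsys R := Opsys bds_opsys_proof.

Lemma bds_fcone (I : finType) (x : I -> I -> bds) : fcone x <->
  fpsd (fun p q => (x p q).1) /\
  forall l, fpsd (fun p q : I * 'I_(k l) => bds_coord l (x p.1 q.1) p.2 q.2).
Proof.
rewrite /fcone /=; split=> -[h1 h2]; split.
- apply: eq_fpsd (fpsd_reindex enum_rank h1) => p q.
  by rewrite mxE !enum_rankK.
- move=> l; apply: eq_fpsd (fpsd_reindex (fun p => (enum_rank p.1, p.2)) (h2 l)) => p q.
  by rewrite mxE !enum_rankK.
- by apply: eq_fpsd (fpsd_reindex enum_val h1) => p q; rewrite mxE.
- move=> l; apply: eq_fpsd (fpsd_reindex (fun p : 'I_#|I| * 'I_(k l) => (enum_val p.1, p.2)) (h2 l)) => p q.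
  by rewrite mxE.
Qed.

Lemma bds_coord_ucp l : @ucp R bds (mx_mos R (k l)) (bds_coord l).
Proof.
split; [exact: bds_coord_linear|exact: bds_coord_one|].
by move=> n X /bds_coneE[_]; apply.
Qed.

Lemma bds_limit_ucp : @ucp R bds (mx_mos R 1) bds_limit.
Proof. by split=> //; [exact: bds_limit_linear|move=> n X /bds_coneE[]]. Qed.

Definition bds_in l (A : 'M[C]_(k l)) : bds := (0, dsum_in (A : blk l)).

Lemma bds_in_linear l : linear (@bds_in l).
Proof.
move=> a x y; rewrite /bds_in (@dsum_in_linear _ _ blk l a x y).
have E : (0 : C^o) = a *: 0 + 0 by rewrite scaler0 addr0.
exact: (congr2 pair E erefl).
Qed.

Lemma bds_coord_in l A : bds_coord l (bds_in A) = A.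
Proof. by rewrite /bds_coord /= dfwithin raddf0 add0r. Qed.

Lemma bds_coord_in_neq l m (A : 'M[C]_(k l)) : l != m -> bds_coord m (bds_in A) = 0.
Proof. by move=> lm; rewrite /bds_coord /= dfwithout// raddf0 add0r. Qed.

Lemma fcone_bds_in l (I : finType) (x : I -> I -> 'M[C]_(k l)) :
  fpsd (fun p q : I * 'I_(k l) => x p.1 q.1 p.2 q.2) -> fcone (fun i j => bds_in (x i j)).
Proof.
move=> px; apply/bds_fcone; split.
  by move=> v; rewrite /sform big1// => i _; rewrite big1// => j _; rewrite mulr0 mul0r.
move=> m; have [lm|lm] := eqVneq l m.
  case: m / lm; apply: eq_fpsd px => p q; by rewrite bds_coord_in.
by move=> v; rewrite /sform big1// => i _; rewrite big1// => j _;
  rewrite bds_coord_in_neq// mxE mulr0 mul0r.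
Qed.

(** The indicator of the complement of s, with limit 1. *)
Definition bds_tail (s : seq L) : bds := mos_one bds - \sum_(l <- s) bds_in (1%:M : 'M_(k l)).

Lemma bds_coord_tail s l : uniq s -> bds_coord l (bds_tail s) = (l \notin s)%:R%:M.
Proof.
move=> us; have bl := @bds_coord_linear l.
rewrite /bds_tail -scaleN1r (linearD_of bl) (linearZ_of bl) (linear_sum_of bl).
rewrite bds_coord_one; have [ls|ls] := boolP (l \in s).
  rewrite (bigD1_seq l)//= bds_coord_in big1 => [|m ml]; last exact: bds_coord_in_neq.
  by rewrite addr0 scaleN1r subrr raddf0.
rewrite big_seq big1 => [|m ms]; first by rewrite scaler0 addr0.
by apply: bds_coord_in_neq; apply: contraNneq ls => <-.
Qed.

Lemma bds_tail_pos s : uniq s -> pos_elt (bds_tail s).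
Proof.
move=> us; apply/bds_fcone.
have t1 : (bds_tail s).1 = 1.
  rewrite /bds_tail /=; have -> : (\sum_(l <- s) bds_in (1%:M : 'M_(k l))).1 = 0.
    by elim/big_rec: _ => // l x _ /= ->; rewrite addr0.
  by rewrite subr0.
split.
  move=> v; apply: sumr_ge0 => -[] _; apply: sumr_ge0 => -[] _.
  by rewrite t1 mulr1 mul_conjC_ge0.
move=> l; rewrite bds_coord_tail//.
have b0 : 0 <= (l \notin s)%:R :> C by rewrite ler0n.
apply: eq_fpsd (fpsdZ b0 (fpsd_reindex (fun p : unit * 'I_(k l) => p.2) (@fpsd_id R _))).
by move=> p q; rewrite mxE mulr_natr.
Qed.

Section Slices.
Variables (S : opsys R) (M : tensor_model S bds).
Local Notation te := (tm_tens M).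

(** The maps id (x) (matrix coefficient of a block) and id (x) limit, obtained from the universal
    property. *)
Lemma bds_slices : exists (slice : forall l, 'I_(k l) -> 'I_(k l) -> M -> S) (slice0 : M -> S),
  [/\ forall l a b, linear (@slice l a b) /\
        forall s t, slice l a b (te s t) = bds_coord l t a b *: s,
      linear slice0 & forall s (t : bds), slice0 (te s t) = t.1 *: s].
Proof.
have /choice[h hP] : forall u : {l : L & ('I_(k l) * 'I_(k l))%type}, exists h : M -> S,
    linear h /\ forall s t, h (te s t) = bds_coord (tag u) t (tagged u).1 (tagged u).2 *: s.
  case=> l ab; apply: (@tm_univ _ _ _ M S (fun s t => bds_coord l t ab.1 ab.2 *: s)).
    by move=> t c x y; rewrite scalerDr !scalerA mulrC.
  by move=> s c x y; rewrite bds_coord_linear !mxE scalerDl scalerA.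
have [h0 [h0l h0E]] : exists h : M -> S, linear h /\
    forall s (t : bds), h (te s t) = (t.1 : C) *: s.
  apply: (@tm_univ _ _ _ M S (fun s (t : bds) => (t.1 : C) *: s)).
    by move=> t c x y; rewrite scalerDr !scalerA mulrC.
  by move=> s c x y; rewrite scalerDl scalerA.
exists (fun l a b => h (Tagged _ (a, b))), h0; split=> // l a b; exact: (hP (Tagged _ (a, b))).
Qed.

Variables (slice : forall l, 'I_(k l) -> 'I_(k l) -> M -> S) (slice0 : M -> S).
Hypothesis slice_linear : forall l a b, linear (@slice l a b).
Hypothesis sliceE : forall l a b s t, @slice l a b (te s t) = bds_coord l t a b *: s.
Hypothesis slice0_linear : linear slice0.
Hypothesis slice0E : forall s (t : bds), slice0 (te s t) = t.1 *: s.

(** Rebuilds z from its slices: the limit on the tail, matrix units on the blocks in s. It returns z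
    once s is large enough ([bds_expansion_support]). *)
Definition bds_expansion (s : seq L) (z : M) : M :=
  te (slice0 z) (bds_tail s) +
  \sum_(l <- s) \sum_a \sum_b te (slice a b z) (bds_in (delta_mx a b : 'M_(k l))).

Lemma bds_expansion_linear s : linear (bds_expansion s).
Proof.
move=> c x y; rewrite /bds_expansion slice0_linear tm_linearl scalerDr addrACA.
congr (_ + _); rewrite scaler_sumr -big_split; apply: eq_bigr => l _ /=.
rewrite scaler_sumr -big_split; apply: eq_bigr => a _ /=.
rewrite scaler_sumr -big_split; apply: eq_bigr => b _ /=.
by rewrite slice_linear tm_linearl.
Qed.

Lemma bds_expansion_tens x (t : bds) s : uniq s -> (forall l, t.2 l != 0 -> l \in s) ->
  bds_expansion s (te x t) = te x t.
Proof.
move=> us ts; have tr := tm_linearr M x.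
rewrite /bds_expansion slice0E (linearZ_of (tm_linearl M _)) -(linearZ_of tr).
have E l : \sum_a \sum_b te (slice a b (te x t)) (bds_in (delta_mx a b : 'M_(k l))) =
    te x (bds_in (bds_coord l t)).
  rewrite [in RHS](matrix_sum_delta (bds_coord l t)) pair_bigA [in RHS]pair_bigA.
  rewrite (linear_sumZ (@bds_in_linear l)) (linear_sumZ tr).
  by apply: eq_bigr => p _; rewrite sliceE (linearZ_of (tm_linearl M _)).
under eq_bigr do rewrite E.
rewrite -(linear_sum_of tr) -(linearD_of tr); congr (te x _).
have bl m := @bds_coord_linear m; have ll := bds_limit_linear.
have in0 l (A : 'M[C]_(k l)) : bds_limit (bds_in A) = 0.
  by apply/matrixP => i j; rewrite !mxE mul0rn.
apply: bds_eq => [|m].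
  rewrite (linearD_of ll) (linear_sum_of ll) big1 => [|l _]; last exact: in0.
  rewrite (linearZ_of ll) /bds_tail -scaleN1r (linearD_of ll) (linearZ_of ll).
  rewrite (linear_sum_of ll) big1 => [|l _]; last exact: in0.
  by rewrite scaler0 !addr0; apply/matrixP => i j; rewrite !mxE mulrnAr mulr1.
rewrite (linearD_of (bl m)) (linear_sum_of (bl m)) (linearZ_of (bl m)) bds_coord_tail//.
have [ms|ms] := boolP (m \in s).
  rewrite scale_scalar_mx mulr0 raddf0 add0r (bigD1_seq m)//= bds_coord_in.
  rewrite big1 ?addr0// => l lm; exact: bds_coord_in_neq.
rewrite big_seq big1 => [|l ls]; last first.
  by apply: bds_coord_in_neq; apply: contraNneq ms => <-.
rewrite addr0 scale_scalar_mx mulr1 /bds_coord; have -> : t.2 m = 0; last by rewrite addr0.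
by apply/eqP; apply: contraNT ms => /ts.
Qed.

Lemma bds_expansion_support (z : M) : exists s0 : seq L, forall s, uniq s ->
  {subset s0 <= s} -> bds_expansion s z = z.
Proof.
have [r ->] := tm_sum z; elim: r => [|[x t] r [s0 IH]].
  by exists [::] => s us _; rewrite big_nil (linear0_of (bds_expansion_linear s)).
have [s1 us1 ts1] := dsum_support ((fun=> t.2) : unit -> dsum blk).
exists (s1 ++ s0) => s us ss; rewrite big_cons (linearD_of (bds_expansion_linear s)).
rewrite IH//; last by move=> l ls; apply: ss; rewrite mem_cat ls orbT.
rewrite bds_expansion_tens// => l tl.
by apply: ss; rewrite mem_cat (ts1 tt l tl).
Qed.

(** The expansion of X is a sum of Hadamard products of slices with positive matrices over [bds].
    The slices are positive by separation: a ucp f applied to a slice is a compression of f (x)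
    coordinate applied to X. *)
Lemma bds_max_form n (X : 'M[M]_n) : mos_cone X -> max_form X.
Proof.
move=> /tm_coneP cX; apply: hadamard_max_form.
have /choice[s0 s0P] (p : 'I_n * 'I_n) := bds_expansion_support (X p.1 p.2).
pose s := undup (flatten [seq s0 p | p : 'I_n * 'I_n]).
have us : uniq s := undup_uniq _.
have sX i j : bds_expansion s (X i j) = X i j.
  apply: (s0P (i, j)) => // l ls; rewrite mem_undup; apply/flattenP.
  by exists (s0 (i, j)) => //; apply: map_f; rewrite mem_enum.
apply: eq_hadamard_form sX _; apply: hadamard_formD.
  exists 'I_n, (fun i j => slice0 (X i j)), (fun _ _ => bds_tail s), (fun i j => (i == j)%:R).
  split.
  - apply: fcone_separation => m f fu; have [fl _ _] := fu.
    have [ll _ _] := bds_limit_ucp.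
    have := fpsd_reindex (fun p : 'I_n * 'I_m => (p.1, mxtens_index (p.2, 0))) (cX _ _ _ _ fu bds_limit_ucp).
    apply: eq_fpsd => p q /=.
    pose F (z : M) : C^o := tm_map f bds_limit z (mxtens_index (p.2, 0)) (mxtens_index (q.2, 0)).
    pose G (z : M) : C^o := f (slice0 z) p.2 q.2.
    rewrite -[LHS]/(F _) -[RHS]/(G _); apply: (tm_ext (M := M)).
    + by move=> a x y; rewrite /F (tm_map_linear fl ll) !mxE.
    + by move=> a x y; rewrite /G slice0_linear fl !mxE.
    move=> x t; rewrite /F /G tm_mapE// tensmxE slice0E (linearZ_of fl) !mxE eqxx mulr1n.
    by rewrite mulrC.
  - exact: (fcone_reindex (fun=> tt) (bds_tail_pos us)).
  - move=> i j; under eq_bigr => p _.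
      under eq_bigr => q _ do rewrite rmorph_nat -scalerA.
      rewrite -scaler_sumr sum_deltaZ; over.
    by rewrite sum_deltaZ.
apply: hadamard_form_sum => l.
exists ('I_n * 'I_(k l))%type, (fun p q => slice p.2 q.2 (X p.1 q.1)),
  (fun p q => bds_in (delta_mx p.2 q.2 : 'M_(k l))), (fun i p => (i == p.1)%:R); split.
- apply: fcone_separation => m f fu; have [fl _ _] := fu.
  have [ll _ _] := bds_coord_ucp l.
  have := fpsd_reindex (fun p : ('I_n * 'I_(k l)) * 'I_m => (p.1.1, mxtens_index (p.2, p.1.2)))
    (cX _ _ _ _ fu (bds_coord_ucp l)).
  apply: eq_fpsd => p q /=.
  pose F (z : M) : C^o := tm_map f (bds_coord l : bds -> _) z
    (mxtens_index (p.2, p.1.2)) (mxtens_index (q.2, q.1.2)).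
  pose G (z : M) : C^o := f (slice p.1.2 q.1.2 z) p.2 q.2.
  rewrite -[LHS]/(F _) -[RHS]/(G _); apply: (tm_ext (M := M)).
  + by move=> a x y; rewrite /F (tm_map_linear fl ll) !mxE.
  + by move=> a x y; rewrite /G slice_linear fl !mxE.
  move=> x t; rewrite /F /G tm_mapE// tensmxE sliceE (linearZ_of fl) [RHS]mxE.
  by rewrite mulrC.
(* The matrix whose entries are the matrix units is a rank one Gram matrix. *)
- apply: fcone_bds_in.
  apply: eq_fpsd (fpsd_gram (fun (p : ('I_n * 'I_(k l)) * 'I_(k l)) (_ : 'I_1) => (p.1.2 == p.2)%:R)) => p q.
  by rewrite big_ord1 rmorph_nat -natrM mulnb mxE ![_ == p.2]eq_sym ![_ == q.2]eq_sym.
- move=> i j; rewrite [RHS]sum_pair.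
  transitivity (\sum_(p < n) (i == p)%:R *: \sum_a \sum_b
      te (slice a b (X p j)) (bds_in (delta_mx a b : 'M_(k l)))).
    by rewrite sum_deltaZ.
  apply: eq_bigr => p _; rewrite scaler_sumr; apply: eq_bigr => a _.
  rewrite sum_pair exchange_big scaler_sumr; apply: eq_bigr => b _ /=.
  transitivity (\sum_(q < n) (j == q)%:R *:
      ((i == p)%:R *: te (slice a b (X p q)) (bds_in (delta_mx a b : 'M_(k l))))).
    by rewrite sum_deltaZ.
  by apply: eq_bigr => q _; rewrite rmorph_nat scalerA mulrC.
Qed.

End Slices.

Lemma bds_nuclear (S : opsys R) (M : tensor_model S bds) n (X : 'M[M]_n) :
  mos_cone X -> max_form X.
Proof.
have [slice [slice0 [h hl hE]]] := bds_slices M.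
by apply: (@bds_max_form S M slice slice0) => // l a b; case: (h l a b).
Qed.

End BlockDiagonalSystem.

(** * Quotients of block diagonal systems and of the coproduct *)

Section Realization.
Local Open Scope ring_scope.
Local Open Scope classical_set_scope.
Variable R : realType.
Local Notation C := R[i].
Local Notation cj := Num.conj.
Local Notation rC r := ((r%:C)%C : C).

Section BlockMaps.
Variables (L : choiceType) (k : L -> nat) (E : opsys R).
Variable B : forall l, 'I_(k l) -> 'I_(k l) -> E.
Hypothesis B_pos : forall l, fcone (@B l).
Hypothesis B_small : forall s : seq L, uniq s ->
  pos_elt (mos_one E - \sum_(l <- s) \sum_a @B l a a).

Definition blk_map l (A : blk R k l) : E := \sum_a \sum_b (A : 'M[C]_(k l)) a b *: B a b.

Lemma blk_map_linear l : linear (@blk_map l).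
Proof.
move=> c x y; rewrite scaler_sumr -big_split; apply: eq_bigr => a _ /=.
rewrite scaler_sumr -big_split; apply: eq_bigr => b _ /=.
by rewrite !mxE scalerDl scalerA.
Qed.

Definition bds_map (z : bds R k) : E := (z.1 : C) *: mos_one E + dsum_lift blk_map z.2.

Lemma bds_map_linear : linear bds_map.
Proof.
move=> c x y; rewrite /bds_map (dsum_lift_linear blk_map_linear) /=.
by rewrite scalerDl scalerDr scalerA addrACA.
Qed.

Lemma bds_map_in l A : bds_map (@bds_in R L k l A) = blk_map A.
Proof. by rewrite /bds_map scale0r add0r (dsum_lift_in blk_map_linear). Qed.

(** With y . B = sum_ab y_ab B_ab, regroup c 1 + sum_l y_l . B_l as c (1 - sum_l tr B_l) + sum_l (c
    1 + y_l) . B_l over the support: [B_small] and [fcone_schur] make the terms positive. *)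
Lemma bds_map_ucp : ucp bds_map.
Proof.
split; first exact: bds_map_linear.
  by rewrite /bds_map /= scale1r (linear0_of (dsum_lift_linear blk_map_linear)) addr0.
move=> n X [h1 h2]; apply/mos_coneE.
have [s us Xs] := dsum_support (fun p : 'I_n * 'I_n => (X p.1 p.2).2).
have c1 := fcone_fpsd h1 (B_small us).
have c2 := @fcone_sum _ E 'I_n L s xpredT _ (fun l _ => fcone_schur (h2 l) (B_pos l)).
apply: eq_fcone (fconeD c1 c2) => i j; rewrite map_mx_entry /bds_map.
rewrite (dsum_liftE blk_map_linear us (Xs (i, j))) scalerBr -addrA; congr (_ + _).
rewrite scaler_sumr -sumrN -big_split; apply: eq_bigr => l _ /=.
rewrite /blk_map scaler_sumr -sumrN -big_split; apply: eq_bigr => a _ /=.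
rewrite (bigD1 a)//= [RHS](bigD1 a)//= addrA; congr (_ + _).
  by rewrite !mxE eqxx mulr1n scalerDl addrA addNr add0r.
apply: eq_bigr => b ba; rewrite !mxE eq_sym (negbTE ba) mulr0n add0r.
by [].
Qed.

(* Matrices over E with an evident positive preimage. *)
Inductive liftable n : ('I_n -> 'I_n -> E) -> Prop :=
| liftable0 : liftable (fun _ _ => 0)
| liftable_add l (P : 'I_n * 'I_(k l) -> 'I_n * 'I_(k l) -> C) x :
    fpsd P -> liftable x ->
    liftable (fun i j => \sum_a \sum_b P (i, a) (j, b) *: B a b + x i j).

Lemma eq_liftable n (x y : 'I_n -> 'I_n -> E) :
  (forall i j, x i j = y i j) -> liftable x -> liftable y.
Proof.
move=> xy; suff -> : x = y by [].
by apply: funext => i; apply: funext => j.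
Qed.

Lemma liftableD n (x y : 'I_n -> 'I_n -> E) : liftable x -> liftable y ->
  liftable (fun i j => x i j + y i j).
Proof.
move=> hx hy; elim: hx => {x} [|l P x pP _ IH].
  by apply: eq_liftable hy => i j; rewrite add0r.
by apply: eq_liftable (liftable_add pP IH) => i j; rewrite addrA.
Qed.

Lemma liftable_sum n (J : Type) (s : seq J) (x : J -> 'I_n -> 'I_n -> E) :
  (forall u, liftable (x u)) -> liftable (fun i j => \sum_(u <- s) x u i j).
Proof.
move=> hx; elim: s => [|u s IH].
  by apply: eq_liftable (liftable0 n) => i j; rewrite big_nil.
by apply: eq_liftable (liftableD (hx u) IH) => i j; rewrite big_cons.
Qed.

(** Surjectivity is a consequence of lifting: p + 1 has a preimage for each positive p, hence so has
    p, and the positive elements span E. *)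
Lemma lifting_quotient (T : mospace R) (f : T -> E) : ucp f ->
    (forall n (x : 'I_n -> 'I_n -> E), liftable x ->
      exists Z : 'M[T]_n, mos_cone Z /\ forall i j, f (Z i j) = x i j) ->
    (forall n (Q : 'M[E]_n) e, mos_cone Q -> 0 < e ->
      liftable (fun i j => (Q + mxunitr E n e) i j)) ->
  complete_order_quotient f.
Proof.
move=> fu flift El; have [fl f1 _] := fu.
have lift n (Q : 'M[E]_n) e : mos_cone Q -> 0 < e ->
    exists P : 'M[T]_n, mos_cone P /\ map_mx f P = Q + mxunitr E n e.
  move=> cQ e0; have [Z [cZ ZE]] := flift _ _ (El _ _ _ cQ e0).
  by exists Z; split=> //; apply/matrixP => i j; rewrite map_mx_entry ZE.
split=> // y; have [m [c [p [pp ->]]]] := pos_elt_span y.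
have /choice[g gE] : forall i, exists x, f x = p i.
  move=> i; have cp : mos_cone (const_mx (p i) : 'M[E]_1).
    apply/mos_coneE; apply: eq_fcone (fcone_reindex (fun=> tt) (pp i)) => a b.
    by rewrite mxE.
  have [P [_ /matrixP/(_ 0 0)]] := lift _ _ _ cp ltr01.
  rewrite map_mx_entry mxD_entry mxunitrE mxE mulr1 scale1r => PE.
  exists (- (1 : C) *: mos_one T + P 0 0).
  by rewrite fl f1 PE scaleN1r addrC addrK.
exists (\sum_i c i *: g i); rewrite (linear_sumZ fl).
by apply: eq_bigr => i _; rewrite gE.
Qed.

End BlockMaps.

Lemma geometric_sum_le1 (s : seq nat) : uniq s ->
  \sum_(i <- s) (2^-1 ^+ i.+1 : R) <= 1.
Proof.
move=> us; pose N := (\max_(i <- s) i).+1.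
have sN i : i \in s -> (i < N)%N by move=> si; rewrite ltnS; exact: leq_bigmax_seq.
have geo : \sum_(0 <= i < N) (2^-1 ^+ i.+1 : R) = 1 - 2^-1 ^+ N.
  elim: N {sN} => [|m IH]; first by rewrite big_geq// expr0 subrr.
  by rewrite big_nat_recr//= IH exprSr; lra.
apply: (@le_trans _ _ (\sum_(0 <= i < N) (2^-1 ^+ i.+1 : R))); last first.
  by rewrite geo lerBlDr lerDl exprn_ge0// invr_ge0.
rewrite [leRHS](bigID (fun i => i \in s))/= -[leLHS]addr0.
apply: lerD; last by apply: sumr_ge0 => i _; rewrite exprn_ge0// invr_ge0.
rewrite -[leRHS]big_filter le_eqVlt; apply/orP; left; apply/eqP.
apply: perm_big; apply: uniq_perm => //; first by rewrite filter_uniq// iota_uniq.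
move=> i; rewrite mem_filter mem_index_iota /=.
by case: (boolP (i \in s)) => //= si; rewrite sN.
Qed.

(** Countability of L enters here. If q_l <= r_l 1, the weight 2^-(code l + 1) / r_l gives w_l q_l
    <= 2^-(code l + 1) 1, and every finite sum of these bounds is at most 1. *)
Lemma weights (L : choiceType) (code : L -> nat) (E : opsys R) (q : L -> E) :
    injective code -> (forall l, pos_elt (q l)) ->
  exists w : L -> R, (forall l, 0 < w l) /\ forall s, uniq s ->
    pos_elt (mos_one E - \sum_(l <- s) rC (w l) *: q l).
Proof.
move=> cI qp.
have /choice[r rP] : forall l, exists r, 0 < r /\ pos_elt (rC r *: mos_one E - q l).
  move=> l; have [|r r0 hr] := @pos_elt_bound _ E (- q l); last by exists r.
  by rewrite mos_starN (fcone_star tt tt (qp l)).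
exists (fun l => 2^-1 ^+ (code l).+1 / r l); split.
  by move=> l; have [r0 _] := rP l; rewrite divr_gt0// exprn_gt0// invr_gt0.
move=> s us; pose W := \sum_(l <- s) (2^-1 ^+ (code l).+1 : R).
have W1 : W <= 1.
  rewrite /W -(big_map code xpredT (fun i => 2^-1 ^+ i.+1)).
  by apply: geometric_sum_le1; rewrite map_inj_uniq.
have W0 : 0 <= 1 - W by rewrite subr_ge0.
have c1 := fconeZ W0 (pos_elt_one E).
have c2 := @fcone_sum _ E unit L s xpredT
  (fun l _ _ => rC (2^-1 ^+ (code l).+1 / r l) *: (rC (r l) *: mos_one E - q l)) _.
apply: eq_fcone (fconeD c1 (c2 _)) => [_ _|l _]; last first.
  have [r0 hr] := rP l.
  have t0 : 0 <= 2^-1 ^+ (code l).+1 / r l.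
    by apply: divr_ge0; [apply: exprn_ge0; rewrite invr_ge0|exact: ltW].
  exact: fconeZ t0 hr.
under eq_bigr => l _.
  have [r0 _] := rP l.
  rewrite scalerBr scalerA -rCM mulfVK ?gt_eqF//; over.
rewrite sumrB addrA; congr (_ - _).
rewrite -scaler_suml -scalerDl -[RHS]scale1r; congr (_ *: _).
by rewrite -(rmorph_sum (real_complex R)) -rCD subrK.
Qed.

(** * Approximation by Gaussian-integer matrices over a finitely generated system *)

Section IntegralFamily.
Variables (E : opsys R) (d : nat) (p : 'I_d -> E).
Hypothesis p_pos : forall j, pos_elt (p j).
Hypothesis p_span : forall x : E, exists c : 'I_d -> C, x = \sum_j c j *: p j.

Definition gauss (z : int * int) : C := rC (z.1%:~R) + 'i * rC (z.2%:~R).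

(** A countable type, so that its elements can be coded by natural numbers. *)
Definition int_mx K := {ffun 'I_d * ('I_K * 'I_K) -> int * int}.

(* sum_j (c_j + c_j^* ) (x) p_j with c_j Gaussian-integer matrices: after scaling,
   this countable family approximates every self-adjoint matrix over E. *)
Definition int_comb K (c : int_mx K) (a b : 'I_K) : E :=
  \sum_j (gauss (c (j, (a, b))) + cj (gauss (c (j, (b, a))))) *: p j.

(** Rounding down the real and the imaginary part costs at most 1 each. *)
Lemma gauss_approx (z : C) : exists c, `|z - gauss c| <= 2.
Proof.
exists (Num.floor (complex.Re z), Num.floor (complex.Im z)); rewrite /gauss.
have fl (x : R) : `|rC (x - (Num.floor x)%:~R)| <= 1.
  have x0 : 0 <= x - (Num.floor x)%:~R by rewrite subr_ge0 floor_le.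
  rewrite ger0_norm ?lecR// lerBlDl; have := floorD1_gt x.
  by rewrite intrD addrC => /ltW.
have zE : z = rC (complex.Re z) + 'i * rC (complex.Im z) by case: (z) => a b; simpc.
rewrite {1}zE opprD addrACA -mulrBr -!rCN -!rCD.
rewrite (le_trans (ler_normD _ _))// normrM normCi mul1r.
by have := lerD (fl (complex.Re z)) (fl (complex.Im z)).
Qed.

Section Approximation.
Variables (L : choiceType) (k : L -> nat) (B : forall l, 'I_(k l) -> 'I_(k l) -> E).
Hypothesis B_int : forall K (c : int_mx K.+1), fcone (int_comb c) ->
  forall n (P : 'I_n * 'I_K.+1 -> 'I_n * 'I_K.+1 -> C), fpsd P ->
  liftable B (fun i j => \sum_a \sum_b P (i, a) (j, b) *: int_comb c a b).

(** The integral 1 by 1 matrix 1 in position j yields 2 p_j, the factor 2 coming from c + c^*; it is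
    halved in A. *)
Lemma liftable_tensor n (A : 'I_n -> 'I_n -> C) j : fpsd A ->
  liftable B (fun i i' => A i i' *: p j).
Proof.
move=> pA.
pose c : int_mx 1 := [ffun u => ((u.1 == j)%:R, 0)].
have cE a b : int_comb c a b = 2 *: p j.
  transitivity (\sum_i (j == i)%:R *: (2 *: p i)); last exact: sum_deltaZ.
  apply: eq_bigr => i _; rewrite !ffunE /= /gauss /= mulr0 addr0 eq_sym scalerA; congr (_ *: _).
  by rewrite cj_real; case: (_ == _); rewrite ?mul1r ?mul0r ?addr0.
have cp : fcone (int_comb c).
  have r2 : 0 <= 2 :> R by [].
  apply: eq_fcone (fconeZ r2 (fcone_reindex (fun=> tt) (p_pos j))) => a b.
  by rewrite cE rmorph_nat.
have r0 : 0 <= rC 2^-1 by rewrite lecR invr_ge0.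
have := B_int cp (fpsdZ r0 (fpsd_reindex (fun u : 'I_n * 'I_1 => u.1) pA)).
apply: eq_liftable => i i'; rewrite !big_ord1 cE scalerA.
by rewrite fmorphV rmorph_nat mulrAC mulVf ?pnatr_eq0// mul1r.
Qed.

(** For x = Q + e, a large multiple N x equals comb + sum_j D_j (x) p_j with comb integral and
    positive and each D_j >= 0; dividing by N shows that x is liftable. *)
Lemma liftable_approx K (Q : 'I_K.+1 -> 'I_K.+1 -> E) (e : R) : fcone Q -> 0 < e ->
  liftable B (fun i j => Q i j + (rC e * (i == j)%:R) *: mos_one E).
Proof.
move=> cQ e0; pose n := K.+1.
pose x i j := Q i j + (rC e * (i == j)%:R) *: mos_one E.
have pstar j : mos_star (p j) = p j by exact: (fcone_star tt tt (p_pos j)).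
have xstar i j : mos_star (x j i) = x i j.
  rewrite /x mos_starD mos_starZ mos_star_one (fcone_star j i cQ).
  by rewrite cjM cj_real rmorph_nat eq_sym.
have /choice[g gE] (u : 'I_n * 'I_n) := p_span (x u.1 u.2).
(* Averaging with the adjoint makes the coefficients hermitian; this is possible as x and the p_j
   are self-adjoint. *)
pose q j a b : C := (g (a, b) j + cj (g (b, a) j)) / 2.
have q_herm j a b : q j b a = cj (q j a b).
  by rewrite /q cjM cjD conjCK fmorphV rmorph_nat addrC.
have xE a b : x a b = \sum_j q j a b *: p j.
  have s1 : x a b + x a b = \sum_j (g (a, b) j + cj (g (b, a) j)) *: p j.
    rewrite -{2}(xstar a b) (gE (a, b)) (gE (b, a)) mos_star_sum -big_split.
    by apply: eq_bigr => j _; rewrite mos_starZ pstar scalerDl.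
  have -> : x a b = 2^-1 *: (x a b + x a b).
    by rewrite -mulr2n -(scaler_nat 2 (x a b)) scalerA mulVf ?pnatr_eq0// scale1r.
  rewrite s1 scaler_sumr; apply: eq_bigr => j _.
  by rewrite scalerA mulrC.
clearbody q.
have [r r0 hr] : exists2 r, 0 < r & pos_elt (rC r *: mos_one E - \sum_j p j).
  apply: (@pos_elt_bound _ E (- \sum_j p j)).
  by rewrite mos_starN mos_star_sum; under eq_bigr do rewrite pstar.
(* The rounding error H_j below has entries of modulus at most 4 = 2 + 2, so [fpsd_bound] gives -
   kap <= H_j <= kap. *)
pose kap : R := #|'I_n|%:R * 4.
have kap0 : 0 < kap by rewrite /kap card_ord mulr_gt0.
(* Chosen so that N e = 2 kap r, with r 1 >= sum_j p_j: the unit in N x then absorbs 2 kap sum_j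
   p_j. *)
pose N := kap * 2 * r / e.
have N0 : 0 < N by rewrite divr_gt0// mulr_gt0// mulr_gt0.
have Ne : N * e = kap * 2 * r by rewrite mulfVK ?gt_eqF.
(* The half anticipates c + c^* in [int_comb]; the shift by kap makes D_j = kap + H_j positive. *)
pose y j a b : C := (rC N * q j a b - rC kap * (a == b)%:R) / 2.
have y_herm j a b : y j b a = cj (y j a b).
  rewrite /y cjM cjB !cjM !cj_real -q_herm fmorphV !rmorph_nat.
  by rewrite [b == a]eq_sym.
have /choice[c cE] (u : 'I_d * ('I_n * 'I_n)) := gauss_approx (y u.1 u.2.1 u.2.2).
pose c' : int_mx n := [ffun u => c u].
pose H j a b : C := 2 * y j a b - (gauss (c (j, (a, b))) + cj (gauss (c (j, (b, a))))).
have H_herm j a b : H j b a = cj (H j a b).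
  rewrite /H cjB cjM cjD conjCK -y_herm rmorph_nat.
  by rewrite [gauss _ + _]addrC.
have H_le j a b : `|H j a b| <= rC 4.
  have -> : H j a b = (y j a b - gauss (c (j, (a, b)))) +
      cj (y j b a - gauss (c (j, (b, a)))).
    by rewrite /H cjB -y_herm; ring.
  rewrite (le_trans (ler_normD _ _))// norm_conjC.
  have -> : rC 4 = 2 + 2 by rewrite -natrD rmorph_nat.
  exact: lerD (cE (j, (a, b))) (cE (j, (b, a))).
have H_pos j : fpsd (fun a b => rC kap * (a == b)%:R + H j a b).
  exact: fpsd_bound (H_herm j) (H_le j).
have H_neg j : fpsd (fun a b => rC kap * (a == b)%:R + - H j a b).
  apply: fpsd_bound => a b; first by rewrite H_herm cjN.
  by rewrite normrN.
pose D j a b : C := rC kap * (a == b)%:R + H j a b.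
have combE a b : int_comb c' a b = rC N *: x a b - \sum_j D j a b *: p j.
  rewrite xE scaler_sumr -sumrB; apply: eq_bigr => j _.
  rewrite scalerA -scalerBl !ffunE; congr (_ *: _).
  by rewrite /D /H /y; field.
have comb_pos : fcone (int_comb c').
  have N1 := ltW N0.
  have c1 := fconeZ N1 cQ.
  have k2 : 0 <= kap * 2 by rewrite mulr_ge0// ltW.
  have k2' : 0 <= rC (kap * 2) by rewrite lecR.
  have c2 := fcone_fpsd (fpsdZ k2' (@fpsd_id R 'I_n)) hr.
  have c3 := @fcone_sum _ E 'I_n 'I_d (index_enum 'I_d) xpredT _
    (fun j _ => fcone_fpsd (H_neg j) (p_pos j)).
  apply: eq_fcone (fconeD (fconeD c1 c2) c3) => a b; rewrite combE /x.
  rewrite [in RHS]scalerDr -addrA -[RHS]addrA; congr (_ + _).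
  rewrite [in LHS]scalerBr -addrA; congr (_ + _).
    by rewrite !scalerA; congr (_ *: _); rewrite [RHS]mulrA -rCM Ne rCM; ring.
  rewrite scaler_sumr -!sumrN -big_split; apply: eq_bigr => j _ /=.
  rewrite -[in LHS]scaleNr -scalerDl -[RHS]scaleNr; congr (_ *: _).
  by rewrite /D rCM rmorph_nat; ring.
have Ni : 0 <= rC N^-1 by rewrite lecR invr_ge0 ltW.
have l1 := B_int comb_pos (fpsdZ Ni (fpsd_gram (fun (u : 'I_n * 'I_n) (_ : 'I_1) => (u.1 == u.2)%:R))).
have l2 := liftable_sum (index_enum 'I_d) (fun j => liftable_tensor j (fpsdZ Ni (H_pos j))).
apply: eq_liftable (liftableD l1 l2) => i j; rewrite -/(x i j).
transitivity (rC N^-1 *: (int_comb c' i j + \sum_u D u i j *: p u)).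
  rewrite scalerDr scaler_sumr; congr (_ + _); last first.
    by apply: eq_bigr => u _; rewrite scalerA.
  transitivity (\sum_a (i == a)%:R *: \sum_b (j == b)%:R *: (rC N^-1 *: int_comb c' a b)).
    apply: eq_bigr => a _; rewrite scaler_sumr; apply: eq_bigr => b _.
    rewrite big_ord1 rmorph_nat !scalerA; congr (_ *: _); ring.
  by rewrite sum_deltaZ sum_deltaZ.
by rewrite combE subrK scalerA rCVK// scale1r.
Qed.

Lemma liftable_positive n (Q : 'M[E]_n) e : mos_cone Q -> 0 < e ->
  liftable B (fun i j => (Q + mxunitr E n e) i j).
Proof.
(* Blocks have size at least 1; at level 0 the zero lift serves. *)
case: n Q => [|n] Q /mos_coneE cQ e0.
  by apply: eq_liftable (liftable0 _ _) => -[].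
apply: eq_liftable (liftable_approx cQ e0) => i j.
by rewrite mxD_entry mxunitrE.
Qed.

End Approximation.

End IntegralFamily.

End Realization.

Section QuotientLift.
Local Open Scope ring_scope.
Local Open Scope classical_set_scope.
Variables (K : fieldType) (V W : lmodType K) (U : set V) (f : V -> W).
Hypothesis f_linear : linear f.
Hypothesis f_zero : forall u, U u -> f u = 0.

Definition qlift (z : qspan U) : W := f (repr z).

Lemma qlift_proj x : qlift (qproj U x) = f x.
Proof.
have [n [c [u [Uu xE]]]] : lin_span U (repr (qproj U x) - x).
  by apply/qproj_eq; rewrite qproj_repr.
rewrite /qlift -[repr _](subrK x) xE; have fD := f_linear 1.
have {}fD y z : f (y + z) = f y + f z by have := f_linear 1 y z; rewrite !scale1r.
rewrite fD; apply/eqP; rewrite -subr_eq0 addrK; apply/eqP.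
have f0 : f 0 = 0 by apply: (addrI (f 0)); rewrite -fD !addr0.
elim/big_rec: _ => // i y _ y0.
by rewrite f_linear f_zero// scaler0 add0r.
Qed.

Lemma qlift_linear : linear qlift.
Proof.
move=> a x y; rewrite -[x]qproj_repr -[y]qproj_repr -qproj_linear.
by rewrite !qlift_proj f_linear.
Qed.

End QuotientLift.

(** * Affine matrix-valued functions on the unit interval *)

Section AffineMatrixFunctions.
Local Open Scope ring_scope.
Local Open Scope classical_set_scope.
Local Open Scope sesquilinear_scope.
Variable R : realType.
Local Notation C := R[i].
Local Notation rC r := ((r%:C)%C : C).
Variable k : nat.

Definition ck_eval (x : @I01 R) (Y : Ck_mos R k) : 'M[C]_k :=
  map_mx (fun f : C01 R => f x : C) (val Y : 'M[C01 R]_k).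

Lemma ck_eval_linear x : linear (ck_eval x).
Proof. by move=> a X Y; apply/matrixP => i j; rewrite !mxE. Qed.

Lemma ck_eval_one x : ck_eval x (mos_one (Ck_mos R k)) = 1%:M.
Proof.
apply/matrixP => i j; rewrite /ck_eval mxE.
transitivity ((mxunitr (C01_mos R) k 1 i j : C01 R) x); first by [].
rewrite mxunitrE [RHS]mxE rmorph1 mul1r.
exact: mulr1.
Qed.

Lemma ck_coneE n (X : 'M[Ck_mos R k]_n) : mos_cone X <->
  forall x, fpsd (fun p q : 'I_n * 'I_k => ck_eval x (X p.1 q.1) p.2 q.2).
Proof.
have E x : psd (mxflat (map_mx (ck_eval x) X)) <->
    fpsd (fun p q : 'I_n * 'I_k => ck_eval x (X p.1 q.1) p.2 q.2).
  by rewrite psd_flatE; split; apply: eq_fpsd => p q; rewrite map_mx_entry.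
split=> h x; first apply/E.
  by have := h x; congr (psd _); apply/matrixP => p q; rewrite !mxE.
have /E := h x; congr (psd _); apply/matrixP => p q; by rewrite !mxE.
Qed.

Lemma ck_eval_ucp x : @ucp R (Ck_mos R k) (mx_mos R k) (ck_eval x).
Proof.
split; [exact: ck_eval_linear|exact: ck_eval_one|move=> n X /ck_coneE h].
by rewrite /= psd_flatE; apply: eq_fpsd (h x) => p q; rewrite map_mx_entry.
Qed.

Fact ck_ramp_unit_subproof (a b : 'I_k) :
  eltm a b (C01_cst 1) - eltm a b (C01_coord R) \in span_pred (@Ck_gen R k).
Proof.
apply/span_predP; rewrite -[eltm a b (C01_cst 1)]scale1r -scaleN1r.
rewrite -[_ *: eltm _ _ (C01_coord R)]addr0.
apply: lin_spanZD; first by apply: lin_span_gen; exists a, b; left.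
apply: lin_spanZD; last exact: lin_span0.
by apply: lin_span_gen; exists a, b; right.
Qed.

Definition ck_ramp_unit (a b : 'I_k) : Ck_mos R k := 
  exist (fun x => x \in span_pred (@Ck_gen R k)) _ (ck_ramp_unit_subproof a b).

(** A (x) (1 - t), a lift of A at the endpoint 0 that vanishes at the endpoint 1. *)
Definition ck_ramp (A : 'M[C]_k) : Ck_mos R k := \sum_a \sum_b A a b *: ck_ramp_unit a b.

Lemma ck_eval_ramp x A : ck_eval x (ck_ramp A) = rC (1 - set_val x) *: A.
Proof.
have el := ck_eval_linear x.
have uE a b : ck_eval x (ck_ramp_unit a b) = rC (1 - set_val x) *: delta_mx a b.
  apply/matrixP => i j; rewrite [LHS]mxE.
  have -> : (val (ck_ramp_unit a b) : 'M[C01 R]_k) i j =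
      (C01_cst 1 - C01_coord R) *+ ((i == a) && (j == b)).
    by rewrite !mxE mulrnBl.
  rewrite !mxE; case: (_ && _); last by rewrite mulr0.
  by rewrite mulr1 rCD rCN rmorph1.
rewrite /ck_ramp (linear_sum_of el) {2}(matrix_sum_delta A) scaler_sumr.
apply: eq_bigr => a _; rewrite (linear_sumZ el) scaler_sumr; apply: eq_bigr => b _.
by rewrite uE !scalerA mulrC.
Qed.

Lemma ck_ramp_pos n (P : 'I_n * 'I_k -> 'I_n * 'I_k -> C) : fpsd P ->
  mos_cone (\matrix_(i, j) ck_ramp (\matrix_(a, b) P (i, a) (j, b))).
Proof.
move=> pP; apply/ck_coneE => x.
have x1 : 0 <= rC (1 - set_val x).
  rewrite lecR subr_ge0; have := set_valP x.
  by rewrite /I01 /= in_itv => /andP[].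
apply: eq_fpsd (fpsdZ x1 pP) => p q.
by rewrite mxE ck_eval_ramp !mxE -!surjective_pairing.
Qed.

Fact I01_0_subproof : (0 : R) \in @I01 R.
Proof. by rewrite inE /I01 /= in_itv /= lexx ler01. Qed.
Definition I01_0 : @I01 R := exist _ 0 I01_0_subproof.

Fact I01_1_subproof : (1 : R) \in @I01 R.
Proof. by rewrite inE /I01 /= in_itv /= lexx ler01. Qed.
Definition I01_1 : @I01 R := exist _ 1 I01_1_subproof.

End AffineMatrixFunctions.

(** * Maps out of the coproduct *)

Section CoproductMaps.
Local Open Scope ring_scope.
Local Open Scope classical_set_scope.
Variable R : realType.
Local Notation C := R[i].
Local Notation cj := Num.conj.
Variables (L : choiceType) (S : L -> mospace R).
Local Notation D := (dsum (fun l => S l : lmodType C)).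

Lemma coprod_cone_sum n (F : {fset L}) (x : forall l, 'M[S l]_n) :
  (forall l, mos_cone (x l)) ->
  @mos_cone R (coprod_mos S) n (\sum_(l <- F) map_mx (@coprod_in R L S l) (x l)).
Proof.
move=> cx; exists F, x; split=> // w hw _.
by rewrite big_seq; apply: sumr_ge0 => l lF; have [_ _] := hw l lF; exact.
Qed.

(* Vector states of compatible matrix representations of the summands are a
   compatible family of states. *)
Lemma coprod_map_cp (kap n : nat) (g : forall l, S l -> 'M[C]_kap)
    (h : coprod_mos S -> 'M[C]_kap) (X : 'M[coprod_mos S]_n) :
    (forall l, @ucp R (S l) (mx_mos R kap) (@g l)) ->
    linear h -> (forall l x, h (@coprod_in R L S l x) = g l x) ->
  mos_cone X -> fpsd (fun p q : 'I_n * 'I_kap => h (X p.1 q.1) p.2 q.2).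
Proof.
move=> gu hl hE [F [x [-> wF]]] v.
pose N := \sum_p v p * cj (v p).
have N0 : 0 <= N by exact: normE_sum.
pose s l (Y : 'M[S l]_n) := sform (fun p q : 'I_n * 'I_kap => g l (Y p.1 q.1) p.2 q.2) v v.
have sE : sform (fun p q : 'I_n * 'I_kap =>
    h ((\sum_(l <- F) map_mx (@coprod_in R L S l) (x l)) p.1 q.1) p.2 q.2) v v =
    \sum_(l <- F) s l (x l).
  rewrite /s -sform_sum; apply: eq_bigr => p _; apply: eq_bigr => q _; congr (_ * _ * _).
  rewrite summxE (linear_sum_of hl) summxE; apply: eq_bigr => l _.
  by rewrite map_mx_entry hE.
have sl l a (Y Z : 'M[S l]_n) : s l (mxscale a Y + Z) = a * s l Y + s l Z.
  have [gl _ _] := gu l; rewrite /s -sformZ -sformD.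
  apply: eq_bigr => p _; apply: eq_bigr => q _; congr (_ * _ * _).
  by rewrite mxD_entry map_mx_entry gl !mxE.
have s1 l (a : 'M[C]_n) : s l (mxunit (S l) a) =
    sform (fun p q : 'I_n * 'I_kap => a p.1 q.1 * (p.2 == q.2)%:R) v v.
  have [gl g1 _] := gu l; apply: eq_bigr => p _; apply: eq_bigr => q _.
  by rewrite map_mx_entry (linearZ_of gl) g1 !mxE.
have sp l (Y : 'M[S l]_n) : mos_cone Y -> 0 <= s l Y.
  have [_ _ gp] := gu l => /gp; rewrite /= psd_flatE => /(_ v).
  by congr (0 <= _); apply: eq_bigr => p _; apply: eq_bigr => q _; rewrite map_mx_entry.
have sN l : s l (mxunitr (S l) n 1) = N.
  rewrite [LHS]s1 /N -sform_id; apply: eq_bigr => p _; apply: eq_bigr => q _; congr (_ * _ * _).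
  by rewrite mxE -mulr_natr rmorph1 mul1r -natrM mulnb -xpair_eqE -!surjective_pairing.
(* States have to be normalized by N; N = 0 means v = 0, and the form vanishes. *)
rewrite sE; have [N00|NN] := eqVneq N 0.
  have v0 p : v p = 0.
    have /eqP := N00; rewrite psumr_eq0 => [|q _]; last exact: mul_conjC_ge0.
    by move=> /allP/(_ p (mem_index_enum p)); rewrite mul_conjC_eq0 => /eqP.
  rewrite big1// => l _; apply: big1 => p _; apply: big1 => q _.
  by rewrite v0 !mul0r.
have Ni : 0 <= N^-1 by rewrite invr_ge0.
have := wF (fun l Y => N^-1 * s l Y); rewrite -mulr_sumr => wS.
have Np : 0 < N^-1 by rewrite invr_gt0 lt_neqAle eq_sym NN.
rewrite -(pmulr_rge0 _ Np); apply: wS => [l _|l m _ _ a]; last by rewrite !s1.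
split=> [a Y Z||Y cY].
- by rewrite sl mulrDr mulrCA.
- by rewrite sN mulVf.
- by rewrite mulr_ge0// sp.
Qed.

Section Lift.
Variables (W : lmodType C) (g : forall l, S l -> W) (e : W).
Hypothesis g_linear : forall l, linear (@g l).
Hypothesis g_one : forall l, g (mos_one (S l)) = e.

Definition coprod_lift (z : coprod_mos S) : W := qlift (dsum_lift g) (z : qspan (@coprod_rel R L S)).

Let lift_rel z : @coprod_rel R L S z -> dsum_lift g z = 0.
Proof.
have dl := dsum_lift_linear g_linear.
move=> [l [m ->]]; rewrite -[_ - _]addrC -scaleN1r dl.
by rewrite !(dsum_lift_in g_linear) !g_one scaleN1r addNr.
Qed.

Lemma coprod_lift_linear : linear coprod_lift.
Proof. exact: (qlift_linear (dsum_lift_linear g_linear) lift_rel). Qed.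

Lemma coprod_lift_in l x : coprod_lift (@coprod_in R L S l x) = g x.
Proof.
by rewrite /coprod_lift (qlift_proj (dsum_lift_linear g_linear) lift_rel) dsum_lift_in.
Qed.

End Lift.
End CoproductMaps.

Section CoproductOntoBlocks.
Local Open Scope ring_scope.
Local Open Scope classical_set_scope.
Variable R : realType.
Local Notation C := R[i].
Variables (L : choiceType) (k : L -> nat).
Local Notation T := (bds R (fun l => (k l).+1)).
Local Notation CK := (fun l => Ck_mos R (k l).+1).

(** A vector state at the endpoint 1: it is 1 on the unit and kills every [ck_ramp]. The entry (0,
    0) exists because the sizes are successors. *)
Definition ck_corner K (Y : Ck_mos R K.+1) : C := ck_eval (I01_1 R) Y ord0 ord0.

Lemma ck_corner_linear K (a : C) (X Y : Ck_mos R K.+1) :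
  ck_corner (a *: X + Y) = a * ck_corner X + ck_corner Y.
Proof. by rewrite /ck_corner ck_eval_linear !mxE. Qed.

Lemma ck_corner_one K : ck_corner (mos_one (Ck_mos R K.+1)) = 1.
Proof. by rewrite /ck_corner ck_eval_one mxE. Qed.

Lemma ck_corner_ucp K m : @ucp R (Ck_mos R K.+1) (mx_mos R m) (fun Y => (ck_corner Y)%:M).
Proof.
split.
- by move=> a X Y; apply/matrixP => i j; rewrite ck_corner_linear !mxE mulrnDl mulrnAr.
- by rewrite ck_corner_one.
move=> n X /ck_coneE/(_ (I01_1 R)) h; rewrite /= psd_flatE.
have := fpsd_reindex (fun i : 'I_n => (i, ord0)) h.
move=> /fpsd_tensor/(_ (@fpsd_id R 'I_m)); apply: eq_fpsd => p q.
by rewrite map_mx_entry [RHS]mxE mulr_natr.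
Qed.

Lemma ck_corner_ramp K (A : 'M[C]_K.+1) : ck_corner (ck_ramp A) = 0.
Proof. by rewrite /ck_corner ck_eval_ramp /= subrr scale0r mxE. Qed.

(** Block l of the image is x(0); every other block and the limit are the scalar x(1)_00. All of
    these are ucp in x. *)
Definition ck_to_bds l (Y : Ck_mos R (k l).+1) : T :=
  ck_corner Y *: mos_one T +
  @bds_in R L (fun l => (k l).+1) l (ck_eval (I01_0 R) Y - (ck_corner Y)%:M).

Lemma ck_to_bds_linear l : linear (@ck_to_bds l).
Proof.
move=> a X Y; rewrite /ck_to_bds ck_corner_linear scalerDl -scalerA.
rewrite scalerDr addrACA; congr (_ + _).
rewrite -bds_in_linear; congr bds_in; rewrite ck_eval_linear.
by apply/matrixP => i j; rewrite !mxE; ring.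
Qed.

Lemma ck_to_bds_one l : ck_to_bds (mos_one (Ck_mos R (k l).+1)) = mos_one T.
Proof.
rewrite /ck_to_bds ck_corner_one ck_eval_one subrr scale1r.
by rewrite (linear0_of (@bds_in_linear R L (fun l => (k l).+1) l)) addr0.
Qed.

Lemma ck_to_bds_limit l (Y : Ck_mos R (k l).+1) :
  @bds_limit R L (fun l => (k l).+1) (ck_to_bds Y) = (ck_corner Y)%:M.
Proof.
by rewrite /bds_limit /= addr0 [_ *: _]mulr1.
Qed.

Local Notation bcoord := (@bds_coord R L (fun l => (k l).+1)).

Lemma ck_to_bds_coord l m (Y : Ck_mos R (k l).+1) : bcoord m (ck_to_bds Y) =
  (ck_corner Y)%:M +
  bcoord m (@bds_in R L (fun l => (k l).+1) l (ck_eval (I01_0 R) Y - (ck_corner Y)%:M)).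
Proof.
rewrite /ck_to_bds (@bds_coord_linear R L (fun l => (k l).+1) m).
by rewrite bds_coord_one scalemx1.
Qed.

Definition coprod_to_bds : coprod_mos CK -> T := coprod_lift ck_to_bds.

Lemma coprod_to_bds_linear : linear coprod_to_bds.
Proof. exact: (coprod_lift_linear ck_to_bds_linear ck_to_bds_one). Qed.

Lemma coprod_to_bds_in l Y : coprod_to_bds (@coprod_in R L CK l Y) = ck_to_bds Y.
Proof. exact: (coprod_lift_in ck_to_bds_linear ck_to_bds_one). Qed.

(** The limit and each block of the image restrict to ucp maps on all the summands, as
    [coprod_map_cp] requires; [l0] names a summand whose unit is the unit of the coproduct. *)
Lemma coprod_to_bds_ucp (l0 : L) : ucp coprod_to_bds.
Proof.
split; first exact: coprod_to_bds_linear.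
  by rewrite /= (coprod_oneE _ l0) coprod_to_bds_in ck_to_bds_one.
move=> n X cX; apply/bds_coneE; split=> [|m].
  rewrite /= psd_flatE.
  pose h z := @bds_limit R L (fun l => (k l).+1) (coprod_to_bds z).
  apply: (@eq_fpsd R _ (fun p q : 'I_n * 'I_1 => h (X p.1 q.1) p.2 q.2)) => [p q|].
    by rewrite !map_mx_entry.
  apply: (@coprod_map_cp R L CK 1 n (fun l Y => (ck_corner Y)%:M)) => //.
  - by move=> l; exact: ck_corner_ucp.
  - by move=> a x y; rewrite /h coprod_to_bds_linear (@bds_limit_linear R L (fun l => (k l).+1)).
  - by move=> l Y; rewrite /h coprod_to_bds_in ck_to_bds_limit.
rewrite /= psd_flatE.
pose h z := bcoord m (coprod_to_bds z).
pose g l (Y : Ck_mos R (k l).+1) : 'M[C]_((k m).+1) := bcoord m (ck_to_bds Y).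
apply: (@eq_fpsd R _ (fun p q : 'I_n * 'I_(k m).+1 => h (X p.1 q.1) p.2 q.2)) => [p q|].
  by rewrite !map_mx_entry.
apply: (@coprod_map_cp R L CK (k m).+1 n g) => //.
- move=> l; have [lm|lm] := eqVneq l m.
    subst m; rewrite (_ : @g l = ck_eval (I01_0 R)); first exact: ck_eval_ucp.
    by apply: funext => Y; rewrite /g ck_to_bds_coord bds_coord_in addrC subrK.
  rewrite (_ : @g l = fun Y => (ck_corner Y)%:M); first exact: ck_corner_ucp.
  by apply: funext => Y; rewrite /g ck_to_bds_coord bds_coord_in_neq// addr0.
- by move=> a x y; rewrite /h coprod_to_bds_linear (@bds_coord_linear R L (fun l => (k l).+1) m).
- by move=> l Y; rewrite /h coprod_to_bds_in.
Qed.

Section LiftingFamilies.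
Variables (E : opsys R) (B : forall l, 'I_(k l).+1 -> 'I_(k l).+1 -> E).

(** A derivation of [liftable] may use the same l several times, while the coproduct cone has one
    entry per l; repeated coefficients are added up. *)
Lemma liftable_family n (x : 'I_n -> 'I_n -> E) :
  @liftable R L (fun l => (k l).+1) E B n x ->
  exists (F : {fset L}) (P : forall l, 'I_n * 'I_(k l).+1 -> 'I_n * 'I_(k l).+1 -> C),
    (forall l, fpsd (P l)) /\ forall i j, x i j =
      \sum_(l <- F) \sum_a \sum_b P l (i, a) (j, b) *: B a b.
Proof.
elim=> [|l P0 {}x pP0 _ [F [P [pP xE]]]].
  exists fset0, (fun _ _ _ => 0); split.
    by move=> l; apply: eq_fpsd (fpsdZ (lexx 0) (@fpsd_id R _)) => p q; rewrite mul0r.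
  by move=> i j; rewrite big_seq_fset0.
have [lF|lF] := boolP (l \in F).
  pose P1 p q := P0 p q + P l p q.
  exists F, (dfwith P l P1); split.
    by move=> m; case: dfwithP => //; exact: fpsdD.
  move=> i j; rewrite xE (bigD1_seq l)//= [RHS](bigD1_seq l)//= addrA dfwithin.
  congr (_ + _).
    rewrite -big_split; apply: eq_bigr => a _; rewrite -big_split; apply: eq_bigr => b _ /=.
    by rewrite scalerDl.
  by apply: eq_bigr => m ml; rewrite dfwithout// eq_sym.
exists (l |` F)%fset, (dfwith P l P0); split.
  by move=> m; case: dfwithP.
move=> i j; rewrite xE big_fsetU1//= dfwithin; congr (_ + _).
rewrite big_seq [RHS]big_seq; apply: eq_bigr => m mF.
by rewrite dfwithout//; apply: contraNneq lF => ->.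
Qed.

(** The ramps of the coefficient matrices form the lift, since [ck_to_bds] maps a ramp to its value
    at 0 in block l with limit 0. *)
Lemma liftable_coprod n (x : 'I_n -> 'I_n -> E) :
  @liftable R L (fun l => (k l).+1) E B n x ->
  exists Z : 'M[coprod_mos CK]_n, mos_cone Z /\
    forall i j, bds_map B (coprod_to_bds (Z i j)) = x i j.
Proof.
move=> /liftable_family[F [P [pP xE]]].
pose Y l : 'M[CK l]_n := \matrix_(i, j) ck_ramp (\matrix_(a, b) P l (i, a) (j, b)).
exists (\sum_(l <- F) map_mx (@coprod_in R L CK l) (Y l)); split.
  by apply: coprod_cone_sum => l; exact: ck_ramp_pos.
move=> i j; rewrite summxE (linear_sum_of coprod_to_bds_linear).
rewrite (linear_sum_of (bds_map_linear B)) xE; apply: eq_bigr => l _.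
rewrite map_mx_entry coprod_to_bds_in /ck_to_bds mxE ck_corner_ramp scale0r add0r.
rewrite (_ : ck_eval _ _ - _ = \matrix_(a, b) P l (i, a) (j, b)); last first.
  by rewrite ck_eval_ramp /= subr0 scale1r raddf0 subr0.
rewrite (@bds_map_in R L (fun l => (k l).+1)).
by apply: eq_bigr => a _; apply: eq_bigr => b _; rewrite mxE.
Qed.

End LiftingFamilies.

End CoproductOntoBlocks.

(** * Nuclearity from the lifting property *)

Section NuclearityFromLifting.
Local Open Scope ring_scope.
Local Open Scope classical_set_scope.
Variable R : realType.
Local Notation C := R[i].
Local Notation rC r := ((r%:C)%C : C).

Lemma quotient_of_comp (T1 T2 T3 : mospace R) (f : T1 -> T2) (g : T2 -> T3) :
  ucp f -> ucp g -> complete_order_quotient (g \o f) -> complete_order_quotient g.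
Proof.
move=> [_ _ fp] gu [_ surj lift]; split=> // [y|n Q e cQ e0].
  by have [x <-] := surj y; exists (f x).
have [P [cP PE]] := lift n Q e cQ e0; exists (map_mx f P); split; first exact: fp.
by rewrite -PE; apply/matrixP => i j; rewrite !map_mx_entry.
Qed.

Lemma map_mxD_unitr (S T : mospace R) (f : S -> T) n (X : 'M[S]_n) e : linear f ->
  f (mos_one S) = mos_one T -> map_mx f (X + mxunitr S n e) = map_mx f X + mxunitr T n e.
Proof.
move=> fl f1; rewrite -(map_mxunitr n e fl f1); move: (mxunitr S n e) => Y.
by apply/matrixP => i j; rewrite [RHS]mxD_entry !map_mx_entry mxD_entry (linearD_of fl).
Qed.

Section IdTensMaps.
Variables (S T1 T2 : mospace R) (f : T1 -> T2).
Hypothesis fl : linear f.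

Lemma id_tens_tm_map k l (g : S -> 'M[C]_k) (h : T2 -> 'M[C]_l) :
    linear g -> linear h -> forall z : min_model S T1,
  tm_map g h (@id_tens R S T1 T2 f z : min_model S T2) = tm_map g (h \o f) z.
Proof.
move=> gl hl; have il := @id_tens_linear R S T1 T2 f fl.
have ml := @tm_map_linear R S T2 (min_model S T2) k l g h gl hl.
have hfl : linear (h \o f) by move=> a x y /=; rewrite fl hl.
apply: (@tm_ext _ _ _ (min_model S T1) _
  (fun z => tm_map g h (@id_tens R S T1 T2 f z : min_model S T2))).
- by move=> a x y; rewrite il ml.
- exact: tm_map_linear.
- by move=> s t; rewrite (id_tensE fl) !tm_mapE.
Qed.

Lemma id_tens_comp (T3 : mospace R) (g : T2 -> T3) : linear g ->
  forall z : min_model S T1,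
  @id_tens R S T2 T3 g (@id_tens R S T1 T2 f z) = @id_tens R S T1 T3 (g \o f) z.
Proof.
move=> gl; have gfl : linear (g \o f) by move=> a x y /=; rewrite fl gl.
apply: (@tm_ext _ _ _ (min_model S T1) (min_model S T3)
  (fun z => @id_tens R S T2 T3 g (@id_tens R S T1 T2 f z)) (@id_tens R S T1 T3 (g \o f))).
- by move=> a x y; rewrite (@id_tens_linear R S T1 T2 f fl) (@id_tens_linear R S T2 T3 g gl).
- exact: (@id_tens_linear R S T1 T3 _ gfl).
- by move=> s t; rewrite (id_tensE fl) (id_tensE gl) (id_tensE gfl).
Qed.

End IdTensMaps.

Local Notation L := {classic {K : nat & nat}}.

(** The summand (K, m) receives the integral matrix of size K + 1 with code m if that is a positive
    matrix over E, and 0 otherwise, scaled down by [weights]. *)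
Lemma affine_coproduct_quotient (E : opsys R) d (p : 'I_d -> E) :
    (forall j, pos_elt (p j)) -> (forall x, exists c : 'I_d -> C, x = \sum_j c j *: p j) ->
  exists B : forall l : L, 'I_(tag l).+1 -> 'I_(tag l).+1 -> E,
    ucp (bds_map B) /\
    complete_order_quotient (bds_map B \o @coprod_to_bds R L (fun l => tag l)).
Proof.
move=> p_pos p_span.
pose Q (l : L) : 'I_(tag l).+1 -> 'I_(tag l).+1 -> E :=
  if (choice.unpickle (tagged l) : option (int_mx d (tag l).+1)) is Some c then
    if `[< fcone (int_comb p c) >] then int_comb p c else fun _ _ => 0
  else fun _ _ => 0.
have Q_pos l : fcone (Q l).
  rewrite /Q; case: choice.unpickle => [c|]; last exact: fcone0.
  by case: asboolP => // _; exact: fcone0.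
have tr_pos l : pos_elt (\sum_a Q l a a).
  by apply: fcone_sum => a _; exact: (fcone_reindex (fun=> a) (Q_pos l)).
have [w [w0 wS]] :=
  @weights R L (choice.pickle : L -> nat) E _ (pcan_inj (@choice.pickleK {K : nat & nat})) tr_pos.
pose B (l : L) a b := rC (w l) *: Q l a b.
have B_pos l : fcone (@B l) by exact: fconeZ (ltW (w0 l)) (Q_pos l).
have B_small (s : seq L) : uniq s ->
    pos_elt (mos_one E - \sum_(l <- s) \sum_a @B l a a).
  move=> us; have := wS s us; congr pos_elt; congr (_ - _).
  by apply: eq_bigr => l _; rewrite scaler_sumr.
have B_int K (c : int_mx d K.+1) : fcone (int_comb p c) ->
    forall n (P : 'I_n * 'I_K.+1 -> 'I_n * 'I_K.+1 -> C), fpsd P ->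
    liftable B (fun i j => \sum_a \sum_b P (i, a) (j, b) *: int_comb p c a b).
  (* The weight of this summand is undone by rescaling P. *)
  move=> cc n P pP; pose l : L := existT _ K (choice.pickle c).
  have QE : Q l = int_comb p c by rewrite /Q /= choice.pickleK asboolT.
  have wi : 0 <= rC (w l)^-1 by rewrite lecR invr_ge0 ltW.
  have := @liftable_add R L _ E B n l _ _ (fpsdZ wi pP) (liftable0 B n).
  apply: eq_liftable => i j; rewrite addr0.
  apply: eq_bigr => a _; apply: eq_bigr => b _.
  by rewrite /B QE scalerA mulrAC rCVK// mul1r.
have Bu := bds_map_ucp B_pos B_small.
exists B; split=> //; apply: (@lifting_quotient R L _ E B).
- by apply: ucp_comp Bu; apply: coprod_to_bds_ucp; exact: (existT (fun=> nat) 0%N 0%N : L).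
- by move=> n x /liftable_coprod.
- by move=> n M e cM e0; exact: (liftable_positive p_pos p_span).
Qed.

Lemma pos_span_seq (T : opsys R) (r : seq T) : exists q : seq T,
  (forall x, x \in q -> pos_elt x) /\ forall t, t \in r -> lin_span [set x | x \in q] t.
Proof.
have mono (A B : set T) x : A `<=` B -> lin_span A x -> lin_span B x.
  by move=> AB [n [c [u [Au ->]]]]; exists n, c, u; split=> // i; exact/AB.
elim: r => [|t r [q [qp qr]]]; first by exists [::].
have [n [c [u [pu tE]]]] := pos_elt_span t.
exists (codom u ++ q); split.
  by move=> x; rewrite mem_cat => /orP[/codomP[i ->]|]; [exact: pu|exact: qp].
move=> y; rewrite inE => /orP[/eqP ->|yr].
  by exists n, c, u; split=> // i /=; rewrite mem_cat codom_f.
by apply: mono (qr _ yr) => x /= xq; rewrite mem_cat xq orbT.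
Qed.

Section Descent.
Variables (S T : opsys R) (n : nat) (X : 'M[min_model S T]_n).
Hypothesis cX : mos_cone X.

(* X comes from S (x) E for a finite-dimensional operator subsystem E of T;
   positivity descends to E by Arveson's theorem. *)
Lemma min_cone_descent : exists (E : opsys R) (d : nat) (p : 'I_d -> E) (v : E -> T)
    (X' : 'M[min_model S E]_n),
  [/\ forall j, pos_elt (p j),
      forall x, exists c : 'I_d -> C, x = \sum_j c j *: p j,
      ucp v, mos_cone X' & map_mx (@id_tens R S E T v) X' = X].
Proof.
have /choice[s sE] (u : 'I_n * 'I_n) := tm_sum (X u.1 u.2).
(* The unit is included so that the span of q is an operator subsystem. *)
have [q [qp qr]] := pos_span_seq
  (mos_one T :: flatten [seq [seq z.2 | z <- s u] | u <- enum {: 'I_n * 'I_n}]).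
pose p := tnth (in_tuple q).
have p_pos j : pos_elt (p j) by apply: qp; exact: mem_tnth.
have qE : [set x | x \in q] = range p.
  apply/seteqP; split=> x /=; last by case=> j _ <-; exact: mem_tnth.
  by move=> xq; have /(tnthP (in_tuple q))[j ->] : x \in in_tuple q by []; exists j.
rewrite qE in qr.
have U_one : lin_span (range p) (mos_one T) by apply: qr; rewrite mem_head.
have qs u z : z \in s u -> lin_span (range p) z.2.
  move=> zs; apply: qr; rewrite inE; apply/orP; right; apply/flattenP.
  by exists [seq z.2 | z <- s u]; [apply: map_f; rewrite mem_enum|exact: map_f].
pose E := span_opsys p_pos U_one.
pose v : E -> T := @span_val R T _ p p_pos U_one.
have vu : ucp v by have [] := span_val_embedding p_pos U_one.
have vl : linear v by [].
(* A section of the inclusion v on its range, with value 0 elsewhere; it is only evaluated at the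
   second factors of X. *)
have /choice[g gE] (t : T) : exists t' : E, lin_span (range p) t -> v t' = t.
  have [ht|] := pselect (lin_span (range p) t); last by exists 0.
  by exists (exist _ t (introT (span_predP _ _) ht)).
pose X' : 'M[min_model S E]_n :=
  \matrix_(i, j) \sum_(z <- s (i, j)) tm_tens (min_model S E) z.1 (g z.2).
have X'E : map_mx (@id_tens R S E T v) X' = X.
  apply/matrixP => i j; rewrite map_mx_entry mxE (linear_sum_of (id_tens_linear vl)).
  rewrite (sE (i, j)) big_seq [RHS]big_seq; apply: eq_bigr => z zs.
  by rewrite (id_tensE vl) gE//; exact: qs zs.
exists E, (size q), (span_gen p_pos U_one), v, X'; split=> //.
- exact: span_gen_pos.
- exact: span_gen_span.
apply/tm_coneP => k l f h fu hu; have [fl _ _] := fu; have [hl _ _] := hu.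
(* A ucp map h on E extends to h' on T, so f (x) h at X' is f (x) h' at X. *)
have [h' [h'u h'E]] := ucp_extension (span_val_embedding p_pos U_one) hu.
have [h'l _ _] := h'u.
have /tm_coneP/(_ _ _ _ _ fu h'u) := cX; apply: eq_fpsd => a b.
rewrite -X'E map_mx_entry (id_tens_tm_map vl fl h'l).
by rewrite (_ : h' \o v = h)//; apply: funext.
Qed.

End Descent.

(** The hypothesis is shaped to follow from both (iii) and (iv): the quotient map onto E comes
    factored through an operator system T, here [bds], over which the lift is sought. *)
Lemma nuclear_of_lifting (S : opsys R) :
    (forall (E T : opsys R) (f : CI_mos R (fun=> nat) -> T) (g : T -> E),
      finite_dimensional E -> ucp f -> ucp g -> complete_order_quotient (g \o f) ->
      forall n (Q : 'M[min_model S E]_n) e, mos_cone Q -> 0 < e ->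
      exists P : 'M[min_model S T]_n, mos_cone P /\
        map_mx (@id_tens R S T E g) P = Q + mxunitr (min_model S E) n e) ->
  nuclear S.
Proof.
move=> lift; apply: nuclear_of_max_form => T n X cX e e0.
have [E [d [p [v [X' [p_pos p_span vu cX' <-]]]]]] := min_cone_descent cX.
have [B [Bu Bq]] := affine_coproduct_quotient p_pos p_span.
have cu := @coprod_to_bds_ucp R L (fun l => tag l) (existT (fun=> nat) 0%N 0%N : L).
have Efd : finite_dimensional E by exists d, p.
have [P [cP PE]] := lift E _ _ _ Efd cu Bu Bq n X' e cX' e0.
have [vl v1 _] := vu; have [Bl _ _] := Bu.
have il := @id_tens_linear R S E T v vl.
have iE := @id_tensE R S E T v vl.
have i1 : @id_tens R S E T v (mos_one (min_model S E)) = mos_one (min_model S T).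
  by rewrite -!tm_one iE v1.
rewrite -(@map_mxD_unitr (min_model S E) (min_model S T) _ n X' e il i1) -PE.
(* The lift over [bds] has maximal form, and this form is carried along the ucp maps to E and then
   to T. *)
apply: (@tm_map_max_form R S E T (min_model S E) (min_model S T) v _ il iE _ _ vu).
apply: (@tm_map_max_form R S _ E (min_model S _) (min_model S E) _ _
  (@id_tens_linear R S _ E _ Bl) (@id_tensE R S _ E _ Bl) _ _ Bu).
exact: bds_nuclear.
Qed.

End NuclearityFromLifting.

Local Open Scope classical_set_scope.
Local Open Scope card_scope.

Theorem theorem5p3 (R : realType) (S : opsys R) :
  [<-> nuclear S;
       forall (T1 T2 : opsys R) (f : T1 -> T2),
         complete_order_quotient f ->
         complete_order_quotient (@id_tens R S T1 T2 f);
       forall (I : Type) (J : nat -> Type) (T : opsys R)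
           (f : CI_mos R J -> T),
         [set: I] !=set0 ->
         (forall k, [set: J k] #= [set: I]) ->
         complete_order_quotient f ->
         complete_order_quotient (@id_tens R S (CI_mos R J) T f);
       forall (T E : opsys R) (f : T -> E),
         finite_dimensional E ->
         complete_order_quotient f ->
         complete_order_quotient (@id_tens R S T E f)].
Proof.
have lift3 : (forall (T E : opsys R) (f : T -> E), finite_dimensional E ->
    complete_order_quotient f -> complete_order_quotient (@id_tens R S T E f)) ->
    nuclear S.
  move=> h; apply: nuclear_of_lifting => E T f g Efd fu gu gfq.
  (* The second factor g is itself a quotient map, since lifts for the composite can be pushed
     forward along f. *)
  by have [_ _] := h T E g Efd (quotient_of_comp fu gu gfq); exact.
have lift2 : (forall (I : Type) (J : nat -> Type) (T : opsys R)
    (f : CI_mos R J -> T), [set: I] !=set0 ->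
    (forall k, [set: J k] #= [set: I]) -> complete_order_quotient f ->
    complete_order_quotient (@id_tens R S (CI_mos R J) T f)) -> nuclear S.
  move=> h; apply: nuclear_of_lifting => E T f g _ fu gu gfq n Q e cQ e0.
  have NN : [set: nat] !=set0 by exists 0.
  (* Here the whole composite from the coproduct is lifted, and the lift is then pushed forward from
     the coproduct to T. *)
  have [_ _ lift] := h nat (fun=> nat) E _ NN (fun=> card_eqxx _) gfq.
  have [fl _ _] := fu; have [gl _ _] := gu; have [gfl _ _] := ucp_comp fu gu.
  have [_ _ Fp] := @tm_map_ucp R S _ T (min_model S _) (min_model S T) f
    (@id_tens R S _ T f) (@id_tens_linear R S _ T f fl) (@id_tensE R S _ T f fl) fu.
  have [P [cP PE]] := lift n Q e cQ e0.
  exists (map_mx (@id_tens R S _ T f) P); split; first exact: Fp.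
  rewrite -PE; apply/matrixP => i j; rewrite !map_mx_entry.
  exact: (@id_tens_comp R S _ T f fl E g gl (P i j)).
tfae.
- by move=> nS T1 T2 f; exact: nuclear_quotient.
(* Condition (ii) speaks of operator systems, so it is not applied to the coproduct itself: it
   contains (iv), which gives nuclearity, and nuclearity handles any source. *)
- move=> h I J T f _ _; apply: nuclear_quotient; apply: lift3 => T' E f' _.
  exact: h.
- by move=> h T E f _; apply: nuclear_quotient; exact: lift2.
- exact: lift3.
Qed.
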